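(* Let $X$ be a compact Riemann surface of genus $g\ge2$, $n\ge1$, and let $(E,\Phi,\omega)\in\mathcal{M}_{\mathrm{SO}(2n+1,\mathbb{C})}(X,K_X)$ be of $\mathfrak{sl}(2)$-type with irreducible and reduced ($\mathrm{Sp}(2n,\mathbb{C})$-)spectral curve $\Sigma$. Let $(E_3,\Phi_3,\omega_3)$ be the corresponding $\pi_n^*K_X$-twisted $\mathrm{SO}(3,\mathbb{C})$-Higgs bundle on $\Sigma/\sigma$, with its solution $h_3$ of the decoupled Hitchin equation. Then the pushforward along $\pi_n$ defines a solution $h_{dc}$ to the decoupled Hitchin equation on $(E,\Phi,\omega)$ (as a Hermitian metric which may be singular on $Z(a_{2n})\cup\mathrm{supp}(B)$, where $B$ is the branch divisor of $\pi_n:\Sigma/\sigma\to X$).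
   Context: **Higgs bundles.** An $N$-twisted $\mathrm{SO}(2n+1,\mathbb{C})$-Higgs bundle is $(E,\Phi,\omega)$ with $E$ of rank $2n+1$, $\det E$ trivial, $\omega$ a non-degenerate holomorphic symmetric form on $E$, $\Phi\in H^0(\mathrm{End}(E)\otimes N)$, $\omega(\Phi\cdot,\cdot)=-\omega(\cdot,\Phi\cdot)$; stable if isotropic $\Phi$-invariant proper non-zero subbundles have negative degree. $\mathcal{M}_{\mathrm{SO}(2n+1,\mathbb{C})}(X,K_X)$ is the moduli space of stable $K_X$-twisted ones. The characteristic polynomial of $\Phi$ is $\lambda(\lambda^{2n}+a_2\lambda^{2n-2}+\dots+a_{2n})$. $\Sigma\subset\mathrm{Tot}(K_X)$ is the zero divisor of $\lambda^{2n}+a_2\lambda^{2n-2}+\dots+a_{2n}$, $\sigma:\lambda\mapsto-\lambda$, $\pi_n:\Sigma/\sigma\to X$. $\mathfrak{sl}(2)$-type means $\Sigma/\sigma$ is smooth. $-\lambda^2$ descends to $b_2\in H^0(\Sigma/\sigma,\pi_n^*K_X^2)$. **Corresponding $\mathrm{SO}(3,\mathbb{C})$-Higgs bundle.** $(E_3,\Phi_3,\omega_3)$ is the unique stable $\pi_n^*K_X$-twisted $\mathrm{SO}(3,\mathbb{C})$-Higgs bundle on $\Sigma/\sigma$ with characteristic polynomial $\lambda(\lambda^2+b_2)$ such that $(\ker(\Phi)^\perp,\Phi|,\omega|)\cong\pi_{n*}\big(\ker(\Phi_3)^\perp\otimes\pi_n^*K_X^{n-1},\Phi_3|,(\partial\pi_n)^{-1}\omega_3|\big)$;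 $E$ is a uniquely determined Hecke modification at $Z(a_{2n})$ of $\ker(\Phi)\oplus\ker(\Phi)^\perp$, and the two agree over $X\setminus Z(a_{2n})$. One has $\mathcal{O}(\mathrm{div}(\partial\pi_n))\cong\pi_n^*K_X^{2n-2}$, so $|\partial\pi_n|^{-1}$ is a singular flat metric on $\pi_n^*K_X^{n-1}$. **Decoupled Hitchin equation.** A Hermitian metric $h$ compatible with $\omega$ (i.e. a reduction of structure group to the maximal compact subgroup) solves the decoupled Hitchin equation if its Chern connection is flat and the Higgs field is normal with respect to $h$ ($[\Phi\wedge\Phi^{*_h}]=0$ in the $K_X$-twisted case). **Construction of $h_3$.** Via $\mathrm{Ad}:\mathrm{GL}(2,\mathbb{C})\to\mathrm{SO}(3,\mathbb{C})$, $(E_3,\Phi_3,\omega_3)$ is induced by a rank 2 Higgs bundle $(E',\Phi')$ on $\Sigma/\sigma$ with $\mathrm{tr}\,\Phi'=0$. Let $h_{\det}$ be a Hermitian–Einstein metric on $\det E'$. Let $\tilde\pi_2:\tilde\Sigma\to\Sigma/\sigma$ be the double covering given by the normalised spectral curve of $\Phi'$, $\lambda$ the eigenvalue section, $L=\ker(\tilde\pi_2^*\Phi'-\lambda)$, $D$ the divisor of vanishing orders of $\Phi'$ at the zeros of $\det\Phi'$, $s_D$ the canonical section of $\mathcal{O}(D)$. Give $L$ the Hermitian–Einstein metric $h_L$ adapted to the parabolic weights $\alpha_p=\frac12(\mathrm{div}(\lambda)-\tilde\pi_2^*D)_p$, normalised by $h_L\otimes\sigma^*h_L=\tilde\pi_2^*h_{\det}\,|\tilde\pi_2^*\det\Phi'/\tilde\pi_2^*s_D^2|$.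 Then $h_L\oplus\sigma^*h_L$ descends to a metric on $E'$ away from the zeros of $b_2$ with determinant $h_{\det}$; the metric on $E_3$ it induces through $\mathrm{Ad}$ is $h_3$, independent of the choice of $(E',\Phi')$. **The metric defined by pushforward.** On $\ker(\Phi)$ take the singular flat metric $v\mapsto|\omega(v,v)|$ and on $\ker(\Phi)^\perp=\pi_{n*}(\ker(\Phi_3)^\perp\otimes\pi_n^*K_X^{n-1})$ the metric $\pi_{n*}(h_3|\partial\pi_n|^{-1})$. Their direct sum is $h_{dc}$ on $E$ outside $Z(a_{2n})\cup\mathrm{supp}(B)$, where $B$ is the norm of the ramification divisor of $\pi_n$. *)

(* Defs.v *)
From mathcomp Require Export all_boot all_order all_algebra.
From mathcomp Require Export complex.
From mathcomp Require Export all_classical all_reals all_analysis.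
Export Order.TTheory GRing.Theory Num.Theory numFieldNormedType.Exports.

Set Implicit Arguments.
Unset Strict Implicit.
Unset Printing Implicit Defensive.

#[global] Open Scope classical_set_scope.
#[global] Open Scope complex_scope.
#[global] Open Scope sesquilinear_scope.
#[global] Open Scope ring_scope.

(* [R[i]^o] is [R[i]] with the topology and the normed structure of the
   modulus, so that [derivable g z 1] for [g : R[i]^o -> R[i]^o] is complex
   differentiability. *)

Definition hol1 (R : realType) (g : R[i] -> R[i]) (z : R[i]) : Prop :=
  \forall w \near (z : R[i]^o), derivable (g : R[i]^o -> R[i]^o) w 1.

(* [f] is given near [x] by the function [g] of the coordinate [phi]. *)
Definition germ_eq (R : realType) (X : topologicalType) (A : Type)
    (phi : X -> R[i]) (x : X) (f : X -> A) (g : R[i] -> A) : Prop :=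
  \forall y \near x, f y = g (phi y).

(* The image condition [coord_open] says that [coord c] is open onto its image,
   i.e. a homeomorphism from [dom c] to an open subset of the plane. *)
Record surface (R : realType) := Surface {
  point :> topologicalType;
  chart : Type;
  dom : chart -> set point;
  coord : chart -> point -> R[i];
  point_hausdorff : hausdorff_space point;
  point_compact : compact [set: point];
  point_connected : connected [set: point];
  point_nonempty : [set: point] !=set0;
  dom_open : forall c, open (dom c);
  dom_cover : forall x, exists c, dom c x;
  coord_inj : forall c x y, dom c x -> dom c y -> coord c x = coord c y -> x = y;
  coord_cont : forall c x, dom c x ->
    (coord c y : R[i]^o) @[y --> x] --> (coord c x : R[i]^o);
  coord_open : forall c (U : set point), open U -> U `<=` dom c ->
    open (coord c @` U : set R[i]^o);
  coord_hol : forall c c' x, dom c x -> dom c' x ->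
    exists2 g, hol1 g (coord c x) & germ_eq (coord c) x (coord c') g }.

(* [U] is meant to be open. *)
Definition hol_on (R : realType) (X : surface R) (U : set X) (f : X -> R[i]) :=
  forall (c : chart X) x, U x -> dom c x ->
    exists2 g, hol1 g (coord c x) & germ_eq (coord c) x f g.

Definition mx_hol (R : realType) (X : surface R) (U : set X) (m n : nat)
    (A : X -> 'M[R[i]]_(m, n)) := forall i j, hol_on U (fun x => A x i j).

Definition hol_map (R : realType) (X Y : surface R) (f : Y -> X) : Prop :=
  continuous f /\
  forall c : chart X, hol_on (f @^-1` dom c) (fun y => coord c (f y)).

(* Derivative at [x] of a holomorphic function with respect to [coord c]. *)
Definition dcoord (R : realType) (X : surface R) (c : chart X) (f : X -> R[i])
    (x : X) : R[i] :=
  lim (((f y - f x) / (coord c y - coord c x) : R[i]^o) @[y --> x^']).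

Definition chart_at (R : realType) (X : surface R) (x : X) : chart X :=
  projT1 (cid (dom_cover x)).

(* A bundle of rank [r] is given by its fibres, each identified with column
   vectors by some basis (chosen point by point, with no continuity), and by
   local holomorphic frames: the columns of [frame i x] are the values at [x]
   of the [i]-th frame.  Every holomorphic vector bundle has this form.
   Sections, bundle maps, forms and metrics are then matrix-valued functions,
   and their regularity is tested in the frames. *)

Record bundle (R : realType) (X : surface R) (r : nat) := Bundle {
  fidx : Type;
  fdom : fidx -> set X;
  frame : fidx -> X -> 'M[R[i]]_r }.

(* [A] is a holomorphic homomorphism from [E] to [F] over the open set [U]. *)
Definition hom_hol (R : realType) (X : surface R) (r s : nat) (E : bundle X r)
    (F : bundle X s) (U : set X) (A : X -> 'M[R[i]]_(s, r)) : Prop :=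
  forall i j, mx_hol (U `&` fdom i `&` fdom j)
    (fun x => invmx (frame (b := F) j x) *m A x *m frame (b := E) i x).

Record is_bundle (R : realType) (X : surface R) (r : nat) (E : bundle X r) :
    Prop := IsBundle {
  fdom_open : forall i, open (fdom (b := E) i);
  fdom_cover : forall x, exists i, fdom (b := E) i x;
  frame_unit : forall i x, fdom (b := E) i x -> frame i x \in unitmx;
  frame_trans : hom_hol E E setT (fun=> 1%:M) }.

Definition triv (R : realType) (X : surface R) (r : nat) : bundle X r :=
  Bundle (fun _ : unit => setT) (fun _ _ => 1%:M).

Definition pull (R : realType) (X Y : surface R) (f : Y -> X) (r : nat)
    (E : bundle X r) : bundle Y r :=
  Bundle (fun i => f @^-1` fdom (b := E) i) (fun i y => frame i (f y)).

Definition dual (R : realType) (X : surface R) (r : nat) (E : bundle X r) :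
    bundle X r :=
  Bundle (fdom (b := E)) (fun i x => (invmx (frame i x))^T).

Definition detb (R : realType) (X : surface R) (r : nat) (E : bundle X r) :
    bundle X 1 :=
  Bundle (fdom (b := E)) (fun i x => (\det (frame i x))%:M).

Definition lframe (R : realType) (X : surface R) (L : bundle X 1)
    (i : fidx L) (x : X) : R[i] := frame i x ord0 ord0.

Definition tens (R : realType) (X : surface R) (r : nat) (E : bundle X r)
    (L : bundle X 1) : bundle X r :=
  Bundle (fun ij : fidx E * fidx L => fdom ij.1 `&` fdom ij.2)
         (fun ij x => lframe ij.2 x *: frame ij.1 x).

Definition lpow (R : realType) (X : surface R) (L : bundle X 1) (m : nat) :
    bundle X 1 :=
  Bundle (fdom (b := L)) (fun i x => (lframe i x ^+ m)%:M).

(* The fibre at [x] is spanned by the differential of [coord (chart_at x)], and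
   the frame attached to a chart [c] is the differential of [coord c]. *)
Definition canonical (R : realType) (X : surface R) : bundle X 1 :=
  Bundle (@dom R X) (fun c x => (dcoord (chart_at x) (coord c) x)%:M).

Definition sec_hol (R : realType) (X : surface R) (r : nat) (E : bundle X r)
    (U : set X) (s : X -> 'cV[R[i]]_r) := hom_hol (triv X 1) E U s.

Definition lsec_hol (R : realType) (X : surface R) (L : bundle X 1)
    (U : set X) (s : X -> R[i]) := sec_hol L U (fun x => (s x)%:M).

(* The meromorphic homomorphism [A] has vanishing order [k] at [p]. *)
Definition hom_ord (R : realType) (X : surface R) (r s : nat) (E : bundle X r)
    (F : bundle X s) (A : X -> 'M[R[i]]_(s, r)) (p : X) (k : int) : Prop :=
  exists (c : chart X) (U : set X) (B : X -> 'M[R[i]]_(s, r)),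
    [/\ dom c p, open U, U p, hom_hol E F U B & B p != 0] /\
    \forall y \near p^', A y = (coord c y - coord c p) ^ k *: B y.

Definition lsec_ord (R : realType) (X : surface R) (L : bundle X 1)
    (s : X -> R[i]) (p : X) (k : int) : Prop :=
  hom_ord (triv X 1) L (fun x => (s x)%:M) p k.

(* The degree of a line bundle is that of the divisor of any meromorphic section
   which is not identically zero. *)
Definition has_degree (R : realType) (X : surface R) (L : bundle X 1)
    (d : int) : Prop :=
  exists (s : X -> R[i]) (k : X -> int) (Z : seq X),
    [/\ forall p, lsec_ord L s p (k p),
        uniq Z,
        forall p, p \notin Z -> k p = 0
      & d = \sum_(p <- Z) k p].

Definition subbundle (R : realType) (X : surface R) (r k : nat)
    (E : bundle X r) (F : bundle X k) (J : X -> 'M[R[i]]_(r, k)) : Prop :=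
  [/\ is_bundle F, hom_hol F E setT J & forall x, \rank (J x) = k].

Definition genus (R : realType) (X : surface R) (g : nat) : Prop :=
  exists th : 'I_g -> X -> R[i],
    (forall k, lsec_hol (canonical X) setT (th k)) /\
    forall s, lsec_hol (canonical X) setT s ->
      exists! a : 'rV[R[i]]_g, forall x, s x = \sum_k a ord0 k * th k x.

(* A bilinear form is the matrix [w] with value [u^T *m w *m v] on [(u, v)]. *)

Definition stable (R : realType) (X : surface R) (r : nat) (E : bundle X r)
    (Phi w : X -> 'M[R[i]]_r) : Prop :=
  forall (k : nat) (F : bundle X k) (J : X -> 'M[R[i]]_(r, k)) (d : int),
    (0 < k < r)%N -> subbundle E F J ->
    (forall x, (J x)^T *m w x *m J x = 0) ->
    (forall x, exists B, Phi x *m J x = J x *m B) ->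
    has_degree (detb F) d -> d < 0.

(* Stable [N]-twisted orthogonal Higgs bundles with trivial determinant. *)
Record so_higgs (R : realType) (X : surface R) (N : bundle X 1) (r : nat)
    (E : bundle X r) (Phi w : X -> 'M[R[i]]_r) : Prop := SoHiggs {
  so_bundle : is_bundle E;
  so_det : exists2 s, lsec_hol (detb E) setT s & forall x, s x != 0;
  so_form_hol : hom_hol E (dual E) setT w;
  so_form_sym : forall x, (w x)^T = w x;
  so_form_nondeg : forall x, w x \in unitmx;
  so_phi_hol : hom_hol E (tens E N) setT Phi;
  so_phi_skew : forall x, (Phi x)^T *m w x = - (w x *m Phi x);
  so_stable : stable E Phi w }.

(* The total space of a line bundle [N] has [X * R[i]] as underlying set. *)

Definition tot_germ (R : realType) (X : surface R) (N : bundle X 1)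
    (a : X * R[i]) (j : fidx N) (P : X * R[i] -> Prop) : Prop :=
  nbhs ((a.1, a.2 / lframe j a.1) : X * R[i]^o)
       [set q | P (q.1, q.2 * lframe j q.1)].

(* [f] is given near [a] by the holomorphic function [G] of the coordinates
   defined by the chart [c] and the frame [j]. *)
Definition tot_rep (R : realType) (X : surface R) (N : bundle X 1)
    (a : X * R[i]) (c : chart X) (j : fidx N) (f : X * R[i] -> R[i])
    (G : R[i]^o * R[i]^o -> R[i]^o) : Prop :=
  (\forall z \near ((coord c a.1, a.2 / lframe j a.1) : R[i]^o * R[i]^o),
     differentiable G z) /\
  tot_germ a j (fun b => f b = G (coord c b.1, b.2 / lframe j b.1)).

Definition tot_hol (R : realType) (X : surface R) (N : bundle X 1)
    (a : X * R[i]) (f : X * R[i] -> R[i]) : Prop :=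
  forall (c : chart X) (j : fidx N), dom c a.1 -> fdom j a.1 ->
    exists G, tot_rep a c j f G.

Definition tot_analytic (R : realType) (X : surface R) (N : bundle X 1)
    (A : set (X * R[i])) : Prop :=
  forall (a : X * R[i]) (j : fidx N), fdom j a.1 ->
    exists (k : nat) (f : 'I_k -> X * R[i] -> R[i]),
      (forall l, tot_hol N a (f l)) /\
      tot_germ a j (fun b => A b <-> forall l, f l b = 0).

(* A monic polynomial of degree [d] whose coefficients are sections of the
   powers of [N] is a section of the [d]-th power of [N] on the total space;
   [tot_eqn] is its expression in the frame [j]. *)
Definition tot_eqn (R : realType) (X : surface R) (N : bundle X 1) (d : nat)
    (P : X -> {poly R[i]}) (j : fidx N) (b : X * R[i]) : R[i] :=
  (P b.1).[b.2] / lframe j b.1 ^+ d.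

Definition zeros (R : realType) (X : surface R) (P : X -> {poly R[i]}) :
    set (X * R[i]) := [set b | (P b.1).[b.2] = 0].

Definition irreducible_div (R : realType) (X : surface R) (N : bundle X 1)
    (P : X -> {poly R[i]}) : Prop :=
  zeros P !=set0 /\
  forall A B, tot_analytic N A -> tot_analytic N B -> zeros P = A `|` B ->
    zeros P = A \/ zeros P = B.

Definition reduced_div (R : realType) (X : surface R) (N : bundle X 1)
    (d : nat) (P : X -> {poly R[i]}) : Prop :=
  forall (a : X * R[i]) (j : fidx N), fdom j a.1 -> zeros P a ->
    ~ exists f g, [/\ tot_hol N a f, tot_hol N a g, f a = 0 &
        tot_germ a j (fun b => tot_eqn d P j b = f b ^+ 2 * g b)].

Definition smooth_div (R : realType) (X : surface R) (N : bundle X 1)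
    (d : nat) (P : X -> {poly R[i]}) : Prop :=
  forall (a : X * R[i]) (c : chart X) (j : fidx N),
    dom c a.1 -> fdom j a.1 -> zeros P a ->
    exists2 G, tot_rep a c j (tot_eqn d P j) G &
      exists v, 'd G ((coord c a.1, a.2 / lframe j a.1) : R[i]^o * R[i]^o) v
                != 0.

(* The characteristic polynomial divided by the indeterminate. *)
Definition spec_poly (R : realType) (n : nat) (A : 'M[R[i]]_(1 + 2 * n)) :
    {poly R[i]} := \poly_(i < (2 * n).+1) (char_poly A)`_i.+1.

(* [spec_poly A] is even when [A] is skew; this is the polynomial it defines in
   the square of the indeterminate. *)
Definition quot_poly (R : realType) (n : nat) (A : 'M[R[i]]_(1 + 2 * n)) :
    {poly R[i]} := \poly_(i < n.+1) (spec_poly A)`_(2 * i).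

(* The surface [Y] with [pi] and [eta] is the smooth zero divisor of [P] in the
   total space of [N]: [y |-> (pi y, eta y)] is a holomorphic embedding with
   image [zeros P]. *)
Record is_curve_of (R : realType) (X : surface R) (N : bundle X 1)
    (P : X -> {poly R[i]}) (Y : surface R) (pi : Y -> X) (eta : Y -> R[i]) :
    Prop := IsCurveOf {
  curve_map : hol_map pi;
  curve_taut : lsec_hol (pull pi N) setT eta;
  curve_inj : injective (fun y => (pi y, eta y));
  curve_range : range (fun y => (pi y, eta y)) = zeros P;
  curve_immersion : forall y (e : chart Y) (c : chart X) (j : fidx N),
    dom e y -> dom c (pi y) -> fdom j (pi y) ->
    dcoord e (fun y' => coord c (pi y')) y != 0 \/
    dcoord e (fun y' => eta y' / lframe j (pi y')) y != 0 }.

(* The canonical section of the line bundle of the ramification divisor of [pi],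
   seen as a section of [L]. *)
Definition ramification_section (R : realType) (X Y : surface R) (pi : Y -> X)
    (L : bundle Y 1) (delta : Y -> R[i]) : Prop :=
  lsec_hol L setT delta /\
  forall y (e : chart Y) (c : chart X), dom e y -> dom c (pi y) ->
    exists2 k, lsec_ord L delta y k &
      lsec_ord (triv Y 1) (dcoord e (fun y' => coord c (pi y'))) y k.

Definition branch_set (R : realType) (X Y : surface R) (pi : Y -> X) : set X :=
  [set x | exists y (e : chart Y) (c : chart X),
    [/\ pi y = x, dom e y, dom c x & dcoord e (fun y' => coord c (pi y')) y = 0]].

(* A Hermitian metric is the matrix [h] with [h(u, v) = v^t* *m h *m u]. *)

Definition line_re (R : realType) (g : R[i] -> R[i]) (z v : R[i]) (t : R) : R :=
  complex.Re (g (z + t%:C * v)).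

Definition line_im (R : realType) (g : R[i] -> R[i]) (z v : R[i]) (t : R) : R :=
  complex.Im (g (z + t%:C * v)).

Definition pder (R : realType) (v : R[i]) (g : R[i] -> R[i]) (z : R[i]) : R[i] :=
  derive1 (line_re g z v) 0 +i* derive1 (line_im g z v) 0.

Fixpoint Ck (R : realType) (k : nat) (U : set R[i]^o) (g : R[i] -> R[i]) : Prop :=
  if k is k'.+1 then
    forall v, v \in [:: 1; 'i] ->
      (forall z, U z ->
        derivable (line_re g z v) 0 1 /\ derivable (line_im g z v) 0 1) /\
      Ck k' U (pder v g)
  else forall z, U z -> {for z, continuous (g : R[i]^o -> R[i]^o)}.

Definition smooth_at (R : realType) (g : R[i] -> R[i]) (z : R[i]) : Prop :=
  exists U : set R[i]^o, [/\ open U, U z & forall k, Ck k U g].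

Definition wirt (R : realType) (g : R[i] -> R[i]) (z : R[i]) : R[i] :=
  (pder 1 g z - 'i * pder 'i g z) / 2.

Definition wirtbar (R : realType) (g : R[i] -> R[i]) (z : R[i]) : R[i] :=
  (pder 1 g z + 'i * pder 'i g z) / 2.

(* The Chern connection of a metric with matrix [H] in a holomorphic frame has
   connection form [H^-1 (d' H)], hence curvature [d'' (H^-1 (d' H))]; this is the
   coefficient of the latter in a holomorphic coordinate. *)
Definition chern_curv (R : realType) (r : nat) (H : R[i] -> 'M[R[i]]_r)
    (z : R[i]) : 'M[R[i]]_r :=
  \matrix_(k, l) wirtbar (fun w =>
    (invmx (H w) *m \matrix_(k', l') wirt (fun w' => H w' k' l') w) k l) z.

Definition frame_metric (R : realType) (X : surface R) (r : nat)
    (E : bundle X r) (h : X -> 'M[R[i]]_r) (i : fidx E) (x : X) : 'M[R[i]]_r :=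
  (frame i x)^t* *m h x *m frame i x.

(* Smooth Hermitian metrics on the complement of the closed set [S]. *)
Record herm_metric (R : realType) (X : surface R) (r : nat) (E : bundle X r)
    (S : set X) (h : X -> 'M[R[i]]_r) : Prop := HermMetric {
  hm_herm : forall x, ~ S x -> (h x)^t* = h x;
  hm_pos : forall x (v : 'cV_r), ~ S x -> v != 0 ->
    0 < (v^t* *m h x *m v) ord0 ord0;
  hm_smooth : forall (c : chart X) (i : fidx E) x, ~ S x -> dom c x -> fdom i x ->
    exists2 H, germ_eq (coord c) x (frame_metric h i) H &
      forall k l, smooth_at (fun z => H z k l) (coord c x) }.

Definition chern_flat (R : realType) (X : surface R) (r : nat) (E : bundle X r)
    (S : set X) (h : X -> 'M[R[i]]_r) : Prop :=
  forall (c : chart X) (i : fidx E) x H, ~ S x -> dom c x -> fdom i x ->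
    germ_eq (coord c) x (frame_metric h i) H -> chern_curv H (coord c x) = 0.

Definition madj (R : realType) (r : nat) (h A : 'M[R[i]]_r) : 'M[R[i]]_r :=
  invmx h *m A^t* *m h.

(* The columns of [P] form a basis orthonormal for both the form and the metric,
   i.e. an element of the reduction to the maximal compact subgroup. *)
Definition compatible (R : realType) (r : nat) (w h : 'M[R[i]]_r) : Prop :=
  exists P : 'M[R[i]]_r, P^T *m w *m P = 1%:M /\ P^t* *m h *m P = 1%:M.

(* Solutions of the decoupled Hitchin equation on the complement of [S]. *)
Record decoupled_solution (R : realType) (X : surface R) (r : nat)
    (E : bundle X r) (Phi w : X -> 'M[R[i]]_r) (S : set X)
    (h : X -> 'M[R[i]]_r) : Prop := DecoupledSolution {
  dec_metric : herm_metric E S h;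
  dec_compat : forall x, ~ S x -> compatible (w x) (h x);
  dec_flat : chern_flat E S h;
  dec_normal : forall x, ~ S x ->
    Phi x *m madj (h x) (Phi x) = madj (h x) (Phi x) *m Phi x }.

(* A Kaehler form is the same as a Hermitian metric on the tangent bundle. *)
Definition kaehler (R : realType) (X : surface R) (kappa : X -> R[i]) : Prop :=
  herm_metric (dual (canonical X)) set0 (fun x => (kappa x)%:M).

(* The curvature is a constant multiple of the pullback by [f] of the Kaehler
   form [kappa]. *)
Definition hermite_einstein (R : realType) (X Y : surface R) (f : Y -> X)
    (kappa : X -> R[i]) (L : bundle Y 1) (S : set Y) (h : Y -> R[i]) : Prop :=
  herm_metric L S (fun y => (h y)%:M) /\
  exists gamma : R[i], forall (c : chart Y) (i : fidx L) y H,
    ~ S y -> dom c y -> fdom i y ->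
    germ_eq (coord c) y (frame_metric (fun y => (h y)%:M) i) H ->
    chern_curv H (coord c y) =
      (gamma * (kappa (f y) *
        `|dcoord c (fun y' => coord (chart_at (f y)) (f y')) y| ^+ 2))%:M.

(* The squared norm [h] is adapted to the parabolic weight [k / 2] at [p]. *)
Definition adapted (R : realType) (X : surface R) (L : bundle X 1)
    (h : X -> R[i]) (p : X) (k : int) : Prop :=
  exists (c : chart X) (i : fidx L) (u : X -> R[i]),
    [/\ dom c p, fdom i p, (u y : R[i]^o) @[y --> p] --> (u p : R[i]^o), 0 < u p &
      \forall y \near p^',
        h y * `|lframe i y| ^+ 2 = `|coord c y - coord c p| ^ k * u y].

Definition lin_app (R : realType) (psi : 'I_3 -> 'M[R[i]]_2) (v : 'cV[R[i]]_3) :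
    'M[R[i]]_2 := \sum_l v l ord0 *: psi l.

(* [psi] identifies [(E3, Phi3, w3)] with the trace-free endomorphisms of [E'],
   the adjoint action of [Phi'] and the trace form. *)
Record ad_induced (R : realType) (Y : surface R) (N : bundle Y 1)
    (E3 : bundle Y 3) (Phi3 w3 : Y -> 'M[R[i]]_3)
    (E' : bundle Y 2) (Phi' : Y -> 'M[R[i]]_2)
    (psi : Y -> 'I_3 -> 'M[R[i]]_2) : Prop := AdInduced {
  ad_bundle : is_bundle E';
  ad_phi_hol : hom_hol E' (tens E' N) setT Phi';
  ad_phi_tr : forall y, \tr (Phi' y) = 0;
  ad_psi_hol : forall (i : fidx E3) (j : fidx E') l,
    mx_hol (fdom i `&` fdom j) (fun y =>
      invmx (frame j y) *m lin_app (psi y) (col l (frame i y)) *m frame j y);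
  ad_psi_tr : forall y l, \tr (psi y l) = 0;
  ad_psi_form : forall y k l, \tr (psi y k *m psi y l) = w3 y k l;
  ad_psi_phi : forall y l, lin_app (psi y) (col l (Phi3 y)) =
    Phi' y *m psi y l - psi y l *m Phi' y }.

(* [sD] is the canonical section of the line bundle [OD] of the divisor of
   vanishing orders of [Phi'] at the zeros of its determinant. *)
Definition vanishing_section (R : realType) (Y : surface R) (N : bundle Y 1)
    (E' : bundle Y 2) (Phi' : Y -> 'M[R[i]]_2) (OD : bundle Y 1)
    (sD : Y -> R[i]) : Prop :=
  [/\ is_bundle OD, lsec_hol OD setT sD,
      forall y, \det (Phi' y) != 0 -> sD y != 0
    & forall y, \det (Phi' y) = 0 ->
        exists2 k, hom_ord E' (tens E' N) Phi' y k & lsec_ord OD sD y k].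

(* The surface [S], with [p2], the eigenvalue section [la] and the involution
   [sg], is the normalised spectral curve of [Phi']: it is compact and smooth,
   maps onto the spectral curve, and bijectively so over the locus where the two
   eigenvalues differ. *)
Record normalised_cover (R : realType) (Y : surface R) (N : bundle Y 1)
    (Phi' : Y -> 'M[R[i]]_2) (S : surface R) (p2 : S -> Y)
    (la : S -> R[i]) (sg : S -> S) : Prop := NormalisedCover {
  nc_map : hol_map p2;
  nc_la : lsec_hol (pull p2 N) setT la;
  nc_range : range (fun s => (p2 s, la s)) =
    [set b | root (char_poly (Phi' b.1)) b.2];
  nc_inj : forall s t, \det (Phi' (p2 s)) != 0 ->
    p2 s = p2 t -> la s = la t -> s = t;
  nc_sg : hol_map sg;
  nc_sg_p2 : forall s, p2 (sg s) = p2 s;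
  nc_sg_la : forall s, la (sg s) = - la s }.

(* The Hermite-Einstein metric on the eigenline bundle [L], embedded by [JL].
   For the normalisation: mapping [v (x) w] to [(v /\ w) (x) (la / sD)^-1]
   identifies the product of [L] with its image by [sg] with the pullback of
   [det E' (x) N^-1 (D)]; the metric [hdet |det Phi' / sD^2|] of the latter is
   evaluated at the image of [JL s (x) JL (sg s)]. *)
Record eigenline_metric (R : realType) (Y : surface R) (N : bundle Y 1)
    (E' : bundle Y 2) (Phi' : Y -> 'M[R[i]]_2) (OD : bundle Y 1) (sD : Y -> R[i])
    (kappa hdet : Y -> R[i]) (S : surface R) (p2 : S -> Y) (la : S -> R[i])
    (sg : S -> S) (L : bundle S 1) (JL : S -> 'M[R[i]]_(2, 1)) (hL : S -> R[i]) :
    Prop := EigenlineMetric {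
  el_sub : subbundle (pull p2 E') L JL;
  el_eigen : forall s, Phi' (p2 s) *m JL s = la s *: JL s;
  el_he : hermite_einstein p2 kappa L [set s | la s = 0] hL;
  el_adapted : forall s, la s = 0 -> exists m d,
    [/\ lsec_ord (pull p2 N) la s m, lsec_ord (pull p2 OD) (fun s => sD (p2 s)) s d
      & adapted L hL s (m - d)];
  el_norm : forall s, la s != 0 ->
    hL s * hL (sg s) =
      hdet (p2 s) * `|\det (Phi' (p2 s)) / sD (p2 s) ^+ 2| *
      `|\det (row_mx (JL s) (JL (sg s)) : 'M[R[i]]_2) / (la s / sD (p2 s))| ^+ 2 }.

(* [h3] is the metric constructed on the rank three Higgs bundle away from the
   zeros of [b2].  The metric [h'] on [E'] is the one to which the orthogonal sum
   of [hL] and its image by [sg] descends. *)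
Definition is_h3 (R : realType) (Y : surface R) (N : bundle Y 1)
    (E3 : bundle Y 3) (Phi3 w3 : Y -> 'M[R[i]]_3) (b2 : Y -> R[i])
    (h3 : Y -> 'M[R[i]]_3) : Prop :=
  exists (E' : bundle Y 2) (Phi' : Y -> 'M[R[i]]_2) (psi : Y -> 'I_3 -> 'M[R[i]]_2)
    (OD : bundle Y 1) (sD kappa hdet : Y -> R[i])
    (S : surface R) (p2 : S -> Y) (la : S -> R[i]) (sg : S -> S)
    (L : bundle S 1) (JL : S -> 'M[R[i]]_(2, 1)) (hL : S -> R[i])
    (h' : Y -> 'M[R[i]]_2),
  [/\ ad_induced N E3 Phi3 w3 E' Phi' psi,
      vanishing_section N E' Phi' OD sD,
      kaehler kappa /\ hermite_einstein id kappa (detb E') set0 hdet,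
      normalised_cover N Phi' p2 la sg
    & eigenline_metric N E' Phi' OD sD kappa hdet p2 la sg L JL hL] /\
  [/\ forall s, la s != 0 -> (JL s)^t* *m h' (p2 s) *m JL s = (hL s)%:M,
      forall s, la s != 0 -> (JL (sg s))^t* *m h' (p2 s) *m JL s = 0
    & forall y k l, b2 y != 0 ->
        h3 y k l = \tr (psi y l *m madj (h' y) (psi y k))].

Definition is_kernel (R : realType) (X : surface R) (r : nat) (E : bundle X r)
    (Phi : X -> 'M[R[i]]_r) (M : bundle X 1) (JM : X -> 'M[R[i]]_(r, 1)) : Prop :=
  subbundle E M JM /\ forall x, Phi x *m JM x = 0.

(* The orthogonal complement [V] of [M], with the restriction of [Phi] to it. *)
Definition is_perp (R : realType) (X : surface R) (r : nat) (E : bundle X (1 + r))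
    (Phi w : X -> 'M[R[i]]_(1 + r)) (JM : X -> 'M[R[i]]_(1 + r, 1))
    (V : bundle X r) (J : X -> 'M[R[i]]_(1 + r, r)) (PhiV : X -> 'M[R[i]]_r) :
    Prop :=
  [/\ subbundle E V J,
      forall x, (JM x)^T *m w x *m J x = 0
    & forall x, Phi x *m J x = J x *m PhiV x].

(* By adjunction a homomorphism from [V] to the pushforward of [W] is a
   homomorphism [T] from the pullback of [V] to [W]; it is an isomorphism of
   sheaves when it is bijective on sections over all open sets. *)
Definition pushforward_iso (R : realType) (X Y : surface R) (pi : Y -> X)
    (r s : nat) (V : bundle X r) (W : bundle Y s) (T : Y -> 'M[R[i]]_(s, r)) :
    Prop :=
  hom_hol (pull pi V) W setT T /\
  forall U : set X, open U ->
    (forall t, sec_hol W (pi @^-1` U) t ->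
      exists2 u, sec_hol V U u & forall y, U (pi y) -> t y = T y *m u (pi y)) /\
    (forall u u', sec_hol V U u -> sec_hol V U u' ->
      (forall y, U (pi y) -> T y *m u (pi y) = T y *m u' (pi y)) ->
      forall x, U x -> u x = u' x).

(* The pushforward at [x] of the forms [t] on the fibres of [W], transported by
   the isomorphism [T]. *)
Definition push_form (R : realType) (X Y : surface R) (pi : Y -> X) (r s : nat)
    (T : Y -> 'M[R[i]]_(s, r)) (t : Y -> 'M[R[i]]_s) (x : X) : 'M[R[i]]_r :=
  \sum_(y \in pi @^-1` [set x]) ((T y)^T *m t y *m T y).

Definition push_metric (R : realType) (X Y : surface R) (pi : Y -> X) (r s : nat)
    (T : Y -> 'M[R[i]]_(s, r)) (t : Y -> 'M[R[i]]_s) (x : X) : 'M[R[i]]_r :=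
  \sum_(y \in pi @^-1` [set x]) ((T y)^t* *m t y *m T y).

(* The isomorphism [T] from the orthogonal complement [V] of the kernel to the
   pushforward of [V3 (x) pi^* K^(n-1)], where [V3] is the orthogonal complement
   of the kernel of [Phi3].  The pushforward of forms is compared away from the
   branch points, where it is a sum over the fibre. *)
Record push_corr (R : realType) (X Y : surface R) (n : nat) (pi : Y -> X)
    (delta : Y -> R[i]) (w : X -> 'M[R[i]]_(1 + 2 * n))
    (V : bundle X (2 * n)) (J : X -> 'M[R[i]]_(1 + 2 * n, 2 * n))
    (PhiV : X -> 'M[R[i]]_(2 * n)) (w3 : Y -> 'M[R[i]]_3)
    (V3 : bundle Y 2) (J3 : Y -> 'M[R[i]]_(1 + 2, 2)) (PhiV3 : Y -> 'M[R[i]]_2)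
    (T : Y -> 'M[R[i]]_(2, 2 * n)) : Prop := PushCorr {
  pc_iso : pushforward_iso pi V (tens V3 (pull pi (lpow (canonical X) n.-1))) T;
  pc_phi : forall y, T y *m PhiV (pi y) = PhiV3 y *m T y;
  pc_form : forall x, ~ branch_set pi x ->
    (J x)^T *m w x *m J x =
    push_form pi T (fun y => (delta y)^-1 *: ((J3 y)^T *m w3 y *m J3 y)) x }.

(* The direct sum of the metric [|w(v, v)|] on the kernel and of the pushforward
   of [h3 / |delta|] on its orthogonal complement. *)
Definition h_dc (R : realType) (X Y : surface R) (n : nat) (pi : Y -> X)
    (delta : Y -> R[i]) (w : X -> 'M[R[i]]_(1 + 2 * n))
    (JM : X -> 'M[R[i]]_(1 + 2 * n, 1)) (J : X -> 'M[R[i]]_(1 + 2 * n, 2 * n))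
    (J3 : Y -> 'M[R[i]]_(1 + 2, 2)) (T : Y -> 'M[R[i]]_(2, 2 * n))
    (h3 : Y -> 'M[R[i]]_3) (x : X) : 'M[R[i]]_(1 + 2 * n) :=
  let B := row_mx (JM x) (J x) in
  (invmx B)^t* *m
  block_mx (`|((JM x)^T *m w x *m JM x) ord0 ord0|%:M) 0
           0 (push_metric pi T
                (fun y => `|delta y|^-1 *: ((J3 y)^t* *m h3 y *m J3 y)) x) *m
  invmx B.

(* Main.v *)
(* Near a point outside [Z(a_2n)] and the branch locus, the metric is [Q^t* Q] for
   an invertible matrix [Q] which is holomorphic in the frames of [E] and satisfies
   [Q Phi = La Q] with [La] diagonal.  A metric with a holomorphic Gram factor is
   smooth and flat, diagonality of [La] gives normality, and a constant unitary
   change of the rows of [Q] turns it into a basis orthonormal for the form, which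
   gives compatibility.

   The kernel contributes to [Q] the row [v^T w / s], where [s] is a holomorphic
   square root of [w(v, v)]; the latter does not vanish as [0] is a simple
   eigenvalue of [Phi].  Each of the [n] sheets of [pi] contributes two rows, given
   by the decomposition of [E_3] into eigenlines of the adjoint action of [Phi'].
   On these the metric [h_3] is [diag(d1 / d2, d2 / d1)], where [d1] and [d2] are
   the norms of local frames of [L] and of its image by the involution.  Both have
   the same curvature, so [d1 / d2 = |f|^2] with [f] holomorphic, and [f], [1 / f]
   are absorbed by the coordinates of the eigenlines.  The factor [1 / |delta|]
   becomes a holomorphic square root of [1 / delta].

   Goursat's theorem on rectangles gives the holomorphy of derivatives, square
   roots, logarithms and local inverses. *)

Require Import Defs.
From mathcomp Require Import ring lra.

Set Implicit Arguments.
Unset Strict Implicit.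
Unset Printing Implicit Defensive.

(** * Wirtinger derivatives *)

(** The normalised cover is given by the separation property [nc_inj], which says nothing on the
    derivative of [p2]. Local inverses are therefore built from local injectivity, with the
    non-vanishing of the derivative as a consequence; this is why they come from contour integrals
    and not from a contraction. The quotient polynomial has degree [n], so a fibre of [pi] has at
    most [n] points. That [n] is attained is read off the form: it is non-degenerate of rank [2 * n]
    on the complement of the kernel, and each point of the fibre contributes rank at most two. The
    two eigenlines over a sheet are isotropic and dual to each other. The form on them is thus
    [swap2], not the identity, and [diag2 f f^-1] preserves it; hence the metric can be made
    standard without touching the form, and the unitary matrix [rot2] relates [swap2] to a sum of
    squares. Fibres carry arbitrary pointwise bases, so holomorphy is only visible after
    multiplication by frames, and square roots are extracted from functions already read in a
    frame. *)

Section Modulus.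
Variable R : realType.
Implicit Types (z w : R[i]) (x y : R).

(** The norm of [R[i]] is itself a complex number; its real part is taken so that estimates live in
    the ordered field [R]. *)
Definition nm z : R := complex.Re `|z|.

Lemma nmE z : `|z| = (nm z)%:C.
Proof. by rewrite /nm normc_def. Qed.

Lemma nm_sqrE z : nm z ^+ 2 = complex.Re z ^+ 2 + complex.Im z ^+ 2.
Proof.
by rewrite /nm normc_def /= sqr_sqrtr // addr_ge0 // sqr_ge0.
Qed.

Lemma nm_ge0 z : 0 <= nm z.
Proof. by rewrite -lecR -nmE normr_ge0. Qed.

Lemma nm0 : nm 0 = 0. Proof. by apply: complexI; rewrite -nmE normr0. Qed.

Lemma nm_eq0 z : (nm z == 0) = (z == 0).
Proof. by rewrite -[RHS]normr_eq0 nmE -(inj_eq (@complexI R)). Qed.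

Lemma nm_gt0 z : (0 < nm z) = (z != 0).
Proof. by rewrite lt_neqAle nm_ge0 andbT eq_sym nm_eq0. Qed.

Lemma nmM z w : nm (z * w) = nm z * nm w.
Proof. by apply: complexI; rewrite rmorphM /= -!nmE normrM. Qed.

Lemma nmX z k : nm (z ^+ k) = nm z ^+ k.
Proof. by apply: complexI; rewrite rmorphXn /= -!nmE normrX. Qed.

Lemma nmV z : nm z^-1 = (nm z)^-1.
Proof. by apply: complexI; rewrite fmorphV /= -!nmE normfV. Qed.

Lemma nmD z w : nm (z + w) <= nm z + nm w.
Proof. by rewrite -lecR rmorphD /= -!nmE ler_normD. Qed.

Lemma nmN z : nm (- z) = nm z.
Proof. by apply: complexI; rewrite -!nmE normrN. Qed.

Lemma nmB z w : nm (z - w) <= nm z + nm w.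
Proof. by rewrite -(nmN w) nmD. Qed.

Lemma nm_distC z w : nm (z - w) = nm (w - z).
Proof. by rewrite -nmN opprB. Qed.

Lemma nm_tri v z w : nm (z - w) <= nm (z - v) + nm (v - w).
Proof. by rewrite -[z - w](subrKA v) nmD. Qed.

Lemma nm_subr z w : nm z - nm w <= nm (z - w).
Proof. by rewrite lerBlDr -{1}(subrK w z) nmD. Qed.

Lemma nmJ z : nm z^* = nm z.
Proof. by apply: complexI; rewrite -!nmE; exact: norm_conjC. Qed.

Lemma nm_real x : nm x%:C = `|x|.
Proof. by rewrite /nm normc_def /= expr0n /= addr0 sqrtr_sqr. Qed.

Lemma ler_Re z : `|complex.Re z| <= nm z.
Proof.
by rewrite -(@ler_pXn2r _ 2) ?nnegrE ?nm_ge0 // real_normK ?num_real // nm_sqrE lerDl sqr_ge0.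
Qed.

Lemma ler_Im z : `|complex.Im z| <= nm z.
Proof.
by rewrite -(@ler_pXn2r _ 2) ?nnegrE ?nm_ge0 // real_normK ?num_real // nm_sqrE lerDr sqr_ge0.
Qed.

Lemma ReD z w : complex.Re (z + w) = complex.Re z + complex.Re w.
Proof. by case: z w => ? ? []. Qed.
Lemma ImD z w : complex.Im (z + w) = complex.Im z + complex.Im w.
Proof. by case: z w => ? ? []. Qed.
Lemma ReN z : complex.Re (- z) = - complex.Re z. Proof. by case: z. Qed.
Lemma ImN z : complex.Im (- z) = - complex.Im z. Proof. by case: z. Qed.
Lemma ReM z w : complex.Re (z * w) =
  complex.Re z * complex.Re w - complex.Im z * complex.Im w.
Proof. by case: z w => ? ? []. Qed.
Lemma ImM z w : complex.Im (z * w) =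
  complex.Re z * complex.Im w + complex.Im z * complex.Re w.
Proof. by case: z w => ? ? [] * /=; rewrite addrC. Qed.
Lemma ReJ z : complex.Re z^* = complex.Re z. Proof. by case: z. Qed.
Lemma ImJ z : complex.Im z^* = - complex.Im z. Proof. by case: z. Qed.

Lemma Re_i : complex.Re ('i : R[i]) = 0. Proof. by []. Qed.
Lemma Im_i : complex.Im ('i : R[i]) = 1. Proof. by []. Qed.

Definition ReImE := (ReD, ImD, ReN, ImN, ReM, ImM, ReJ, ImJ, Re_i, Im_i).

Lemma eqC z w : complex.Re z = complex.Re w -> complex.Im z = complex.Im w -> z = w.
Proof. by case: z w => ? ? [? ?] /= -> ->. Qed.

Lemma cjD z w : (z + w)^* = z^* + w^*. Proof. exact: rmorphD. Qed.
Lemma cjB z w : (z - w)^* = z^* - w^*. Proof. exact: rmorphB. Qed.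
Lemma cjM z w : (z * w)^* = z^* * w^*. Proof. exact: rmorphM. Qed.
Lemma cjN z : (- z)^* = - z^*. Proof. exact: rmorphN. Qed.
Lemma cjK z : z^*^* = z. Proof. exact: conjCK. Qed.
Lemma cj0 : (0 : R[i])^* = 0. Proof. exact: conjC0. Qed.
Lemma cj1 : (1 : R[i])^* = 1. Proof. exact: conjC1. Qed.
Definition cjE := (cjD, cjB, cjM, cjN, cjK, cj0, cj1).

Lemma conj_real x : (x%:C : R[i])^* = x%:C.
Proof. by apply: eqC; rewrite ?ReImE /= ?oppr0. Qed.

Lemma conjE z : z^* = (complex.Re z)%:C - 'i * (complex.Im z)%:C.
Proof. by apply: eqC; rewrite !ReImE /=; ring. Qed.

Lemma reimE z : z = (complex.Re z)%:C + 'i * (complex.Im z)%:C.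
Proof. by apply: eqC; rewrite !ReImE /=; ring. Qed.

Lemma nm_i : nm ('i : R[i]) = 1.
Proof.
by apply/eqP; rewrite -(@eqrXn2 _ 2) ?nm_ge0 // nm_sqrE Re_i Im_i expr0n /= expr1n add0r.
Qed.

Lemma nm_ReIm z : nm z <= `|complex.Re z| + `|complex.Im z|.
Proof. by rewrite {1}(reimE z) (le_trans (nmD _ _)) // nmM nm_i mul1r !nm_real. Qed.

Lemma mulJE z : z^* * z = ((nm z) ^+ 2)%:C.
Proof. by apply: eqC; rewrite !ReImE ?nm_sqrE /=; ring. Qed.

(** The radii of balls in [R[i]^o] are complex; a positive complex number is real, so real radii
    suffice. *)
Lemma near_nm (z : R[i]) (P : R[i] -> Prop) :
  (\forall w \near (z : R[i]^o), P w) <->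
  exists2 d : R, 0 < d & forall w, nm (w - z) < d -> P w.
Proof.
split=> [/nbhs_ballP [e e0 eP]|[d d0 dP]].
  have e0' : 0 < complex.Re e by move: e0; rewrite /= ltcE => /andP[_].
  exists (complex.Re e) => // w wz; apply: eP; rewrite -ball_normE /= distrC nmE.
  have -> : e = (complex.Re e)%:C by rewrite RRe_real // gtr0_real.
  by rewrite ltcR.
apply/nbhs_ballP; exists d%:C; first by rewrite /= ltcR.
by move=> w; rewrite -ball_normE /= distrC nmE ltcR => /dP.
Qed.

Lemma open_nm (U : set R[i]^o) z : open U -> U z ->
  exists2 d : R, 0 < d & forall w, nm (w - z) < d -> U w.
Proof. by move=> /[swap] Uz; rewrite openE => /(_ z Uz) /near_nm. Qed.

Lemma openP_nm (U : set R[i]^o) :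
  (forall z, U z -> exists2 d : R, 0 < d & forall w, nm (w - z) < d -> U w) -> open U.
Proof. by move=> H; rewrite openE => z /H /near_nm. Qed.

Lemma open_disc z (d : R) : open ([set w | nm (w - z) < d] : set R[i]^o).
Proof.
apply: openP_nm => w /= wz; exists (d - nm (w - z)); first by rewrite subr_gt0.
by move=> v vw; apply: le_lt_trans (nm_tri w _ _) _; rewrite -ltrBrDr.
Qed.

Lemma ex_near (z : R[i]) (P : R[i] -> Prop) :
  (\forall w \near (z : R[i]^o), P w) -> P z.
Proof. by move=> /nbhs_singleton. Qed.

End Modulus.

Section Frechet.
Variable R : realType.
Implicit Types (g f : R[i] -> R[i]) (z a b h : R[i]).

(* [a] and [b] are the Wirtinger derivatives of [g] at [z]. *)
Definition fr g z a b := forall e : R, 0 < e ->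
  exists2 d : R, 0 < d & forall h, nm h < d ->
    nm (g (z + h) - g z - (a * h + b * h^*)) <= e * nm h.

Definition cts g z := forall e : R, 0 < e ->
  exists2 d : R, 0 < d & forall w, nm (w - z) < d -> nm (g w - g z) < e.

Lemma ctsP g z : cts g z <-> {for z, continuous (g : R[i]^o -> R[i]^o)}.
Proof.
split=> [H|H e e0].
  apply: (iffRL (cvgrPdist_lt (F := nbhs (z : R[i]^o)) (g : R[i]^o -> R[i]^o) (g z))) => e e0.
  apply/near_nm.
  have e0' : 0 < complex.Re e by move: e0; rewrite ltcE => /andP[_].
  have [d d0 dP] := H _ e0'; exists d => // w /dP.
  rewrite distrC nmE.
  have -> : e = (complex.Re e)%:C by rewrite RRe_real // gtr0_real.
  by rewrite ltcR.
have /(iffLR (cvgrPdist_lt (F := nbhs (z : R[i]^o)) (g : R[i]^o -> R[i]^o) (g z))) /(_ e%:C) := H; rewrite ltcR => /(_ e0) /near_nm [d d0 dP].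
by exists d => // w /dP; rewrite distrC nmE ltcR.
Qed.

Lemma fr_bound g z a b : fr g z a b -> exists2 d : R, 0 < d & forall h, nm h < d ->
  nm (g (z + h) - g z) <= (nm a + nm b + 1) * nm h.
Proof.
move=> /(_ 1 ltr01) [d d0 dP]; exists d => // h /dP; rewrite mul1r => H.
have -> : g (z + h) - g z =
  (g (z + h) - g z - (a * h + b * h^*)) + (a * h + b * h^*) by rewrite subrK.
apply: le_trans (nmD _ _) _; apply: (le_trans (lerD H (nmD _ _))).
by rewrite !nmM nmJ !mulrDl mul1r addrC.
Qed.

Lemma fr_cts g z a b : fr g z a b -> cts g z.
Proof.
move=> /fr_bound [d d0 dP] e e0.
have K0 : 0 < nm a + nm b + 1 by rewrite ltr_pwDr // addr_ge0 // nm_ge0.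
exists (Num.min d (e / (nm a + nm b + 1))); first by rewrite lt_min d0 divr_gt0.
move=> w; rewrite lt_min => /andP[/dP]; rewrite subrKC => H H2.
by apply: le_lt_trans H _; rewrite mulrC -ltr_pdivlMr.
Qed.

Lemma fr_ext g f z a b : (\forall w \near (z : R[i]^o), g w = f w) ->
  fr g z a b -> fr f z a b.
Proof.
move=> /[dup] /ex_near gz /near_nm [d d0 dP] H e /H [d' d'0 d'P].
exists (Num.min d d'); first by rewrite lt_min d0.
move=> h; rewrite lt_min => /andP[h1 h2]; rewrite -gz -dP ?d'P //.
by rewrite addrAC subrr add0r.
Qed.

Lemma fr_cst c z : fr (fun=> c) z 0 0.
Proof.
move=> e e0; exists 1 => // h _.
by rewrite subrr !mul0r addr0 subr0 nm0 mulr_ge0 ?nm_ge0 // ltW.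
Qed.

Lemma fr_id z : fr id z 1 0.
Proof.
move=> e e0; exists 1 => // h _.
have -> : id (z + h) - id z - (1 * h + 0 * h^*) = 0 by rewrite /=; ring.
by rewrite nm0 mulr_ge0 ?nm_ge0 // ltW.
Qed.

Lemma fr_add g f z a b a' b' : fr g z a b -> fr f z a' b' ->
  fr (fun w => g w + f w) z (a + a') (b + b').
Proof.
move=> G F e e0; have e2 : 0 < e / 2 by rewrite divr_gt0.
have [d d0 dP] := G _ e2; have [d' d'0 d'P] := F _ e2.
exists (Num.min d d'); first by rewrite lt_min d0.
move=> h; rewrite lt_min => /andP[/dP h1 /d'P h2].
have -> : g (z + h) + f (z + h) - (g z + f z) - ((a + a') * h + (b + b') * h^*) =
 (g (z + h) - g z - (a * h + b * h^*)) + (f (z + h) - f z - (a' * h + b' * h^*)) by ring.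
apply: le_trans (nmD _ _) (le_trans (lerD h1 h2) _).
by rewrite -mulrDl -splitr.
Qed.

Lemma fr_conj g z a b : fr g z a b -> fr (fun w => (g w)^*) z b^* a^*.
Proof.
move=> G e /G [d d0 dP]; exists d => // h /dP.
rewrite -nmJ !cjE => H.
by rewrite [b^* * _ + _]addrC.
Qed.

Lemma fr_mul g f z a b a' b' : fr g z a b -> fr f z a' b' ->
  fr (fun w => g w * f w) z (a * f z + g z * a') (b * f z + g z * b').
Proof.
move=> G F e e0.
set K := nm a + nm b + 1; set K' := nm a' + nm b' + 1.
have K0 : 0 < K by rewrite ltr_pwDr // addr_ge0 // nm_ge0.
have K'0 : 0 < K' by rewrite ltr_pwDr // addr_ge0 // nm_ge0.
have fz0 : 0 < nm (f z) + 1 by rewrite ltr_pwDr // nm_ge0.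
have gz0 : 0 < nm (g z) + 1 by rewrite ltr_pwDr // nm_ge0.
(* The error is made of two first order remainders, each multiplied by a value of the other factor,
   and of a product of two increments, which is quadratic in [h]. Each of the three gets a third of
   [e]; the summands 1 keep the denominators positive. *)
have e1 : 0 < e / 3 / (nm (f z) + 1) by rewrite !divr_gt0.
have e2 : 0 < e / 3 / (nm (g z) + 1) by rewrite !divr_gt0.
have [d1 d10 G1] := G _ e1; have [d2 d20 F1] := F _ e2.
have [d3 d30 G2] := fr_bound G; have [d4 d40 F2] := fr_bound F.
exists (Num.min (Num.min (Num.min d1 d2) (Num.min d3 d4)) (e / 3 / (K * K'))).
  by rewrite !lt_min d10 d20 d30 d40 /= !divr_gt0 // mulr_gt0.
move=> h; rewrite !lt_min => /andP[/andP[/andP[/G1 h1 /F1 h2] /andP[/G2 h3 /F2 h4]] h5].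
have -> : g (z + h) * f (z + h) - g z * f z -
  ((a * f z + g z * a') * h + (b * f z + g z * b') * h^*) =
  (g (z + h) - g z - (a * h + b * h^*)) * f z +
  g z * (f (z + h) - f z - (a' * h + b' * h^*)) +
  (g (z + h) - g z) * (f (z + h) - f z) by ring.
apply: le_trans (nmD _ _) _; apply: le_trans (lerD (nmD _ _) (lexx _)) _.
rewrite !nmM.
have n0 := nm_ge0 h.
have A1 : nm (g (z + h) - g z - (a * h + b * h^*)) * nm (f z) <= e / 3 * nm h.
  apply: le_trans (ler_wpM2l (nm_ge0 _) (_ : _ <= nm (f z) + 1)) _; first lra.
  apply: le_trans (ler_wpM2r (ltW fz0) h1) _.
  by rewrite mulrAC divfK ?gt_eqF.
have A2 : nm (g z) * nm (f (z + h) - f z - (a' * h + b' * h^*)) <= e / 3 * nm h.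
  apply: le_trans (ler_wpM2r (nm_ge0 _) (_ : _ <= nm (g z) + 1)) _; first lra.
  apply: le_trans (ler_wpM2l (ltW gz0) h2) _.
  by rewrite mulrA [_ * (_ / _)]mulrC divfK ?gt_eqF.
have A3 : nm (g (z + h) - g z) * nm (f (z + h) - f z) <= e / 3 * nm h.
  apply: le_trans (ler_pM (nm_ge0 _) (nm_ge0 _) h3 h4) _.
  rewrite mulrACA mulrA ler_wpM2r // mulrC -ler_pdivlMr ?mulr_gt0 //.
  exact: ltW.
have -> : e * nm h = e / 3 * nm h + e / 3 * nm h + e / 3 * nm h by field.
by rewrite !lerD.
Qed.

(** The conjugate of the inner increment [c * h + d * h^*] is [d^* * h + c^* * h^*]; this is the
    origin of the conjugated coefficients. *)
Lemma fr_comp g t z a b c d : fr t z c d -> fr g (t z) a b ->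
  fr (g \o t) z (a * c + b * d^*) (a * d + b * c^*).
Proof.
move=> T G e e0.
set K := nm c + nm d + 1.
have K0 : 0 < K by rewrite ltr_pwDr // addr_ge0 // nm_ge0.
set L := nm a + nm b + 1.
have L0 : 0 < L by rewrite ltr_pwDr // addr_ge0 // nm_ge0.
have e1 : 0 < e / 2 / K by rewrite !divr_gt0.
have e2 : 0 < e / 2 / L by rewrite !divr_gt0.
have [d1 d10 G1] := G _ e1; have [d2 d20 T1] := T _ e2.
have [d3 d30 T2] := fr_bound T.
exists (Num.min (Num.min d2 d3) (d1 / K)); first by rewrite !lt_min d20 d30 divr_gt0.
move=> h; rewrite !lt_min => /andP[/andP[/T1 h1 /T2 h2] h3].
set k := t (z + h) - t z.
have kd : nm k < d1 by apply: le_lt_trans h2 _; rewrite mulrC -ltr_pdivlMr.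
have := G1 _ kd; rewrite {1}/k subrKC => h4.
set r := k - (c * h + d * h^*).
have kE : k = c * h + d * h^* + r by rewrite /r addrC subrK.
have -> : (g \o t) (z + h) - (g \o t) z -
  ((a * c + b * d^*) * h + (a * d + b * c^*) * h^*) =
  (g (t (z + h)) - g (t z) - (a * k + b * k^*)) + (a * r + b * r^*).
  by rewrite /= kE !cjE; ring.
apply: le_trans (nmD _ _) _.
have A1 : e / 2 / K * nm k <= e / 2 * nm h.
  apply: le_trans (ler_wpM2l (ltW e1) h2) _.
  by rewrite -/K mulrA divfK ?gt_eqF.
have A2 : nm (a * r + b * r^*) <= e / 2 * nm h.
  apply: le_trans (nmD _ _) _; rewrite !nmM nmJ -mulrDl.
  apply: le_trans (ler_wpM2r (nm_ge0 _) (_ : _ <= L)) _; first by rewrite /L; lra.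
  apply: le_trans (ler_wpM2l (ltW L0) h1) _.
  by rewrite mulrA [L * _]mulrC divfK ?gt_eqF.
have -> : e * nm h = e / 2 * nm h + e / 2 * nm h by field.
by rewrite lerD // (le_trans h4).
Qed.

Lemma fr_inv z : z != 0 -> fr (fun w => w^-1) z (- z^-2) 0.
Proof.
move=> z0 e e0.
have nz : 0 < nm z by rewrite nm_gt0.
exists (Num.min (nm z / 2) (e * nm z ^+ 3 / 2)).
  by rewrite lt_min !divr_gt0 // mulr_gt0 // exprn_gt0.
move=> h; rewrite lt_min => /andP[h1 h2].
have zh : nm z / 2 <= nm (z + h).
  have := nm_subr z (- h); rewrite nmN opprK => H; lra.
have zh0 : z + h != 0 by rewrite -nm_gt0; lra.
have -> : (z + h)^-1 - z^-1 - (- z^-2 * h + 0 * h^*) = h * h / (z ^+ 2 * (z + h)).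
  by rewrite mul0r addr0; field; rewrite ?z0 ?zh0.
rewrite !(nmM, nmV, nmX) -mulrA [e * _]mulrC ler_wpM2l ?nm_ge0 //.
rewrite ler_pdivrMr ?mulr_gt0 ?exprn_gt0 // ?nm_gt0 //.
apply: le_trans (ltW h2) _.
have -> : e * nm z ^+ 3 / 2 = e * (nm z ^+ 2 * (nm z / 2)) by field.
apply: ler_wpM2l; first exact: ltW.
by apply: ler_wpM2l => //; rewrite exprn_ge0 ?nm_ge0.
Qed.

Lemma fr_opp g z a b : fr g z a b -> fr (fun w => - g w) z (- a) (- b).
Proof.
move=> G; have := fr_mul (fr_cst (-1) z) G; rewrite !mul0r !add0r !mulN1r.
by under eq_fun do rewrite mulN1r.
Qed.

End Frechet.

(** Stated over any numeric field, since it serves both for real functions along a path and for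
    complex differentiability. *)
Lemma is_derive1P (K : numFieldType) (f : K^o -> K^o) (x v : K^o) :
  is_derive x (1 : K^o) f v <->
  (forall e : K, 0 < e -> exists2 d : K, 0 < d &
     forall h : K, `|h| < d -> `|f (x + h) - f x - v * h| <= e * `|h|).
Proof.
pose q (h : K^o) : K^o := h^-1 *: ((f \o shift x) (h *: (1 : K^o)) - f x).
have qE h : h != 0 -> `|v - q h| = `|f (x + h) - f x - v * h| / `|h|.
  move=> h0; rewrite distrC /q /= -normfV -normrM; congr `| _ |.
  by rewrite /GRing.scale /= mulr1 (addrC h x); field.
split=> [[df dv] e e0|H].
  have : q h @[h --> 0^'] --> v by rewrite -dv; exact: df.
  move=> /cvgrPdist_le /(_ e e0) /nbhs_ballP [d /= d0 dP].
  exists d => // h hd; have [->|h0] := eqVneq h 0.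
    by rewrite addr0 subrr mulr0 subr0 normr0 mulr0.
  rewrite -ler_pdivrMr ?normr_gt0 // -qE //; apply: dP => //.
  by rewrite -ball_normE /= sub0r normrN.
have L : q h @[h --> 0^'] --> v.
  apply/cvgrPdist_le => e /H [d d0 dP]; apply/nbhs_ballP; exists d => //= h.
  rewrite -ball_normE /= sub0r normrN => /dP hd h0.
  by rewrite qE // ler_pdivrMr ?normr_gt0.
split; first by apply/cvg_ex; exists v.
exact/cvg_lim.
Qed.

(** * Paths in the plane and mean value estimates *)

Section PathDerivative.
Variable R : realType.
Implicit Types (P Q : R -> R[i]) (x y a b M : R) (v : R[i]).

Definition rd P x v := forall e : R, 0 < e -> exists2 d : R, 0 < d &
  forall h : R, `|h| < d -> nm (P (x + h) - P x - v * h%:C) <= e * `|h|.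

Lemma rd_is_derive P x v : rd P x v <->
  is_derive x 1 (fun t => complex.Re (P t)) (complex.Re v) /\
  is_derive x 1 (fun t => complex.Im (P t)) (complex.Im v).
Proof.
split=> [H|[/is_derive1P H1 /is_derive1P H2] e e0].
  split; apply/is_derive1P => e /H [d d0 dP]; exists d => // h /dP; apply: le_trans.
    by apply: le_trans (ler_Re _); rewrite !ReImE /= mulr0 subr0.
  by apply: le_trans (ler_Im _); rewrite !ReImE /= mulr0 add0r.
have e2 : 0 < e / 2 by rewrite divr_gt0.
have [d d0 dP] := H1 _ e2; have [d' d'0 d'P] := H2 _ e2.
exists (Num.min d d') => [|h]; first by rewrite lt_min d0.
rewrite lt_min => /andP[/dP h1 /d'P h2].
apply: le_trans (nm_ReIm _) _; rewrite !ReImE /= mulr0 subr0 mulr0 add0r.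
by apply: le_trans (lerD h1 h2) _; rewrite -mulrDl -splitr.
Qed.

Lemma rd_cst (c : R[i]) x : rd (fun=> c) x 0.
Proof.
move=> e e0; exists 1 => // h _.
by rewrite subrr mul0r subr0 nm0 mulr_ge0 // ltW.
Qed.

Lemma rd_lin P Q (c : R[i]) x v w : rd P x v -> rd Q x w ->
  rd (fun t => P t + c * Q t) x (v + c * w).
Proof.
move=> HP HQ e e0; have c0 : 0 < nm c + 1 by rewrite ltr_pwDr // nm_ge0.
have e2 : 0 < e / 2 by rewrite divr_gt0.
have e3 : 0 < e / 2 / (nm c + 1) by rewrite divr_gt0.
have [d d0 dP] := HP _ e2; have [d' d'0 d'P] := HQ _ e3.
exists (Num.min d d') => [|h]; first by rewrite lt_min d0.
rewrite lt_min => /andP[/dP h1 /d'P h2].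
have -> : P (x + h) + c * Q (x + h) - (P x + c * Q x) - (v + c * w) * h%:C =
  (P (x + h) - P x - v * h%:C) + c * (Q (x + h) - Q x - w * h%:C) by ring.
apply: le_trans (nmD _ _) _; rewrite nmM [leRHS](_ : _ = e / 2 * `|h| + e / 2 * `|h|); last by field.
apply: lerD => //.
apply: le_trans (ler_wpM2r (nm_ge0 _) (_ : _ <= nm c + 1)) _; first lra.
apply: le_trans (ler_wpM2l (ltW c0) h2) _.
by rewrite mulrA [_ * (_ / _)]mulrC divfK ?gt_eqF.
Qed.

(** The mean value theorem is applied to the real and to the imaginary part, with two different
    intermediate points; this costs the factor 2. *)
Lemma MVT2 P (P' : R -> R[i]) a b M : a <= b ->
  (forall x, a <= x <= b -> rd P x (P' x)) ->
  (forall x, a <= x <= b -> nm (P' x) <= M) ->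
  nm (P b - P a) <= 2 * M * (b - a).
Proof.
move=> ab dP bM; have ba : 0 <= b - a by rewrite subr_ge0.
have [c1 c1P E1] : exists2 c, a <= c <= b &
    complex.Re (P b) - complex.Re (P a) = complex.Re (P' c) * (b - a).
  have [||c cab E] := @MVT_segment R (fun t => complex.Re (P t))
    (fun t => complex.Re (P' t)) a b ab.
  - by move=> x; rewrite in_itv /= => /andP[/ltW h1 /ltW h2]; have := dP x; rewrite h1 h2 => /(_ isT) /rd_is_derive[].
  - apply: derivable_within_continuous => x; rewrite in_itv /= => h.
    by have /rd_is_derive [] := dP x h => -[].
  by exists c => //; rewrite in_itv in cab.
have [c2 c2P E2] : exists2 c, a <= c <= b &
    complex.Im (P b) - complex.Im (P a) = complex.Im (P' c) * (b - a).
  have [||c cab E] := @MVT_segment R (fun t => complex.Im (P t))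
    (fun t => complex.Im (P' t)) a b ab.
  - by move=> x; rewrite in_itv /= => /andP[/ltW h1 /ltW h2]; have := dP x; rewrite h1 h2 => /(_ isT) /rd_is_derive[].
  - apply: derivable_within_continuous => x; rewrite in_itv /= => h.
    by have /rd_is_derive [] := dP x h => _ [].
  by exists c => //; rewrite in_itv in cab.
apply: le_trans (nm_ReIm _) _; rewrite !ReImE E1 E2 !normrM (ger0_norm ba) -mulrDl.
rewrite ler_wpM2r // -[2]/(1 + 1) mulrDl !mul1r lerD //.
  exact: le_trans (ler_Re _) (bM _ c1P).
exact: le_trans (ler_Im _) (bM _ c2P).
Qed.

(** [MVT2] for the path minus the line of slope [c]. The minimum and the maximum allow the segment
    to be run backwards, as happens for increments of either sign. *)
Lemma MVT_affine P (P' : R -> R[i]) a b (c : R[i]) M :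
  (forall x, Num.min a b <= x <= Num.max a b -> rd P x (P' x)) ->
  (forall x, Num.min a b <= x <= Num.max a b -> nm (P' x - c) <= M) ->
  nm (P b - P a - c * (b - a)%:C) <= 2 * M * `|b - a|.
Proof.
pose Q t : R[i] := P t + (- c) * t%:C.
have E (u t : R) : P u - P t - c * (u - t)%:C = Q u - Q t by rewrite /Q rmorphB /=; ring.
have dQ t v : rd P t v -> rd Q t (v - c).
  move=> h; rewrite -[- c]mulr1; apply: rd_lin => // e e0; exists 1 => // k _.
  rewrite [X in nm X](_ : _ = 0); last by rewrite rmorphD /=; ring.
  by rewrite nm0 mulr_ge0 // ltW.
rewrite E; case: (leP a b) => [ab dP bM|/ltW ba dP bM].
  rewrite ger0_norm ?subr_ge0 //.
  by apply: (@MVT2 Q (fun t => P' t - c)) => // x /dP /dQ.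
rewrite nm_distC distrC ger0_norm ?subr_ge0 //.
by apply: (@MVT2 Q (fun t => P' t - c)) => // x /dP /dQ.
Qed.

Lemma rd0_cst P a b : a <= b -> (forall x, a <= x <= b -> rd P x 0) -> P a = P b.
Proof.
move=> ab H; have := @MVT2 P (fun=> 0) a b 0 ab H; rewrite mulr0 mul0r nm0.
move=> /(_ (fun _ _ => lexx _)) h; apply/esym/eqP; rewrite -subr_eq0 -nm_eq0.
by rewrite eq_le h nm_ge0.
Qed.

Lemma fr_rd (f : R[i] -> R[i]) (z u : R[i]) (t : R) (a b : R[i]) : fr f (z + t%:C * u) a b ->
  rd (fun s => f (z + s%:C * u)) t (a * u + b * u^*).
Proof.
move=> H e e0; have u0 : 0 < nm u + 1 by rewrite ltr_pwDr // nm_ge0.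
have e1 : 0 < e / (nm u + 1) by rewrite divr_gt0.
have [d d0 dP] := H _ e1; exists (d / (nm u + 1)) => [|h]; first by rewrite divr_gt0.
rewrite ltr_pdivlMr // => hd.
have hu : nm (h%:C * u) <= `|h| * (nm u + 1).
  by rewrite nmM nm_real ler_wpM2l // lerDl.
have := dP (h%:C * u) (le_lt_trans hu hd).
have -> : z + t%:C * u + h%:C * u = z + (t + h)%:C * u by rewrite rmorphD /=; ring.
have -> : a * (h%:C * u) + b * (h%:C * u)^* = (a * u + b * u^*) * h%:C.
  by rewrite cjM conj_real; ring.
move=> /le_trans; apply; apply: le_trans (ler_wpM2l (ltW e1) hu) _.
by rewrite [`|h| * _]mulrC mulrA divfK ?gt_eqF.
Qed.

End PathDerivative.

(** * Partial derivatives and Wirtinger derivatives *)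

Section Wirtinger.
Variable R : realType.
Implicit Types (g f : R[i] -> R[i]) (z v : R[i]).

Lemma rd_pder g z v (w : R[i]) : rd (fun t => g (z + t%:C * v)) 0 w ->
  [/\ derivable (line_re g z v) 0 1, derivable (line_im g z v) 0 1 & pder v g z = w].
Proof.
move=> /rd_is_derive [[h1 h2] [h3 h4]]; split => //.
by apply: eqC; rewrite /= /pder /= derive1E ?h2 ?h4.
Qed.

Lemma pder_rd g z v : derivable (line_re g z v) 0 1 -> derivable (line_im g z v) 0 1 ->
  rd (fun t => g (z + t%:C * v)) 0 (pder v g z).
Proof.
move=> h1 h2; apply/rd_is_derive; rewrite /pder /= !derive1E; split.
  exact: (DeriveDef h1 erefl).
exact: (DeriveDef h2 erefl).
Qed.

Lemma fr_pder g z a b v : fr g z a b ->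
  [/\ derivable (line_re g z v) 0 1, derivable (line_im g z v) 0 1
    & pder v g z = a * v + b * v^*].
Proof.
move=> H; apply: rd_pder; apply: fr_rd.
by rewrite mul0r addr0.
Qed.

Lemma fr_wirt g z a b : fr g z a b -> wirt g z = a /\ wirtbar g z = b.
Proof.
move=> H; have [_ _ E1] := fr_pder 1 H; have [_ _ E2] := fr_pder 'i H.
rewrite /wirt /wirtbar E1 E2 cj1.
have -> : ('i : R[i])^* = - 'i by apply: eqC; rewrite !ReImE ?oppr0.
have i2 : 'i * 'i = -1 :> R[i] by rewrite -expr2 sqrCi.
split.
  have -> : a * 1 + b * 1 - 'i * (a * 'i + b * - 'i) =
    a + b - 'i * 'i * (a - b) by ring.
  by rewrite i2; field.
have -> : a * 1 + b * 1 + 'i * (a * 'i + b * - 'i) =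
  a + b + 'i * 'i * (a - b) by ring.
by rewrite i2; field.
Qed.

Lemma fr_uniq g z a b a' b' : fr g z a b -> fr g z a' b' -> a = a' /\ b = b'.
Proof. by move=> /fr_wirt[<- <-] /fr_wirt[]. Qed.

(** Continuous partial derivatives give differentiability: one goes from [z] to [z + h] along a
    horizontal and then a vertical leg, and on each leg the deviation from the linear part is
    controlled by the oscillation of one partial derivative. *)
Lemma C1_fr g z (U : set R[i]^o) : open U -> U z ->
  (forall v, v \in [:: 1; 'i] -> (forall w, U w ->
     (derivable (line_re g w v) 0 1 /\ derivable (line_im g w v) 0 1)) /\
     forall w, U w -> cts (pder v g) w) ->
  fr g z (wirt g z) (wirtbar g z).
Proof.
move=> oU Uz H e e0.
have i_in : 'i \in [:: 1; 'i : R[i]] by rewrite !inE eqxx orbT.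
have [H1 C1] := H 1 (mem_head _ _); have [Hi Ci] := H 'i i_in.
(* There are two legs, and each mean value estimate has a factor 2. *)
have e8 : 0 < e / 4 by rewrite divr_gt0.
have [d0 d00 dU] := open_nm oU Uz.
have [d1 d10 dC1] := C1 z Uz _ e8; have [d2 d20 dC2] := Ci z Uz _ e8.
exists (Num.min d0 (Num.min d1 d2)) => [|h]; first by rewrite !lt_min d00 d10.
rewrite !lt_min => /and3P[h0 h1 h2].
set x := complex.Re h; set y := complex.Im h.
have shift1 v w (t : R) : U (w + t%:C * v) -> v \in [:: 1; 'i] ->
    rd (fun s => g (w + s%:C * v)) t (pder v g (w + t%:C * v)).
  move=> Uw vi; have [d e'] := (H v vi).1 _ Uw.
  have := pder_rd d e' => K ee /K [dd dd0 K1]; exists dd => // k /K1.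
  have -> : w + (t + k)%:C * v = w + t%:C * v + (0 + k)%:C * v.
    by rewrite add0r rmorphD /=; ring.
  by rewrite mul0r addr0.
have E : g (z + h) - g z - (wirt g z * h + wirtbar g z * h^*) =
  (g (z + x%:C * 1 + y%:C * 'i) - g (z + x%:C * 1 + 0%:C * 'i) - pder 'i g z * (y - 0)%:C) +
  (g (z + x%:C * 1) - g (z + 0%:C * 1) - pder 1 g z * (x - 0)%:C).
  have -> : z + x%:C * 1 + y%:C * 'i = z + h by rewrite [in RHS](reimE h) /x /y; ring.
  rewrite !mul0r !addr0 !subr0 /wirt /wirtbar.
  have hE : h = x%:C + 'i * y%:C := reimE h.
  have hJ : h^* = x%:C - 'i * y%:C := conjE h.
  rewrite hJ [X in _ - (_ * X + _)]hE.
  have i2 : 'i * 'i = -1 :> R[i] by rewrite -expr2 sqrCi.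
  have -> : (pder 1 g z - 'i * pder 'i g z) / 2 * (x%:C + 'i * y%:C) +
    (pder 1 g z + 'i * pder 'i g z) / 2 * (x%:C - 'i * y%:C) =
    pder 1 g z * x%:C - 'i * 'i * pder 'i g z * y%:C by field.
  by rewrite i2; ring.
have bnd (s : R) (k : R) : Num.min 0 k <= s <= Num.max 0 k -> `|s| <= `|k|.
  by case: (leP 0 k) => k0 /andP[s1 s2]; [rewrite !ger0_norm|rewrite !ler0_norm] => //; lra.
rewrite E; apply: le_trans (nmD _ _) _.
have -> : e * nm h = 2 * (e / 4) * nm h + 2 * (e / 4) * nm h by field.
apply: lerD.
  apply: (@le_trans _ _ (2 * (e / 4) * `|y - 0|)).
    have hh s : Num.min 0 y <= s <= Num.max 0 y -> nm (z + x%:C * 1 + s%:C * 'i - z) <= nm h.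
      move=> /bnd sy; rewrite (_ : _ - z = x%:C + 'i * s%:C); last by ring.
      rewrite -(@ler_pXn2r _ 2) ?nnegrE ?nm_ge0 // !nm_sqrE.
      have -> : complex.Re (x%:C + 'i * s%:C) = x by rewrite !ReImE /=; ring.
      have -> : complex.Im (x%:C + 'i * s%:C) = s by rewrite !ReImE /=; ring.
      rewrite lerD2l -[s ^+ 2]real_normK ?num_real // -[leRHS]real_normK ?num_real //.
      by rewrite lerXn2r ?nnegrE.
    apply: (@MVT_affine _ (fun s => g (z + x%:C * 1 + s%:C * 'i))
       (fun s => pder 'i g (z + x%:C * 1 + s%:C * 'i))) => s /hh sh.
      by apply: shift1; [apply: dU; exact: le_lt_trans h0|rewrite !inE eqxx orbT].
    by apply/ltW/dC2; exact: le_lt_trans h2.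
  by rewrite subr0 ler_wpM2l ?ler_Im // mulr_ge0 // ltW.
apply: (@le_trans _ _ (2 * (e / 4) * `|x - 0|)).
  have hh s : Num.min 0 x <= s <= Num.max 0 x -> nm (z + s%:C * 1 - z) <= nm h.
    move=> /bnd sy; rewrite (_ : _ - z = s%:C); last by ring.
    by rewrite nm_real (le_trans sy) // ler_Re.
  apply: (@MVT_affine _ (fun s => g (z + s%:C * 1)) (fun s => pder 1 g (z + s%:C * 1))) => s /hh sh.
    by apply: shift1; [apply: dU; exact: le_lt_trans h0|rewrite mem_head].
  by apply/ltW/dC1; exact: le_lt_trans h1.
by rewrite subr0 ler_wpM2l ?ler_Re // mulr_ge0 // ltW.
Qed.

End Wirtinger.

(** * Integrals of complex functions over an interval *)

Section PathIntegral.
Variable R : realType.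
Implicit Types (P Q phi psi : R -> R[i]) (x y a b c M : R).

Definition ctsR phi x := forall e : R, 0 < e -> exists2 d : R, 0 < d &
  forall y, `|y - x| < d -> nm (phi y - phi x) < e.

Lemma real_prim (u : R -> R) a b : a <= b ->
  (forall x, a <= x <= b -> forall e : R, 0 < e -> exists2 d : R, 0 < d &
     forall y, `|y - x| < d -> `|u y - u x| < e) ->
  exists U : R -> R, forall x, a <= x <= b -> is_derive x 1 U (u x).
Proof.
(* The integrand is controlled at the points of [[a, b]] only. Composing it with the retraction [k]
   onto this interval makes it continuous on the whole line, and integrating from [a - 1] makes both
   ends interior points, so that two-sided derivatives exist there too. *)
move=> ab uc; pose k t := Num.min (Num.max t a) b.
have kab t : a <= k t <= b.
  by rewrite /k ge_min lexx orbT andbT le_min ab andbT le_max lexx orbT.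
have kid t : a <= t <= b -> k t = t.
  by case/andP=> at_ tb; rewrite /k max_l // min_l.
have klip s t : `|k s - k t| <= `|s - t|.
  have n1 := ler_norm (s - t); have := ler_norm (t - s); rewrite (distrC t s) => n2.
  rewrite /k; case: (leP s a) => ?; case: (leP t a) => ?;
  repeat match goal with |- context [Order.min ?x b] => case: (leP x b) => ? end;
  rewrite ler_norml; apply/andP; split; lra.
pose v t := u (k t).
have vc t : {for t, continuous v}.
  apply/cvgrPdist_lt => e /(uc _ (kab t)) [d d0 dP].
  apply/nbhs_ballP; exists d => // s st; have ts : `|t - s| < d by exact: st.
  rewrite distrC in ts; rewrite distrC; apply: dP; exact: le_lt_trans (klip _ _) ts.
exists (fun x => \int[lebesgue_measure]_(t in `[a - 1, x]) v t)%R => x xab.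
have xb : x < b + 1 by case/andP: xab; lra.
have ax : a - 1 < x by case/andP: xab; lra.
have vi : lebesgue_measure.-integrable `[a - 1, b + 1] (EFin \o v).
  apply: continuous_compact_integrable; first exact: segment_compact.
  by apply: continuous_subspaceT => t; exact: vc.
have [] := continuous_FTC1_closed xb vi ax (vc x).
by rewrite derive1E /v kid // => d1 d2; split.
Qed.

Definition prim phi a b P := forall x, a <= x <= b -> rd P x (phi x).

Lemma ex_prim phi a b : a <= b -> (forall x, a <= x <= b -> ctsR phi x) ->
  exists P, prim phi a b P.
Proof.
move=> ab pc.
have [U1 H1] : exists U : R -> R, forall x, a <= x <= b -> is_derive x 1 U (complex.Re (phi x)).
  apply: real_prim => // x /pc H e /H [d d0 dP]; exists d => // y /dP.
  by apply: le_lt_trans; apply: le_trans (ler_Re _); rewrite !ReImE.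
have [U2 H2] : exists U : R -> R, forall x, a <= x <= b -> is_derive x 1 U (complex.Im (phi x)).
  apply: real_prim => // x /pc H e /H [d d0 dP]; exists d => // y /dP.
  by apply: le_lt_trans; apply: le_trans (ler_Im _); rewrite !ReImE.
by exists (fun t => U1 t +i* U2 t) => x xab; apply/rd_is_derive; split; [exact: H1|exact: H2].
Qed.

(** The integral is the increment of any primitive, so that its rules reduce to rules for
    derivatives; it is [0] when there is no primitive. *)
Definition pint phi a b : R[i] :=
  if pselect (exists P, prim phi a b P) is left h then
    let P := projT1 (cid h) in P b - P a else 0.

Lemma pintE phi a b P : a <= b -> prim phi a b P -> pint phi a b = P b - P a.
Proof.
move=> ab hP; rewrite /pint; case: pselect => [h|[]]; last by exists P.
case: cid => Q hQ /=.
have : P a + -1 * Q a = P b + -1 * Q b.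
  apply: (@rd0_cst _ (fun t => P t + -1 * Q t)) => // x xab.
  have := rd_lin (-1) (hP x xab) (hQ x xab); by rewrite mulN1r subrr.
by rewrite !mulN1r => /eqP; rewrite -subr_eq0 => /eqP E; apply/eqP; rewrite -subr_eq0 -E; apply/eqP; ring.
Qed.

Lemma pint_cat phi a c b : a <= c -> c <= b -> (forall x, a <= x <= b -> ctsR phi x) ->
  pint phi a b = pint phi a c + pint phi c b.
Proof.
move=> ac cb /(ex_prim (le_trans ac cb)) [P hP].
rewrite (pintE (le_trans ac cb) hP) (@pintE _ a c P) ?(@pintE _ c b P) //; first by ring.
  by move=> x /andP[h1 h2]; apply: hP; rewrite h2 (le_trans ac).
by move=> x /andP[h1 h2]; apply: hP; rewrite h1 (le_trans h2).
Qed.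

Lemma pint_lin phi psi (c : R[i]) a b : a <= b ->
  (forall x, a <= x <= b -> ctsR phi x) -> (forall x, a <= x <= b -> ctsR psi x) ->
  pint (fun t => phi t + c * psi t) a b = pint phi a b + c * pint psi a b.
Proof.
move=> ab /(ex_prim ab) [P hP] /(ex_prim ab) [Q hQ].
rewrite (pintE ab hP) (pintE ab hQ) (@pintE _ a b (fun t => P t + c * Q t)) //.
  by ring.
by move=> x xab; apply: rd_lin; [exact: hP|exact: hQ].
Qed.

Lemma pint_bound phi a b M : a <= b -> (forall x, a <= x <= b -> ctsR phi x) ->
  (forall x, a <= x <= b -> nm (phi x) <= M) -> nm (pint phi a b) <= 2 * M * (b - a).
Proof.
move=> ab /(ex_prim ab) [P hP] bM; rewrite (pintE ab hP).
exact: (@MVT2 _ P phi).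
Qed.

Lemma pint_im_gt0 phi a b : a < b -> (forall x, a <= x <= b -> ctsR phi x) ->
  (forall x, a <= x <= b -> 0 < complex.Im (phi x)) -> 0 < complex.Im (pint phi a b).
Proof.
move=> ab /(ex_prim (ltW ab)) [P hP] p0; rewrite (pintE (ltW ab) hP).
have [||c cab E] := @MVT_segment R (fun t => complex.Im (P t))
    (fun t => complex.Im (phi t)) a b (ltW ab).
- move=> x; rewrite in_itv /= => /andP[/ltW h1 /ltW h2].
  by have := hP x; rewrite h1 h2 => /(_ isT) /rd_is_derive[].
- apply: derivable_within_continuous => x; rewrite in_itv /= => h.
  by have /rd_is_derive [] := hP x h => _ [].
by rewrite !ReImE E mulr_gt0 ?subr_gt0 // p0.
Qed.

End PathIntegral.

(** * Complex differentiability *)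

Section ComplexDiff.
Variable R : realType.
Implicit Types (f g : R[i] -> R[i]) (z w a : R[i]).

Definition holat f z := exists a, fr f z a 0.

Lemma holat_wirt f z : holat f z -> fr f z (wirt f z) 0.
Proof. by case=> a H; have [-> _] := fr_wirt H. Qed.

Lemma holat_cts f z : holat f z -> cts f z. Proof. by case=> a /fr_cts. Qed.

Lemma holatP f z : holat f z <-> derivable (f : R[i]^o -> R[i]^o) z 1.
Proof.
split=> [[a H]|].
  suff [] : is_derive (z : R[i]^o) (1 : R[i]^o) (f : R[i]^o -> R[i]^o) a by [].
  apply/is_derive1P => e e0.
  have e0' : 0 < complex.Re e by move: e0; rewrite ltcE => /andP[_].
  have eE : e = (complex.Re e)%:C by rewrite RRe_real // gtr0_real.
  have [d d0 dP] := H _ e0'; exists d%:C; first by rewrite ltcR.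
  move=> h; rewrite nmE ltcR => /dP; rewrite mul0r addr0.
  by rewrite eE !nmE -rmorphM /= lecR.
move=> /derivableP /is_derive1P H; exists ('D_1 (f : R[i]^o -> R[i]^o) z) => e e0.
have [|d d0 dP] := H e%:C; first by rewrite ltcR.
have d0' : 0 < complex.Re d by move: d0; rewrite ltcE => /andP[_].
have dE : d = (complex.Re d)%:C by rewrite RRe_real // gtr0_real.
exists (complex.Re d) => // h hd; rewrite mul0r addr0 -lecR rmorphM /= -!nmE.
by apply: dP; rewrite dE nmE ltcR.
Qed.

Lemma hol1P f z : hol1 f z <->
  exists2 r : R, 0 < r & forall w, nm (w - z) < r -> holat f w.
Proof.
split=> [/near_nm [r r0 rP]|[r r0 rP]]; first by exists r => // w /rP /holatP.
by apply/near_nm; exists r => // w /rP /holatP.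
Qed.

Lemma holat_cst (c : R[i]) z : holat (fun=> c) z.
Proof. by exists 0; exact: fr_cst. Qed.
Lemma holat_id z : holat id z.
Proof. by exists 1; exact: fr_id. Qed.
Lemma holatD f g z : holat f z -> holat g z -> holat (fun w => f w + g w) z.
Proof. by case=> a H [b H']; exists (a + b); have := fr_add H H'; rewrite addr0. Qed.
Lemma holatM f g z : holat f z -> holat g z -> holat (fun w => f w * g w) z.
Proof.
case=> a H [b H']; exists (a * g z + f z * b); have := fr_mul H H'.
by rewrite mul0r mulr0 addr0.
Qed.
Lemma holatN f z : holat f z -> holat (fun w => - f w) z.
Proof. by case=> a H; exists (- a); have := fr_opp H; rewrite oppr0. Qed.
Lemma holatB f g z : holat f z -> holat g z -> holat (fun w => f w - g w) z.
Proof. by move=> ? ?; apply: holatD => //; exact: holatN. Qed.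
Lemma fr_holcomp f g z a b : fr g z b 0 -> fr f (g z) a 0 -> fr (f \o g) z (a * b) 0.
Proof. by move=> G F; have := fr_comp G F; rewrite !mul0r mulr0 !addr0. Qed.
Lemma holat_comp f g z : holat g z -> holat f (g z) -> holat (f \o g) z.
Proof. by case=> b G [a F]; exists (a * b); exact: fr_holcomp. Qed.
Lemma holatV f z : holat f z -> f z != 0 -> holat (fun w => (f w)^-1) z.
Proof.
move=> H f0; apply: (@holat_comp (fun w => w^-1) f) => //.
by exists (- (f z) ^- 2); exact: fr_inv.
Qed.
Lemma holatX f z n : holat f z -> holat (fun w => f w ^+ n) z.
Proof.
move=> H; elim: n => [|n IH]; first exact: holat_cst.
by under eq_fun do rewrite exprS; exact: holatM.
Qed.
Lemma holat_ext f g z : (\forall w \near (z : R[i]^o), f w = g w) -> holat f z -> holat g z.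
Proof. by move=> E [a H]; exists a; exact: fr_ext H. Qed.

Lemma fr_rdh f (y t : R) a : fr f (t +i* y) a 0 -> rd (fun s => f (s +i* y)) t a.
Proof.
have E (s : R) : s +i* y = y *i + s%:C * 1 :> R[i].
  by apply: eqC; rewrite !ReImE /=; ring.
rewrite (E t) => /fr_rd; rewrite mulr1 mul0r addr0.
by under [in X in _ -> X]eq_fun do rewrite E.
Qed.

Lemma fr_rdv f (x t : R) a : fr f (x +i* t) a 0 -> rd (fun s => f (x +i* s)) t (a * 'i).
Proof.
have E (s : R) : x +i* s = x%:C + s%:C * 'i :> R[i].
  by apply: eqC; rewrite !ReImE /=; ring.
rewrite (E t) => /fr_rd; rewrite mul0r addr0.
by under [in X in _ -> X]eq_fun do rewrite E.
Qed.

Lemma cts_h f (x y : R) : cts f (x +i* y) -> ctsR (fun s => f (s +i* y)) x.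
Proof.
move=> H e /H [d d0 dP]; exists d => // s sx; apply: dP.
rewrite (_ : _ - _ = (s - x)%:C) ?nm_real //.
by apply: eqC; rewrite !ReImE /= ?subrr.
Qed.

Lemma cts_v f (x y : R) : cts f (x +i* y) -> ctsR (fun s => f (x +i* s)) y.
Proof.
move=> H e /H [d d0 dP]; exists d => // s sx; apply: dP.
rewrite (_ : _ - _ = 'i * (s - y)%:C) ?nmM ?nm_i ?mul1r ?nm_real //.
by apply: eqC; rewrite !ReImE /=; ring.
Qed.

End ComplexDiff.

Lemma fr_eq (R : realType) (f : R[i] -> R[i]) z a b a' b' :
  fr f z a b -> a = a' -> b = b' -> fr f z a' b'.
Proof. by move=> H <- <-. Qed.

(** * Cauchy's theorem and its consequences *)

Section Rectangles.
Variable R : realType.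
Implicit Types (f g F : R[i] -> R[i]) (z w p : R[i]) (x y a b M : R).

Definition rect x0 x1 y0 y1 z :=
  (x0 <= complex.Re z <= x1) && (y0 <= complex.Im z <= y1).

Definition edge x0 x1 y0 y1 z := rect x0 x1 y0 y1 z &&
  [|| complex.Re z == x0, complex.Re z == x1, complex.Im z == y0 | complex.Im z == y1].

Definition oint f x0 x1 y0 y1 : R[i] :=
  pint (fun t => f (t +i* y0)) x0 x1 + 'i * pint (fun t => f (x1 +i* t)) y0 y1
  - pint (fun t => f (t +i* y1)) x0 x1 - 'i * pint (fun t => f (x0 +i* t)) y0 y1.

Variables (x0 x1 y0 y1 : R).
Hypotheses (x01 : x0 <= x1) (y01 : y0 <= y1).

Lemma edge_b t : x0 <= t <= x1 -> edge x0 x1 y0 y1 (t +i* y0).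
Proof. by move=> h; rewrite /edge /rect /= h lexx y01 eqxx !orbT. Qed.
Lemma edge_t t : x0 <= t <= x1 -> edge x0 x1 y0 y1 (t +i* y1).
Proof. by move=> h; rewrite /edge /rect /= h lexx y01 eqxx !orbT. Qed.
Lemma edge_l t : y0 <= t <= y1 -> edge x0 x1 y0 y1 (x0 +i* t).
Proof. by move=> h; rewrite /edge /rect /= h lexx x01 eqxx. Qed.
Lemma edge_r t : y0 <= t <= y1 -> edge x0 x1 y0 y1 (x1 +i* t).
Proof. by move=> h; rewrite /edge /rect /= h lexx x01 eqxx orbT. Qed.

(** Each side length occurs twice in the contour, and each integral carries the factor 2 of
    [MVT2]. *)
Lemma oint_bound f M : (forall z, edge x0 x1 y0 y1 z -> cts f z) ->
  (forall z, edge x0 x1 y0 y1 z -> nm (f z) <= M) ->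
  nm (oint f x0 x1 y0 y1) <= 4 * M * ((x1 - x0) + (y1 - y0)).
Proof.
move=> fc fM.
have h1 : nm (pint (fun t => f (t +i* y0)) x0 x1) <= 2 * M * (x1 - x0).
  by apply: pint_bound => // t h; [apply/cts_h/fc/edge_b|apply/fM/edge_b].
have h2 : nm (pint (fun t => f (t +i* y1)) x0 x1) <= 2 * M * (x1 - x0).
  by apply: pint_bound => // t h; [apply/cts_h/fc/edge_t|apply/fM/edge_t].
have h3 : nm (pint (fun t => f (x0 +i* t)) y0 y1) <= 2 * M * (y1 - y0).
  by apply: pint_bound => // t h; [apply/cts_v/fc/edge_l|apply/fM/edge_l].
have h4 : nm (pint (fun t => f (x1 +i* t)) y0 y1) <= 2 * M * (y1 - y0).
  by apply: pint_bound => // t h; [apply/cts_v/fc/edge_r|apply/fM/edge_r].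
apply: (le_trans (nmB _ _)); rewrite nmM nm_i mul1r.
apply: (le_trans (lerD (nmB _ _) (lexx _))).
apply: (le_trans (lerD (lerD (nmD _ _) (lexx _)) (lexx _))).
rewrite nmM nm_i mul1r; lra.
Qed.

Lemma oint_lin f g (c : R[i]) : (forall z, edge x0 x1 y0 y1 z -> cts f z) ->
  (forall z, edge x0 x1 y0 y1 z -> cts g z) ->
  oint (fun z => f z + c * g z) x0 x1 y0 y1 = oint f x0 x1 y0 y1 + c * oint g x0 x1 y0 y1.
Proof.
move=> fc gc; rewrite /oint !pint_lin //; first by ring.
all: by move=> t h; (apply/cts_h || apply/cts_v); (apply: fc || apply: gc);
  (apply: edge_b || apply: edge_t || apply: edge_l || apply: edge_r).
Qed.

Lemma oint_prim f F : (forall z, edge x0 x1 y0 y1 z -> fr F z (f z) 0) ->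
  oint f x0 x1 y0 y1 = 0.
Proof.
move=> H.
have hE y : (y = y0 \/ y = y1) -> pint (fun t => f (t +i* y)) x0 x1 =
    F (x1 +i* y) - F (x0 +i* y).
  move=> yE; rewrite (@pintE _ _ _ _ (fun t => F (t +i* y))) //.
  by move=> t h; apply/fr_rdh/H; case: yE => ->; [apply: edge_b|apply: edge_t].
have vE x : (x = x0 \/ x = x1) -> 'i * pint (fun t => f (x +i* t)) y0 y1 =
    F (x +i* y1) - F (x +i* y0).
  move=> xE; rewrite (@pintE _ _ _ _ (fun t => (- 'i) * F (x +i* t))) //.
    have i2 : 'i * 'i = -1 :> R[i] by rewrite -expr2 sqrCi.
    transitivity (- ('i * 'i) * (F (x +i* y1) - F (x +i* y0))); first by ring.
    by rewrite i2; ring.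
  move=> t h; have E : fr F (x +i* t) (f (x +i* t)) 0.
    by apply: H; case: xE => ->; [apply: edge_l|apply: edge_r].
  have := rd_lin (- 'i) (rd_cst 0 t) (fr_rdv E).
  under eq_fun do rewrite add0r.
  have i2 : 'i * 'i = -1 :> R[i] by rewrite -expr2 sqrCi.
  rewrite (_ : 0 + _ = - ('i * 'i) * f (x +i* t)); last by ring.
  by rewrite i2 opprK mul1r.
by rewrite /oint !hE ?vE; auto; ring.
Qed.

End Rectangles.

Section Splitting.
Variable R : realType.
Implicit Types (f g F : R[i] -> R[i]) (z w p : R[i]) (x y a b M : R).

Lemma oint_hcat f x0 m x1 y0 y1 : x0 <= m -> m <= x1 ->
  (forall t, x0 <= t <= x1 -> cts f (t +i* y0)) ->
  (forall t, x0 <= t <= x1 -> cts f (t +i* y1)) ->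
  oint f x0 x1 y0 y1 = oint f x0 m y0 y1 + oint f m x1 y0 y1.
Proof.
move=> h1 h2 c0 c1; rewrite /oint (@pint_cat _ (fun t => f (t +i* y0)) x0 m x1) //.
  rewrite (@pint_cat _ (fun t => f (t +i* y1)) x0 m x1) //; first by ring.
  by move=> t /c1 /cts_h.
by move=> t /c0 /cts_h.
Qed.

Lemma oint_vcat f x0 x1 y0 m y1 : y0 <= m -> m <= y1 ->
  (forall t, y0 <= t <= y1 -> cts f (x0 +i* t)) ->
  (forall t, y0 <= t <= y1 -> cts f (x1 +i* t)) ->
  oint f x0 x1 y0 y1 = oint f x0 x1 y0 m + oint f x0 x1 m y1.
Proof.
move=> h1 h2 c0 c1; rewrite /oint (@pint_cat _ (fun t => f (x0 +i* t)) y0 m y1) //.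
  rewrite (@pint_cat _ (fun t => f (x1 +i* t)) y0 m y1) //; first by ring.
  by move=> t /c1 /cts_v.
by move=> t /c0 /cts_v.
Qed.

(** Bolzano-Weierstrass, transported from the compact rectangle in [R * R]. *)
Lemma rect_cluster x0 x1 y0 y1 (c : nat -> R[i]) : (forall n, rect x0 x1 y0 y1 (c n)) ->
  exists2 p, rect x0 x1 y0 y1 p &
    forall d N, 0 < d -> exists2 n, (N <= n)%N & nm (c n - p) < d.
Proof.
move=> cr.
have K : compact (`[x0, x1]%classic `*` `[y0, y1]%classic : set (R * R)).
  by apply: compact_setX; exact: segment_compact.
pose u n : R * R := (complex.Re (c n), complex.Im (c n)).
have uK : (u @ \oo) (`[x0, x1]%classic `*` `[y0, y1]%classic).
  exists 0%N => // n _; rewrite /= !in_itv /=.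
  by have /andP[] := cr n.
have [[px py] [[/= pxx pyy] cl]] := K (u @ \oo) _ uK.
exists (px +i* py).
  by rewrite /rect /=; move: pxx pyy; rewrite !in_itv /= => -> ->.
move=> d N d0; have d2 : 0 < d / 2 by rewrite divr_gt0.
have [||[a b] [/= [n Nn [<- <-]] [/= h1 h2]]] := cl [set u n | n in [set n | (N <= n)%N]]
   (ball px (d / 2) `*` ball py (d / 2)).
- by exists N => // n /= Nn; exists n.
- by exists (ball px (d / 2), ball py (d / 2)) => //; split; exact: nbhsx_ballx.
exists n => //; apply: le_lt_trans (nm_ReIm _) _; rewrite !ReImE /=.
have {}h1 : `|px - complex.Re (c n)| < d / 2 by exact: h1.
have {}h2 : `|py - complex.Im (c n)| < d / 2 by exact: h2.
by rewrite distrC [X in _ + X]distrC [d]splitr ltrD.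
Qed.

Lemma rect_ub x0 x1 y0 y1 f : (forall z, rect x0 x1 y0 y1 z -> cts f z) ->
  exists2 M : R, 0 < M & forall z, rect x0 x1 y0 y1 z -> nm (f z) <= M.
Proof.
move=> fc; apply: contrapT => H.
have bad n : exists z, rect x0 x1 y0 y1 z /\ n%:R + 1 < nm (f z).
  apply: contrapT => K; apply: H; exists (n%:R + 1); first by rewrite ltr_wpDl.
  move=> z zr; rewrite leNgt; apply/negP => ?; apply: K; by exists z.
pose c n := projT1 (cid (bad n)).
have cP n : rect x0 x1 y0 y1 (c n) /\ n%:R + 1 < nm (f (c n)) by exact: (projT2 (cid (bad n))).
have [p pr cl] := rect_cluster (fun n => (cP n).1).
have [d d0 dP] := fc p pr 1 ltr01.
have [n Nn /dP h] := cl d (Num.truncn (nm (f p))).+1 d0.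
have [_ h2] := cP n.
have h3 : nm (f p) < n%:R.
  apply: lt_le_trans (truncnS_gt _) _; by rewrite ler_nat.
have := nm_subr (f (c n)) (f p); lra.
Qed.

(** Each side of the boundary is a degenerate rectangle, so [rect_ub] applies to it. *)
Lemma edge_ub x0 x1 y0 y1 f : x0 <= x1 -> y0 <= y1 ->
  (forall z, edge x0 x1 y0 y1 z -> cts f z) ->
  exists2 M : R, 0 < M & forall z, edge x0 x1 y0 y1 z -> nm (f z) <= M.
Proof.
move=> x01 y01 fc.
have sub a b c d : (x0 <= a -> b <= x1 -> y0 <= c -> d <= y1 ->
     (a == x0) && (b == x0) || (a == x1) && (b == x1) || (c == y0) && (d == y0) || (c == y1) && (d == y1) ->
     exists2 M : R, 0 < M & forall z, rect a b c d z -> nm (f z) <= M)%R.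
  move=> h1 h2 h3 h4 H; apply: rect_ub => -[x y] /andP[/= /andP[k1 k2] /andP[k3 k4]].
  apply: fc; rewrite /edge /rect /= (le_trans h1) // (le_trans _ h2) //.
  rewrite (le_trans h3) //= (le_trans _ h4) //=.
  case/orP: H => [/orP[/orP[]|]|] /andP[/eqP e1 /eqP e2]; subst.
  - by rewrite (_ : x == x0) // eq_le k1 k2.
  - by rewrite (_ : x == x1) ?orbT // eq_le k1 k2.
  - by rewrite (_ : y == y0) ?orbT // eq_le k3 k4.
  - by rewrite (_ : y == y1) ?orbT // eq_le k3 k4.
have [M1 M10 B1] := sub x0 x0 y0 y1 (lexx _) x01 (lexx _) (lexx _) ltac:(by rewrite !eqxx ?orbT).
have [M2 M20 B2] := sub x1 x1 y0 y1 x01 (lexx _) (lexx _) (lexx _) ltac:(by rewrite !eqxx ?orbT).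
have [M3 M30 B3] := sub x0 x1 y0 y0 (lexx _) (lexx _) (lexx _) y01 ltac:(by rewrite !eqxx ?orbT).
have [M4 M40 B4] := sub x0 x1 y1 y1 (lexx _) (lexx _) y01 (lexx _) ltac:(by rewrite !eqxx ?orbT).
exists (M1 + M2 + M3 + M4); first lra.
move=> z /andP[/andP[/andP[k1 k2] /andP[k3 k4]]].
case/or4P => /eqP E.
- by have := B1 z; rewrite /rect E lexx k3 k4 => /(_ isT); lra.
- by have := B2 z; rewrite /rect E lexx k3 k4 => /(_ isT); lra.
- by have := B3 z; rewrite /rect E lexx k1 k2 => /(_ isT); lra.
- by have := B4 z; rewrite /rect E lexx k1 k2 => /(_ isT); lra.
Qed.

Lemma edge_rect x0 x1 y0 y1 z : edge x0 x1 y0 y1 z -> rect x0 x1 y0 y1 z.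
Proof. by case/andP. Qed.

(* Bisection keeps the shape of the rectangle, so a non-zero integral would
   decay only like the area along a sequence of subrectangles. *)
Lemma goursat x0 x1 y0 y1 f : x0 <= x1 -> y0 <= y1 ->
  (forall z, rect x0 x1 y0 y1 z -> holat f z) -> oint f x0 x1 y0 y1 = 0.
Proof.
move=> x01 y01 fh; apply/eqP; rewrite -nm_eq0 eq_le nm_ge0 andbT leNgt; apply/negP => Ipos.
set w := x1 - x0; set h := y1 - y0; set I0 := nm _ in Ipos.
have w0 : 0 <= w by rewrite subr_ge0.
have h0 : 0 <= h by rewrite subr_ge0.
pose W n := w / 2 ^+ n; pose H n := h / 2 ^+ n.
have p2 n : 0 < 2 ^+ n :> R by rewrite exprn_gt0.
have W0 n : 0 <= W n by rewrite divr_ge0 // ltW.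
have H0 n : 0 <= H n by rewrite divr_ge0 // ltW.
have WS n : W n = W n.+1 + W n.+1 by rewrite /W exprS; field; rewrite gt_eqF.
have HS n : H n = H n.+1 + H n.+1 by rewrite /H exprS; field; rewrite gt_eqF.
pose bad n (q : R * R) := [/\ x0 <= q.1, q.1 + W n <= x1, y0 <= q.2, q.2 + H n <= y1 &
    I0 / 4 ^+ n <= nm (oint f q.1 (q.1 + W n) q.2 (q.2 + H n))].
have bad0 : bad 0%N (x0, y0).
  by rewrite /bad /= !lexx /W /H expr0 !divr1 /w /h !subrKC !lexx /I0.
have step n (q : {q | bad n q}) : exists q' : {q | bad n.+1 q},
   [/\ (sval q).1 <= (sval q').1, (sval q').1 + W n.+1 <= (sval q).1 + W n,
       (sval q).2 <= (sval q').2 & (sval q').2 + H n.+1 <= (sval q).2 + H n].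
  case: q => -[a b] [/= a0 a1 b0 b1 IH].
  have fc x y : a <= x <= a + W n -> b <= y <= b + H n -> cts f (x +i* y).
    move=> /andP[k1 k2] /andP[k3 k4]; apply/holat_cts/fh; rewrite /rect /=.
    by rewrite (le_trans a0) //= (le_trans k2) // (le_trans b0) //= (le_trans k4).
  have Wn := W0 n.+1; have Hn := H0 n.+1; have EW := WS n; have EH := HS n.
  have am1 : a <= a + W n.+1 by lra.
  have am2 : a + W n.+1 <= a + W n by lra.
  have bm1 : b <= b + H n.+1 by lra.
  have bm2 : b + H n.+1 <= b + H n by lra.
  have E : oint f a (a + W n) b (b + H n) =
     oint f a (a + W n.+1) b (b + H n.+1) + oint f a (a + W n.+1) (b + H n.+1) (b + H n) +
     (oint f (a + W n.+1) (a + W n) b (b + H n.+1) +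
      oint f (a + W n.+1) (a + W n) (b + H n.+1) (b + H n)).
    rewrite (@oint_hcat _ a (a + W n.+1)) //; last 2 first.
    - by move=> t th; apply: fc => //; apply/andP; lra.
    - by move=> t th; apply: fc => //; apply/andP; lra.
    rewrite (@oint_vcat _ a (a + W n.+1) b (b + H n.+1)) //; last 2 first.
    - by move=> t th; apply: fc => //; apply/andP; lra.
    - by move=> t th; apply: fc => //; apply/andP; lra.
    rewrite (@oint_vcat _ (a + W n.+1) _ b (b + H n.+1)) //.
    - by move=> t th; apply: fc => //; apply/andP; lra.
    - by move=> t th; apply: fc => //; apply/andP; lra.
  apply: contrapT => K.
  have small a' b' : a <= a' -> a' + W n.+1 <= a + W n -> b <= b' -> b' + H n.+1 <= b + H n ->
     nm (oint f a' (a' + W n.+1) b' (b' + H n.+1)) < I0 / 4 ^+ n.+1.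
    move=> k1 k2 k3 k4; rewrite ltNge; apply/negP => k5; apply: K.
    have k6 : bad n.+1 (a', b') by rewrite /bad /=; split => //; lra.
    by exists (exist _ _ k6).
  have eW : a + W n.+1 + W n.+1 = a + W n by lra.
  have eH : b + H n.+1 + H n.+1 = b + H n by lra.
  have s1 : nm (oint f a (a + W n.+1) b (b + H n.+1)) < I0 / 4 ^+ n.+1 by apply: small; lra.
  have s2 : nm (oint f a (a + W n.+1) (b + H n.+1) (b + H n)) < I0 / 4 ^+ n.+1.
    by rewrite -eH; apply: small; lra.
  have s3 : nm (oint f (a + W n.+1) (a + W n) b (b + H n.+1)) < I0 / 4 ^+ n.+1.
    by rewrite -eW; apply: small; lra.
  have s4 : nm (oint f (a + W n.+1) (a + W n) (b + H n.+1) (b + H n)) < I0 / 4 ^+ n.+1.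
    by rewrite -eW -eH; apply: small; lra.
  have E4 : I0 / 4 ^+ n = 4 * (I0 / 4 ^+ n.+1).
    by rewrite exprS; field; rewrite expf_neq0.
  move: IH; rewrite E E4; apply/negP; rewrite -ltNge.
  apply: le_lt_trans (nmD _ _) _; apply: le_lt_trans (lerD (nmD _ _) (nmD _ _)) _; lra.
pose s := fix s n : {q | bad n q} :=
  if n is k.+1 then projT1 (cid (step k (s k))) else exist _ _ bad0.
have sP n := projT2 (cid (step n (s n))).
pose A n := (sval (s n)).1; pose B n := (sval (s n)).2.
have AB n : [/\ x0 <= A n, A n + W n <= x1, y0 <= B n, B n + H n <= y1 &
    I0 / 4 ^+ n <= nm (oint f (A n) (A n + W n) (B n) (B n + H n))] by exact: (svalP (s n)).
have nest n m : (n <= m)%N -> [/\ A n <= A m, A m + W m <= A n + W n, B n <= B m & B m + H m <= B n + H n].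
  elim: m => [|m IH]; first by rewrite leqn0 => /eqP ->.
  rewrite leq_eqVlt => /orP[/eqP ->//|/IH [i1 i2 i3 i4]].
  have [j1 j2 j3 j4] := sP m.
  have {}j1 : A m <= A m.+1 by exact: j1.
  have {}j2 : A m.+1 + W m.+1 <= A m + W m by exact: j2.
  have {}j3 : B m <= B m.+1 by exact: j3.
  have {}j4 : B m.+1 + H m.+1 <= B m + H m by exact: j4.
  by split; [exact: le_trans i1 j1|exact: le_trans j2 i2|exact: le_trans i3 j3|exact: le_trans j4 i4].
have [|p pr cl] := @rect_cluster x0 x1 y0 y1 (fun n => A n +i* B n).
  move=> n; have [k1 k2 k3 k4 _] := AB n; have Wn := W0 n; have Hn := H0 n; rewrite /rect /=.
  by rewrite k1 k3 (le_trans _ k2) ?(le_trans _ k4) ?lerDl.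
have pn n : rect (A n) (A n + W n) (B n) (B n + H n) p.
  have near t : 0 < t -> exists m, [/\ (n <= m)%N, `|A m - complex.Re p| < t & `|B m - complex.Im p| < t].
    move=> /(cl _ n) [m nm_ mp]; exists m; split => //; apply: le_lt_trans mp.
      by apply: le_trans (ler_Re _); rewrite !ReImE.
    by apply: le_trans (ler_Im _); rewrite !ReImE.
  have tst (u v : R) : (forall t, 0 < t -> u - v < t) -> u <= v.
    by move=> K; rewrite leNgt; apply/negP => uv; have := K (u - v); rewrite ltxx subr_gt0 => /(_ uv).
  rewrite /rect; apply/andP; split; apply/andP; split; apply: tst => t /near [m [/nest[i1 i2 i3 i4]]];
    rewrite !ltr_norml => /andP[u1 u2] /andP[v1 v2]; move: (W0 m) (H0 m);
    clear -i1 i2 i3 i4 u1 u2 v1 v2; lra.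
have [f' Hf] := fh p pr.
(* With this constant the final estimate [4 * e * (W n + H n) ^+ 2] is at most a quarter of
   [I0 / 4 ^+ n]; the summand 1 keeps the denominator positive. *)
pose e := I0 / (16 * (w + h + 1) ^+ 2).
have wh : 0 < w + h + 1 by lra.
have e0 : 0 < e by rewrite divr_gt0 // mulr_gt0 // exprn_gt0.
have [d d0 dP] := Hf e e0.
have [n Wn] : exists n, W n + H n < d.
  exists (Num.truncn ((w + h) / d)).+1; set n := _.+1.
  rewrite /W /H -mulrDl ltr_pdivrMr // mulrC -ltr_pdivrMr //.
  apply: lt_le_trans (truncnS_gt _) _.
  apply: (@le_trans _ _ n%:R); first by rewrite ler_nat.
  by rewrite -natrX ler_nat ltnW // ltn_expl.
have [k1 k2 k3 k4 k5] := AB n; have := pn n.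
set a := A n in k1 k2 k3 k4 k5 *; set b := B n in k1 k2 k3 k4 k5 *.
move=> /andP[/andP[pa pb] /andP[pc pd]]; have Wn0 := W0 n; have Hn0 := H0 n.
have aW : a <= a + W n by rewrite lerDl.
have bH : b <= b + H n by rewrite lerDl.
(* The affine approximation [L0] of [f] at [p] has the primitive [F0], so subtracting it leaves the
   integral unchanged and only the remainder has to be estimated. *)
pose F0 := fun z => f p * z + f' * ((z - p) * (z - p) / 2).
pose L0 := fun z => f p + f' * (z - p).
have LF z : fr F0 z (L0 z) 0.
  have hid := @fr_id R z; have hc (k : R[i]) := fr_cst k z.
  have h1 := fr_mul (hc (f p)) hid; have h2 := fr_add hid (hc (- p)).
  have h3 := fr_mul (fr_mul h2 h2) (hc 2^-1); have h4 := fr_mul (hc f') h3.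
  by apply: (fr_eq (fr_add h1 h4)); rewrite /L0 /=; [field|ring].
have L0c z : cts L0 z.
  apply: holat_cts; apply: holatD; first exact: holat_cst.
  apply: holatM; first exact: holat_cst.
  by apply: holatB; [exact: holat_id|exact: holat_cst].
have er z : edge a (a + W n) b (b + H n) z -> rect x0 x1 y0 y1 z.
  move=> /edge_rect /andP[/andP[z1 z2] /andP[z3 z4]]; rewrite /rect (le_trans k1 z1) (le_trans z2 k2).
  by rewrite (le_trans k3 z3) (le_trans z4 k4).
have ed z : edge a (a + W n) b (b + H n) z -> nm (z - p) <= W n + H n.
  move=> /edge_rect /andP[/andP[z1 z2] /andP[z3 z4]].
  apply: le_trans (nm_ReIm _) _; rewrite !ReImE lerD // ler_norml; apply/andP; split;
    clear -z1 z2 z3 z4 pa pb pc pd; lra.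
have fc z : edge a (a + W n) b (b + H n) z -> cts f z by move=> /er /fh /holat_cts.
have E : oint f a (a + W n) b (b + H n) =
    oint (fun z => f z + (-1) * L0 z) a (a + W n) b (b + H n).
  rewrite oint_lin //; have -> : oint L0 a (a + W n) b (b + H n) = 0.
    by apply: (@oint_prim _ _ _ _ _ _ _ _ F0).
  by rewrite mulr0 addr0.
have gc z : edge a (a + W n) b (b + H n) z -> cts (fun z => f z + (-1) * L0 z) z.
  move=> /er /fh fz; apply: holat_cts; apply: holatD => //; apply: holatM; first exact: holat_cst.
  apply: holatD; first exact: holat_cst.
  apply: holatM; first exact: holat_cst.
  by apply: holatB; [exact: holat_id|exact: holat_cst].
have bd : nm (oint f a (a + W n) b (b + H n)) <=
    4 * (e * (W n + H n)) * (a + W n - a + (b + H n - b)).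
  rewrite E; apply: oint_bound => // z /ed zp.
  have /dP := le_lt_trans zp Wn; rewrite subrKC mul0r addr0.
  rewrite (_ : f z - f p - f' * (z - p) = f z + -1 * L0 z); last by rewrite /L0; ring.
  by move=> /le_trans; apply; rewrite ler_wpM2l // ltW.
have := le_trans k5 bd.
have -> : a + W n - a + (b + H n - b) = W n + H n by ring.
have EWH : W n + H n = (w + h) / 2 ^+ n by rewrite /W /H [RHS]mulrDl.
rewrite EWH.
have -> : 4 ^+ n = 2 ^+ n * 2 ^+ n :> R by rewrite -exprMn; congr (_ ^+ _); ring.
rewrite /e; apply/negP; rewrite -ltNge.
have -> : 4 * (I0 / (16 * (w + h + 1) ^+ 2) * ((w + h) / 2 ^+ n)) * ((w + h) / 2 ^+ n) =
   I0 / (2 ^+ n * 2 ^+ n) * (((w + h) / (w + h + 1)) ^+ 2 / 4).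
  by field; rewrite !gt_eqF.
rewrite gtr_pMr; last by rewrite divr_gt0 // mulr_gt0.
have q1 : (w + h) / (w + h + 1) <= 1 by rewrite ler_pdivrMr // mul1r lerDl.
have q0 : 0 <= (w + h) / (w + h + 1) by apply: divr_ge0; [exact: addr_ge0|exact: ltW].
have := exprn_ile1 2 q0 q1; set q := _ ^+ 2; clear; lra.
Qed.

End Splitting.

(** * Isolated singularities, winding integrals and residues *)

Section Cauchy.
Variable R : realType.
Implicit Types (f g h k F : R[i] -> R[i]) (z w p a : R[i]) (x y M : R).

Lemma cts_mul f g z : cts f z -> cts g z -> cts (fun w => f w * g w) z.
Proof.
move=> /ctsP F /ctsP G; apply/ctsP.
exact: (cvgM (F := nbhs (z : R[i]^o)) (f := (f : R[i]^o -> R[i]^o)) (g := (g : R[i]^o -> R[i]^o)) F G).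
Qed.

Lemma cts_add f g z : cts f z -> cts g z -> cts (fun w => f w + g w) z.
Proof.
move=> /ctsP F /ctsP G; apply/ctsP.
exact: (cvgD (F := nbhs (z : R[i]^o)) (f := (f : R[i]^o -> R[i]^o)) (g := (g : R[i]^o -> R[i]^o)) F G).
Qed.

Lemma cts_inv f z : f z != 0 -> cts f z -> cts (fun w => (f w)^-1) z.
Proof.
move=> f0 /ctsP F; apply/ctsP.
exact: (cvgV (F := nbhs (z : R[i]^o)) (f := (f : R[i]^o -> R[i]^o)) f0 F).
Qed.

Lemma cts_cst (c : R[i]) z : cts (fun=> c) z.
Proof. by move=> e e0; exists 1 => // w _; rewrite subrr nm0. Qed.

Lemma edge_dist p r w : 0 <= r ->
  edge (complex.Re p - r) (complex.Re p + r) (complex.Im p - r) (complex.Im p + r) w ->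
  r <= nm (w - p) <= 2 * r.
Proof.
move=> r0 /andP[/andP[/andP[h1 h2] /andP[h3 h4]] H].
apply/andP; split; last first.
  apply: le_trans (nm_ReIm _) _; rewrite !ReImE mulrDl mul1r.
  by rewrite lerD // ler_norml; apply/andP; split; lra.
case/or4P: H => /eqP E.
- by apply: le_trans (ler_Re _); rewrite !ReImE E ler_normr; apply/orP; right; lra.
- by apply: le_trans (ler_Re _); rewrite !ReImE E ler_normr; apply/orP; left; lra.
- by apply: le_trans (ler_Im _); rewrite !ReImE E ler_normr; apply/orP; right; lra.
- by apply: le_trans (ler_Im _); rewrite !ReImE E ler_normr; apply/orP; left; lra.
Qed.

(** A small square of half side [r] about [p] is cut out. The four remaining rectangles contribute
    nothing by [goursat], and on the boundary of the square [h] is small compared with [1 / r],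
    while the perimeter is of order [r]. *)
Lemma oint_except x0 x1 y0 y1 h p :
  x0 < complex.Re p < x1 -> y0 < complex.Im p < y1 ->
  (forall z, rect x0 x1 y0 y1 z -> z != p -> holat h z) ->
  (forall e, 0 < e -> exists2 d : R, 0 < d &
     forall w, nm (w - p) < d -> nm ((w - p) * h w) <= e) ->
  oint h x0 x1 y0 y1 = 0.
Proof.
move=> /andP[p1 p2] /andP[p3 p4] hh h0.
apply/eqP; rewrite -nm_eq0 eq_le nm_ge0 andbT; apply/ler_addgt0Pr => e e0.
(* On the square [h] is at most [e / 16 / r] and the two sides add up to [4 * r]; with the factor 4
   of [oint_bound] this gives [e]. *)
rewrite add0r; have e16 : 0 < e / 16 by rewrite divr_gt0.
have [d d0 dP] := h0 _ e16.
set px := complex.Re p in p1 p2 *; set py := complex.Im p in p3 p4 *.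
pose r := Num.min (Num.min (Num.min (px - x0) (x1 - px)) (Num.min (py - y0) (y1 - py))) (d / 4).
have r0 : 0 < r by rewrite /r !lt_min !subr_gt0 p1 p2 p3 p4 /= divr_gt0.
have [r1 r2 r3 r4 r5] : [/\ r <= px - x0, r <= x1 - px, r <= py - y0, r <= y1 - py & r <= d / 4].
  by rewrite /r; split; rewrite ?ge_min ?lexx ?orbT.
have hc x y : x0 <= x <= x1 -> y0 <= y <= y1 -> (x != px) || (y != py) -> cts h (x +i* y).
  move=> hx hy ne; apply/holat_cts/hh; first by rewrite /rect /= hx hy.
  apply: contraTneq ne => E; have -> : x = px by rewrite /px -E.
  by rewrite /py -E !eqxx.
have ne u v : u < v \/ v < u -> u != v :> R by move=> [?|?]; [rewrite lt_eqF|rewrite gt_eqF].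
rewrite (@oint_hcat _ _ x0 (px - r)); [|lra|lra|..]; last 2 first.
- by move=> t ht; apply: hc => //; [lra|rewrite (ne y0 py) ?orbT //; left; lra].
- by move=> t ht; apply: hc => //; [lra|rewrite (ne y1 py) ?orbT //; right; lra].
rewrite (@oint_hcat _ _ (px - r) (px + r)); [|lra|lra|..]; last 2 first.
- by move=> t ht; apply: hc; [lra|lra|rewrite (ne y0 py) ?orbT //; left; lra].
- by move=> t ht; apply: hc; [lra|lra|rewrite (ne y1 py) ?orbT //; right; lra].
rewrite [oint h x0 (px - r) y0 y1]goursat ?add0r; [|lra|lra|]; last first.
  move=> z /andP[hx hy]; apply: hh; first by rewrite /rect hy andbT; lra.
  by apply: contraTneq hx => ->; apply/negP; lra.
rewrite [oint h (px + r) x1 y0 y1]goursat ?addr0; [|lra|lra|]; last first.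
  move=> z /andP[hx hy]; apply: hh; first by rewrite /rect hy andbT; lra.
  by apply: contraTneq hx => ->; apply/negP; lra.
rewrite (@oint_vcat _ _ _ _ y0 (py - r)); [|lra|lra|..]; last 2 first.
- by move=> t ht; apply: hc; [lra|lra|rewrite (ne (px - r) px) //; left; lra].
- by move=> t ht; apply: hc; [lra|lra|rewrite (ne (px + r) px) //; right; lra].
rewrite (@oint_vcat _ _ _ _ (py - r) (py + r)); [|lra|lra|..]; last 2 first.
- by move=> t ht; apply: hc; [lra|lra|rewrite (ne (px - r) px) //; left; lra].
- by move=> t ht; apply: hc; [lra|lra|rewrite (ne (px + r) px) //; right; lra].
rewrite [oint h (px - r) (px + r) y0 (py - r)]goursat ?add0r; [|lra|lra|]; last first.
  move=> z /andP[hx hy]; apply: hh; first by rewrite /rect; apply/andP; split; lra.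
  by apply: contraTneq hy => ->; apply/negP; lra.
rewrite [oint h (px - r) (px + r) (py + r) y1]goursat ?addr0; [|lra|lra|]; last first.
  move=> z /andP[hx hy]; apply: hh; first by rewrite /rect; apply/andP; split; lra.
  by apply: contraTneq hy => ->; apply/negP; lra.
have -> : e = 4 * (e / 16 / r) * ((px + r - (px - r)) + (py + r - (py - r))).
  by field; rewrite gt_eqF.
apply: oint_bound; [lra|lra|..] => z /[dup] /(edge_dist (ltW r0)) /andP[z1 z2] /edge_rect /andP[hx hy].
  apply/holat_cts/hh; first by rewrite /rect; apply/andP; split; lra.
  by rewrite -subr_eq0 -nm_gt0; lra.
have /dP : nm (z - p) < d by lra.
rewrite nmM => H; rewrite ler_pdivlMr // mulrC; apply: le_trans H.
by rewrite ler_wpM2r // nm_ge0.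
Qed.

Lemma pint_scal (phi : R -> R[i]) (c : R[i]) x y : x <= y ->
  (forall t, x <= t <= y -> ctsR phi t) ->
  pint (fun t => c * phi t) x y = c * pint phi x y.
Proof.
move=> xy /(ex_prim xy) [P hP]; rewrite (pintE xy hP).
rewrite (@pintE _ _ _ _ (fun t => 0 + c * P t)) //; first by ring.
by move=> t /hP h; have := rd_lin c (rd_cst 0 t) h; rewrite add0r.
Qed.

Lemma Re_inv z : complex.Re z^-1 = complex.Re z / nm z ^+ 2.
Proof. by rewrite nm_sqrE; case: z. Qed.

Lemma Im_inv z : complex.Im z^-1 = - complex.Im z / nm z ^+ 2.
Proof. by rewrite nm_sqrE; case: z => a b /=; rewrite mulNr. Qed.

(** The winding integral only has to be non-zero, so its value is not computed: on each side,
    oriented along the boundary, the integrand has positive imaginary part. *)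
Lemma winding_gt0 x0 x1 y0 y1 z :
  x0 < complex.Re z < x1 -> y0 < complex.Im z < y1 ->
  0 < complex.Im (oint (fun w => (w - z)^-1) x0 x1 y0 y1).
Proof.
move=> /andP[z1 z2] /andP[z3 z4].
have x01 : x0 < x1 by lra. have y01 : y0 < y1 by lra.
have hi w : w != z -> holat (fun w => (w - z)^-1) w.
  move=> wz; apply: holatV; last by rewrite subr_eq0.
  by apply: holatB; [exact: holat_id|exact: holat_cst].
have n2 (w : R[i]) : w != z -> 0 < nm (w - z) ^+ 2.
  by move=> wz; rewrite exprn_gt0 // nm_gt0 subr_eq0.
have nx (x y : R) : x != complex.Re z -> x +i* y != z.
  by apply: contra_neq => <-.
have ny (x y : R) : y != complex.Im z -> x +i* y != z.
  by apply: contra_neq => <-.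
have e0 : y0 != complex.Im z by rewrite lt_eqF.
have e1 : y1 != complex.Im z by rewrite gt_eqF.
have e2 : x0 != complex.Re z by rewrite lt_eqF.
have e3 : x1 != complex.Re z by rewrite gt_eqF.
have c0 t : x0 <= t <= x1 -> ctsR (fun t => (t +i* y0 - z)^-1) t.
  by move=> _; apply: (@cts_h _ (fun w => (w - z)^-1)); apply/holat_cts/hi/ny.
have c1 t : x0 <= t <= x1 -> ctsR (fun t => (t +i* y1 - z)^-1) t.
  by move=> _; apply: (@cts_h _ (fun w => (w - z)^-1)); apply/holat_cts/hi/ny.
have c2 t : y0 <= t <= y1 -> ctsR (fun t => (x0 +i* t - z)^-1) t.
  by move=> _; apply: (@cts_v _ (fun w => (w - z)^-1)); apply/holat_cts/hi/nx.
have c3 t : y0 <= t <= y1 -> ctsR (fun t => (x1 +i* t - z)^-1) t.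
  by move=> _; apply: (@cts_v _ (fun w => (w - z)^-1)); apply/holat_cts/hi/nx.
have sc (c : R[i]) phi t : ctsR phi t -> ctsR (fun s => c * phi s) t.
  move=> H e e0'; have k0 : 0 < nm c + 1 by rewrite ltr_pwDr // nm_ge0.
  have [d d0 dP] := H (e / (nm c + 1)) (divr_gt0 e0' k0); exists d => // s /dP.
  rewrite ltr_pdivlMr // => K; rewrite -mulrBr nmM; apply: le_lt_trans K.
  by rewrite mulrC ler_wpM2l ?nm_ge0 // lerDl.
have i1 : 0 < complex.Im (pint (fun t => (t +i* y0 - z)^-1) x0 x1).
  apply: pint_im_gt0 => // t ht; rewrite Im_inv divr_gt0 ?n2 ?ny // !ReImE /=; lra.
have i2 : 0 < complex.Im (pint (fun t => - 1 * (t +i* y1 - z)^-1) x0 x1).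
  apply: pint_im_gt0 => // [t ht|t ht]; first by apply: sc; exact: c1.
  by rewrite mulN1r ImN Im_inv -mulNr divr_gt0 ?n2 ?ny // !ReImE /=; lra.
have i3 : 0 < complex.Im (pint (fun t => 'i * (x1 +i* t - z)^-1) y0 y1).
  apply: pint_im_gt0 => // [t ht|t ht]; first by apply: sc; exact: c3.
  by rewrite ImM Re_i Im_i mul0r add0r mul1r Re_inv divr_gt0 ?n2 ?nx // !ReImE /=; lra.
have i4 : 0 < complex.Im (pint (fun t => - 'i * (x0 +i* t - z)^-1) y0 y1).
  apply: pint_im_gt0 => // [t ht|t ht]; first by apply: sc; exact: c2.
  by rewrite ImM ReN ImN Re_i Im_i oppr0 mul0r add0r mulN1r Re_inv -mulNr divr_gt0 ?n2 ?nx // !ReImE /=; lra.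
rewrite !pint_scal ?ltW // in i2 i3 i4.
move: i2 i3 i4; rewrite /oint mulN1r mulNr !ImD !ImN; lra.
Qed.

(** [k1] is minus the derivative of [k]. The remainder is quadratic in [u], uniformly for [t] away
    from the origin; this is what differentiating [k (f w - b)] in [b] under the integral sign
    requires. *)
Definition kernel_pair k k1 := [/\ forall t, t != 0 -> holat k t,
  forall t, t != 0 -> holat k1 t &
  forall d : R, 0 < d -> exists2 C : R, 0 < C & forall t u, d <= nm t -> nm u <= d / 2 ->
    nm (k (t - u) - k t - k1 t * u) <= C * nm u ^+ 2].

Lemma kernel_pair1 : kernel_pair (fun t : R[i] => t^-1) (fun t => t^-1 ^+ 2).
Proof.
split=> [t t0|t t0|d d0]; first by apply: holatV => //; exact: holat_id.
  by apply: holatX; apply: holatV => //; exact: holat_id.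
exists (2 / d ^+ 3); first by rewrite divr_gt0 // exprn_gt0.
move=> t u td ud.
have t0 : t != 0 by rewrite -nm_gt0; lra.
have tu : d / 2 <= nm (t - u) by have := nm_subr t u; lra.
have tu0 : t - u != 0 by rewrite -nm_gt0; lra.
have -> : (t - u)^-1 - t^-1 - t^-1 ^+ 2 * u = u ^+ 2 / (t ^+ 2 * (t - u)).
  by field; rewrite t0 tu0.
rewrite !(nmM, nmX, nmV) mulrC ler_wpM2r ?exprn_ge0 ?nm_ge0 //.
have -> : 2 / d ^+ 3 = (d ^+ 2 * (d / 2))^-1 by field; rewrite gt_eqF.
rewrite lef_pV2 ?posrE ?mulr_gt0 ?exprn_gt0 ?divr_gt0 // ?nm_gt0 //.
apply: ler_pM; rewrite ?exprn_ge0 ?divr_ge0 ?(ltW d0) //.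
by rewrite lerXn2r ?nnegrE ?nm_ge0 ?(ltW d0).
Qed.

Lemma kernel_pair2 : kernel_pair (fun t : R[i] => t^-1 ^+ 2) (fun t => 2 * t^-1 ^+ 3).
Proof.
split=> [t t0|t t0|d d0]; first by apply: holatX; apply: holatV => //; exact: holat_id.
  by apply: holatM; [exact: holat_cst|apply: holatX; apply: holatV => //; exact: holat_id].
(* The numerator contributes at most [4 * nm t], and the rest follows from [d <= nm t] and
   [d / 2 <= nm (t - u)]. *)
exists (16 / d ^+ 4); first by rewrite divr_gt0 // exprn_gt0.
move=> t u td ud.
have t0 : t != 0 by rewrite -nm_gt0; lra.
have tu : d / 2 <= nm (t - u) by have := nm_subr t u; lra.
have tu0 : t - u != 0 by rewrite -nm_gt0; lra.
have -> : (t - u)^-1 ^+ 2 - t^-1 ^+ 2 - 2 * t^-1 ^+ 3 * u =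
  u ^+ 2 * (3 * t - 2 * u) / (t ^+ 3 * (t - u) ^+ 2).
  by field; rewrite t0 tu0.
rewrite !(nmM, nmX, nmV) -mulrA mulrC ler_wpM2r ?exprn_ge0 ?nm_ge0 //.
have h3 : nm (3 * t - 2 * u) <= 4 * nm t.
  apply: le_trans (nmB _ _) _; rewrite !nmM.
  have -> : nm (3 : R[i]) = 3 by rewrite -[3]/(3%:R) -(rmorph_nat (real_complex R)) nm_real ger0_norm.
  have -> : nm (2 : R[i]) = 2 by rewrite -[2]/(2%:R) -(rmorph_nat (real_complex R)) nm_real ger0_norm.
  lra.
have nt : 0 < nm t by rewrite nm_gt0.
have ntu : 0 < nm (t - u) by rewrite nm_gt0.
rewrite ler_pdivrMr ?mulr_gt0 ?exprn_gt0 //; apply: (le_trans h3).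
have -> : 16 / d ^+ 4 * (nm t ^+ 3 * nm (t - u) ^+ 2) =
   4 * nm t * ((nm t / d) ^+ 2 * (nm (t - u) / (d / 2)) ^+ 2).
  by field; rewrite gt_eqF.
have A1 : 1 <= nm t / d by rewrite ler_pdivlMr ?mul1r.
have B1 : 1 <= nm (t - u) / (d / 2) by rewrite ler_pdivlMr ?mul1r ?divr_gt0.
by rewrite ler_peMr ?mulr_ge0 ?nm_ge0 // mulr_ege1 // exprn_ege1.
Qed.

(** Differentiation under the integral sign. With [f] the identity it serves Cauchy's formula; with
    general [f] it serves the integral representing an inverse function. *)
Lemma oint_kernel x0 x1 y0 y1 (phi f k k1 : R[i] -> R[i]) a (d : R) :
  x0 <= x1 -> y0 <= y1 -> kernel_pair k k1 -> 0 < d ->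
  (forall w, edge x0 x1 y0 y1 w -> [/\ holat phi w, holat f w & d <= nm (f w - a)]) ->
  fr (fun b => oint (fun w => phi w * k (f w - b)) x0 x1 y0 y1) a
     (oint (fun w => phi w * k1 (f w - a)) x0 x1 y0 y1) 0.
Proof.
move=> x01 y01 [kh k1h kk] d0 H e e0.
have [C C0 CP] := kk d d0.
have [M M0 MP] : exists2 M : R, 0 < M & forall z, edge x0 x1 y0 y1 z -> nm (phi z) <= M.
  by apply: edge_ub => // z /H [/holat_cts].
pose L := 4 * (M * C) * ((x1 - x0) + (y1 - y0)).
have L0 : 0 <= L by rewrite !mulr_ge0 ?(ltW M0) ?(ltW C0) // addr_ge0 // subr_ge0.
have L1 : 0 < L + 1 by rewrite ltr_wpDl.
exists (Num.min (d / 2) (e / (L + 1))); first by rewrite lt_min !divr_gt0.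
move=> u; rewrite lt_min => /andP[u1 u2].
have fne w : edge x0 x1 y0 y1 w -> f w - a != 0.
  by move=> /H [_ _ h]; rewrite -nm_gt0; lra.
have fneu w : edge x0 x1 y0 y1 w -> f w - (a + u) != 0.
  move=> /H [_ _ h]; rewrite -nm_gt0 opprD addrA.
  by have := nm_subr (f w - a) u; lra.
have hk q b w : (forall t, t != 0 -> holat q t) -> edge x0 x1 y0 y1 w -> f w - b != 0 ->
    holat (fun w => phi w * q (f w - b)) w.
  move=> qh we ne; have [p1 p2 _] := H w we; apply: holatM => //.
  apply: (@holat_comp _ q (fun w => f w - b)); last exact: qh.
  by apply: holatB => //; exact: holat_cst.
rewrite mul0r addr0.
have E : oint (fun w => phi w * k (f w - (a + u))) x0 x1 y0 y1 -
    oint (fun w => phi w * k (f w - a)) x0 x1 y0 y1 -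
    oint (fun w => phi w * k1 (f w - a)) x0 x1 y0 y1 * u =
  oint (fun w => (phi w * k (f w - (a + u)) + -1 * (phi w * k (f w - a))) +
    (- u) * (phi w * k1 (f w - a))) x0 x1 y0 y1.
  rewrite oint_lin //; first last.
  - by move=> w we; apply/holat_cts/hk => //; exact: fne.
  - move=> w we; apply/holat_cts/holatD; first by apply: hk => //; exact: fneu.
    by apply: holatM; [exact: holat_cst|apply: hk => //; exact: fne].
  rewrite oint_lin //; first by ring.
  - by move=> w we; apply/holat_cts/hk => //; exact: fneu.
  - by move=> w we; apply/holat_cts/hk => //; exact: fne.
rewrite E; apply: (@le_trans _ _ (L * nm u ^+ 2)).
  rewrite (_ : L * _ = 4 * (M * (C * nm u ^+ 2)) * ((x1 - x0) + (y1 - y0))); last by rewrite /L; ring.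
  apply: oint_bound => // w we.
    apply/holat_cts/holatD; last by apply: holatM; [exact: holat_cst|apply: hk => //; exact: fne].
    apply/holatD; first by apply: hk => //; exact: fneu.
    by apply: holatM; [exact: holat_cst|apply: hk => //; exact: fne].
  rewrite (_ : _ + _ = phi w * (k (f w - a - u) - k (f w - a) - k1 (f w - a) * u)); last first.
    by rewrite opprD addrA; ring.
  rewrite nmM ler_pM ?nm_ge0 ?MP // CP //; last exact: ltW.
  by have [] := H w we.
rewrite expr2 mulrA ler_wpM2r ?nm_ge0 //.
move: u2; rewrite ltr_pdivlMr // mulrDr mulr1 mulrC => u2.
by apply: ltW; apply: le_lt_trans u2; rewrite lerDl nm_ge0.
Qed.

(** The difference of the two integrands, multiplied by [w - p], tends to 0 at [p], because the
    difference quotient of [f] tends to [wirt f p]; so [oint_except] applies to it. *)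
Lemma residue x0 x1 y0 y1 (phi f : R[i] -> R[i]) p :
  x0 < complex.Re p < x1 -> y0 < complex.Im p < y1 ->
  (forall z, rect x0 x1 y0 y1 z -> [/\ holat phi z, holat f z & holat (wirt f) z]) ->
  (forall z, rect x0 x1 y0 y1 z -> f z = f p -> z = p) -> wirt f p != 0 ->
  oint (fun w => phi w * wirt f w * (f w - f p)^-1) x0 x1 y0 y1 =
  phi p * oint (fun w => (w - p)^-1) x0 x1 y0 y1.
Proof.
move=> px py H inj f'0.
have pin : rect x0 x1 y0 y1 p.
  by case/andP: px => ? ?; case/andP: py => ? ?; rewrite /rect !ltW.
have x01 : x0 <= x1 by case/andP: px => ? ?; lra.
have y01 : y0 <= y1 by case/andP: py => ? ?; lra.
have [ph fh f'h] := H p pin.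
have ep w : edge x0 x1 y0 y1 w -> w != p.
  move=> /andP[_ E]; apply: contraTneq E => ->.
  case/andP: px => ? ?; case/andP: py => ? ?.
  by rewrite !negb_or; apply/and4P; split; [rewrite gt_eqF|rewrite lt_eqF|rewrite gt_eqF|rewrite lt_eqF].
have h1 w : rect x0 x1 y0 y1 w -> w != p -> holat (fun w => phi w * wirt f w * (f w - f p)^-1) w.
  move=> wr wp; have [? ? ?] := H w wr; apply: holatM; first exact: holatM.
  apply: holatV; first by apply: holatB => //; exact: holat_cst.
  by rewrite subr_eq0; apply: contra_neq wp; exact: inj.
have h2 w : w != p -> holat (fun w => (w - p)^-1) w.
  move=> wp; apply: holatV; last by rewrite subr_eq0.
  by apply: holatB; [exact: holat_id|exact: holat_cst].
apply/eqP; rewrite -subr_eq0 -mulNr -oint_lin //; first last.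
- by move=> z /ep /h2 /holat_cts.
- by move=> z /[dup] /ep zp /edge_rect /h1 -/(_ zp) /holat_cts.
apply/eqP; apply: (@oint_except _ _ _ _ _ p) => //.
  move=> z zr zp; apply: holatD; first exact: h1.
  by apply: holatM; [exact: holat_cst|exact: h2].
pose q w := if w == p then wirt f p else (f w - f p) / (w - p).
have qp : q p = wirt f p by rewrite /q eqxx.
have qc : cts q p.
  move=> e e0; have e2 : 0 < e / 2 by rewrite divr_gt0.
  have [d d0 dP] := holat_wirt fh e2; exists d => // w wd.
  rewrite qp /q; case: eqVneq => [_|wp]; first by rewrite subrr nm0.
  have := dP _ wd; rewrite subrKC mul0r addr0 => K.
  have wp0 : w - p != 0 by rewrite subr_eq0.
  have -> : (f w - f p) / (w - p) - wirt f p = (f w - f p - wirt f p * (w - p)) / (w - p) by field.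
  rewrite nmM nmV ltr_pdivrMr ?nm_gt0 //; apply: le_lt_trans K _.
  by rewrite ltr_pM2r ?nm_gt0 //; lra.
pose psi w := phi w * wirt f w * (q w)^-1 + - phi p.
have psi0 : psi p = 0 by rewrite /psi qp mulfK // subrr.
have psic : cts psi p.
  apply: cts_add; last exact: cts_cst.
  apply: cts_mul; last by apply: cts_inv; rewrite ?qp.
  by apply: cts_mul; exact: holat_cts.
have [r r0 rin] : exists2 r : R, 0 < r & forall w, nm (w - p) < r -> rect x0 x1 y0 y1 w.
  case/andP: px => a1 a2; case/andP: py => a3 a4.
  exists (Num.min (Num.min (complex.Re p - x0) (x1 - complex.Re p)) (Num.min (complex.Im p - y0) (y1 - complex.Im p))).
    by rewrite !lt_min !subr_gt0 a1 a2 a3 a4.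
  move=> w; rewrite !lt_min => /andP[/andP[b1 b2] /andP[b3 b4]].
  have := ler_Re (w - p); have := ler_Im (w - p); rewrite !ReImE !ler_norml => /andP[? ?] /andP[? ?].
  by apply/andP; split; apply/andP; split; lra.
move=> e /psic [d d0 dP]; exists (Num.min d r); first by rewrite lt_min d0.
move=> w; rewrite lt_min => /andP[/dP wd /rin wr].
suff -> : (w - p) * (phi w * wirt f w * (f w - f p)^-1 + - phi p * (w - p)^-1) = psi w.
  by move: wd; rewrite psi0 subr0 => /ltW.
have [->|wp] := eqVneq w p; first by rewrite subrr mul0r psi0.
have wp0 : w - p != 0 by rewrite subr_eq0.
have fwp : f w - f p != 0 by rewrite subr_eq0; apply: contra_neq wp; exact: inj.
by rewrite /psi /q (negbTE wp); field; rewrite wp0 fwp.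
Qed.

End Cauchy.

(** * Derivatives, primitives and inverses of holomorphic functions *)

Section Holomorphic.
Variable R : realType.
Implicit Types (f g h k F : R[i] -> R[i]) (z w p a : R[i]) (r s : R).

Definition sqint f z s := oint f (complex.Re z - s) (complex.Re z + s)
  (complex.Im z - s) (complex.Im z + s).
Definition sqr z s := rect (complex.Re z - s) (complex.Re z + s)
  (complex.Im z - s) (complex.Im z + s).
Definition sqe z s := edge (complex.Re z - s) (complex.Re z + s)
  (complex.Im z - s) (complex.Im z + s).

Lemma sqr_dist z s w : sqr z s w -> nm (w - z) <= 2 * s.
Proof.
move=> /andP[/andP[? ?] /andP[? ?]]; apply: le_trans (nm_ReIm _) _; rewrite !ReImE mulrDl mul1r.
by rewrite lerD // ler_norml; apply/andP; split; lra.
Qed.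

Lemma disc_in z s w : nm (w - z) < s ->
  complex.Re z - s < complex.Re w < complex.Re z + s /\
  complex.Im z - s < complex.Im w < complex.Im z + s.
Proof.
move=> H; have := ler_Re (w - z); have := ler_Im (w - z); rewrite !ReImE !ler_norml.
by move=> /andP[? ?] /andP[? ?]; split; apply/andP; split; lra.
Qed.

Lemma disc_sqr z s w : nm (w - z) < s -> sqr z s w.
Proof. by move=> /disc_in [/andP[? ?] /andP[? ?]]; rewrite /sqr /rect !ltW. Qed.

Lemma wirt_id : wirt (@id R[i]) = fun=> 1.
Proof. by apply/funext => z; have [] := fr_wirt (fr_id z). Qed.

(** As the winding integral [c] is not evaluated, Cauchy's formula takes the form [f a = N a / c a].
    Both integrals can be differentiated twice under the integral sign, by the two kernel pairs,
    hence so can [f]. *)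
Lemma hol1_wirt_at f z r : 0 < r -> (forall w, nm (w - z) < r -> holat f w) ->
  holat (wirt f) z.
Proof.
move=> r0 fh; pose s := r / 4; have s0 : 0 < s by rewrite divr_gt0.
have s20 : 0 < s / 2 by rewrite divr_gt0.
have sr : 4 * s = r by rewrite /s; field.
have inr w : sqr z s w -> nm (w - z) < r by move=> /sqr_dist; lra.
have x01 : complex.Re z - s <= complex.Re z + s by lra.
have y01 : complex.Im z - s <= complex.Im z + s by lra.
have K phi (k k1 : R[i] -> R[i]) a : kernel_pair k k1 -> nm (a - z) < s / 2 ->
   (forall w, nm (w - z) < r -> holat phi w) ->
   fr (fun b => sqint (fun w => phi w * k (w - b)) z s) a
     (sqint (fun w => phi w * k1 (w - a)) z s) 0.
  move=> kk az ph; apply: (@oint_kernel _ _ _ _ _ phi id k k1 a (s / 2)) => // w we.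
  split; [exact/ph/inr/edge_rect|exact: holat_id|].
  by have /andP[? ?] := edge_dist (ltW s0) we; have := nm_tri a w z; lra.
pose N b := sqint (fun w => f w * (w - b)^-1) z s.
pose N1 b := sqint (fun w => f w * (w - b)^-1 ^+ 2) z s.
pose c b := sqint (fun w => 1 * (w - b)^-1) z s.
pose c1 b := sqint (fun w => 1 * (w - b)^-1 ^+ 2) z s.
have h1 w : nm (w - z) < r -> holat (fun=> 1 : R[i]) w by move=> _; exact: holat_cst.
have frN a : nm (a - z) < s / 2 -> fr N a (N1 a) 0.
  by move=> az; exact: (K f _ _ a (@kernel_pair1 R)).
have frN1 a : nm (a - z) < s / 2 -> holat N1 a.
  by move=> az; exists (sqint (fun w => f w * (2 * (w - a)^-1 ^+ 3)) z s); exact: (K f _ _ a (@kernel_pair2 R)).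
have frc a : nm (a - z) < s / 2 -> fr c a (c1 a) 0.
  by move=> az; exact: (K (fun=> 1) _ _ a (@kernel_pair1 R)).
have frc1 a : nm (a - z) < s / 2 -> holat c1 a.
  by move=> az; exists (sqint (fun w => 1 * (2 * (w - a)^-1 ^+ 3)) z s); exact: (K (fun=> 1) _ _ a (@kernel_pair2 R)).
have c0 a : nm (a - z) < s / 2 -> c a != 0.
  move=> az; have az' : nm (a - z) < s by lra.
  have [ax ay] := disc_in az'.
  have := winding_gt0 ax ay; apply: contraTneq; rewrite /c /sqint.
  by under eq_fun do rewrite mul1r; move=> ->; rewrite ltxx.
have fE a : nm (a - z) < s / 2 -> N a * (c a)^-1 = f a.
  move=> az; have az' : nm (a - z) < s by lra.
  have [ax ay] := disc_in az'.
  suff -> : N a = f a * c a by rewrite mulfK // c0.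
  transitivity (sqint (fun w => f w * wirt id w * (id w - id a)^-1) z s).
    by congr (sqint _ _ _); apply/funext => w; rewrite wirt_id mulr1.
  rewrite /sqint (@residue _ _ _ _ _ f id a ax ay) //.
  - by rewrite /c /sqint; under [in RHS]eq_fun do rewrite mul1r.
  - by move=> w /inr wr; split; [exact: fh|exact: holat_id|rewrite wirt_id; exact: holat_cst].
  - by rewrite wirt_id oner_neq0.
have frf a : nm (a - z) < s / 2 -> fr (fun a => N a * (c a)^-1) a
    (N1 a * (c a)^-1 + N a * (- (c a)^-1 ^+ 2 * c1 a)) 0.
  move=> az; have := fr_mul (frN a az) (fr_holcomp (frc a az) (fr_inv (c0 a az))).
  by rewrite mul0r mulr0 addr0 exprVn.
have wE a : nm (a - z) < s / 2 -> wirt f a = N1 a * (c a)^-1 + N a * (- (c a)^-1 ^+ 2 * c1 a).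
  move=> az; have nE : \forall w \near (a : R[i]^o), N w * (c w)^-1 = f w.
    apply/near_nm; exists (s / 2 - nm (a - z)) => [|w wa]; first by rewrite subr_gt0.
    by apply: fE; have := nm_tri a w z; lra.
  by have [-> _] := fr_wirt (fr_ext nE (frf a az)).
have zz : nm (z - z) < s / 2 by rewrite subrr nm0.
have hN : holat N z by exists (N1 z); exact: frN.
have hc : holat c z by exists (c1 z); exact: frc.
have hcV : holat (fun a => (c a)^-1) z by apply: holatV => //; exact: c0.
apply: (@holat_ext _ (fun a => N1 a * (c a)^-1 + N a * (- (c a)^-1 ^+ 2 * c1 a))).
  by apply/near_nm; exists (s / 2) => // w /wE.
apply: holatD; first by apply: holatM => //; exact: frN1.
apply: holatM => //; apply: holatM; last exact: frc1.
by apply: holatN; exact: holatX.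
Qed.

Lemma hol1_holat f z : hol1 f z -> holat f z.
Proof. by move=> /hol1P [r r0]; apply; rewrite subrr nm0. Qed.

Lemma hol1_near f z : hol1 f z -> \forall w \near (z : R[i]^o), hol1 f w.
Proof.
move=> /hol1P [r r0 H]; apply/near_nm; exists r => // w wz; apply/hol1P.
exists (r - nm (w - z)); first by rewrite subr_gt0.
by move=> v vw; apply: H; have := nm_tri w v z; lra.
Qed.

Lemma near_hol1 f z r : 0 < r -> (forall w, nm (w - z) < r -> holat f w) -> hol1 f z.
Proof. by move=> r0 H; apply/hol1P; exists r. Qed.

Lemma hol1_wirt f z : hol1 f z -> hol1 (wirt f) z.
Proof.
move=> /hol1_near /near_nm [r r0 H]; apply/hol1P; exists r => // w /H /hol1P [s s0 K].
exact: hol1_wirt_at K.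
Qed.

(** [F] integrates [f] along a horizontal and then a vertical leg, and [goursat] allows the legs to
    be exchanged. The increment of [F] over [h] is then a horizontal plus a vertical integral
    starting at [w], each close to [f w] times its leg. *)
Lemma hol1_prim f z : hol1 f z ->
  exists F, \forall w \near (z : R[i]^o), fr F w (f w) 0.
Proof.
move=> /hol1P [r r0 fh]; pose s := r / 4; have s0 : 0 < s by rewrite divr_gt0.
have sr : 4 * s = r by rewrite /s; field.
pose xb := complex.Re z - s; pose yb := complex.Im z - s.
have inr w : sqr z s w -> holat f w by move=> /sqr_dist ws; apply: fh; lra.
have inxy x y : xb <= x <= xb + 2 * s -> yb <= y <= yb + 2 * s -> holat f (x +i* y).
  by rewrite /xb /yb => ? ?; apply: inr; rewrite /sqr /rect /=; apply/andP; split; lra.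
pose F w := pint (fun t => f (t +i* yb)) xb (complex.Re w) +
  'i * pint (fun t => f (complex.Re w +i* t)) yb (complex.Im w).
have FE w : sqr z s w -> F w = pint (fun t => f (t +i* complex.Im w)) xb (complex.Re w) +
  'i * pint (fun t => f (xb +i* t)) yb (complex.Im w).
  rewrite /sqr /rect -/xb -/yb => /andP[/andP[w1 w2] /andP[w3 w4]].
  have : oint f xb (complex.Re w) yb (complex.Im w) = 0.
    apply: goursat => // v /andP[hx hy]; apply: inr; rewrite /sqr /rect -/xb -/yb; apply/andP; split; lra.
  by rewrite /oint /F => E; apply/eqP; rewrite -subr_eq0 -E; apply/eqP; ring.
exists F; apply/near_nm; exists s => // w wz e e0.
have [wx wy] := disc_in wz.
have e4 : 0 < e / 4 by rewrite divr_gt0.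
have [d d0 dP] := holat_cts (inr _ (disc_sqr wz)) e4.
exists (Num.min d (s - nm (w - z))) => [|h]; first by rewrite lt_min d0 subr_gt0.
rewrite lt_min => /andP[hd hs].
set x := complex.Re w in wx *; set y := complex.Im w in wy *.
pose x' := x + complex.Re h; pose y' := y + complex.Im h.
have [vx vy] : complex.Re z - s < x' < complex.Re z + s /\ complex.Im z - s < y' < complex.Im z + s.
  rewrite /x' /y' /x /y -!ReD -!ImD; apply: disc_in.
  by rewrite addrAC; apply: le_lt_trans (nmD _ _) _; lra.
have b2 : xb <= xb + 2 * s by lra. have b3 : yb <= yb + 2 * s by lra.
have [P hP] : exists P, prim (fun t => f (t +i* y)) xb (xb + 2 * s) P.
  by apply: ex_prim => // t ht; apply/cts_h/holat_cts/inxy => //; rewrite /yb; lra.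
have [Q hQ] : exists Q, prim (fun t => f (x' +i* t)) yb (yb + 2 * s) Q.
  by apply: ex_prim => // t ht; apply/cts_v/holat_cts/inxy => //; rewrite /xb; lra.
have pP t : xb <= t <= xb + 2 * s -> pint (fun t => f (t +i* y)) xb t = P t - P xb.
  by move=> ht; apply: pintE => [|u hu]; [lra|apply: hP; lra].
have pQ t : yb <= t <= yb + 2 * s -> pint (fun t => f (x' +i* t)) yb t = Q t - Q yb.
  by move=> ht; apply: pintE => [|u hu]; [lra|apply: hQ; lra].
have E1 : F (w + h) = F (x' +i* y) + 'i * (Q y' - Q y).
  rewrite /F ReD ImD -/x -/y -/x' -/y' /= !pQ; [ring|rewrite /yb; lra|rewrite /yb; lra].
have E2 : F (x' +i* y) = F w + (P x' - P x).
  rewrite !FE /=; first last.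
  - by rewrite /sqr /rect /=; apply/andP; split; lra.
  - exact: disc_sqr.
  rewrite -/x -/y !pP; [ring|rewrite /xb; lra|rewrite /xb; lra].
have wE : w = x +i* y by rewrite /x /y; case: (w).
have hE : h = (x' - x)%:C + 'i * (y' - y)%:C.
  rewrite /x' /y' [LHS]reimE; congr (_%:C + _ * _%:C); ring.
have -> : F (w + h) - F w - (f w * h + 0 * h^*) =
  (P x' - P x - f w * (x' - x)%:C) + 'i * (Q y' - Q y - f w * (y' - y)%:C).
  by rewrite mul0r addr0 E1 E2 [X in f w * X]hE; ring.
have bnd (u k t : R) : Num.min u (u + k) <= t <= Num.max u (u + k) -> `|t - u| <= `|k|.
  by case: (leP u (u + k)) => k0 /andP[s1 s2]; [rewrite !ger0_norm|rewrite !ler0_norm]; lra.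
apply: le_trans (nmD _ _) _; rewrite nmM nm_i mul1r.
have -> : e * nm h = 2 * (e / 4) * nm h + 2 * (e / 4) * nm h by field.
apply: lerD.
  apply: (@le_trans _ _ (2 * (e / 4) * `|x' - x|)).
    apply: (@MVT_affine _ P (fun t => f (t +i* y))) => t ht.
      by apply: hP; move: ht; rewrite /x' /xb; case: (leP x (x + complex.Re h)) => _ ?; rewrite /x' in vx; lra.
    apply/ltW/dP; apply: le_lt_trans hd; apply: le_trans (ler_Re _).
    by rewrite [X in nm X](_ : _ = (t - x)%:C) ?nm_real ?bnd // wE; apply: eqC; rewrite !ReImE /=; ring.
  have xx : x' - x = complex.Re h by rewrite /x'; ring.
  by rewrite xx ler_wpM2l ?ler_Re // mulr_ge0 // ltW.
apply: (@le_trans _ _ (2 * (e / 4) * `|y' - y|)).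
  apply: (@MVT_affine _ Q (fun t => f (x' +i* t))) => t ht.
    by apply: hQ; move: ht; rewrite /y' /yb; case: (leP y (y + complex.Im h)) => _ ?; rewrite /y' in vy; lra.
  apply/ltW/dP; apply: le_lt_trans hd.
  have tI : `|t - y| <= `|complex.Im h| by exact: bnd.
  rewrite -(@ler_pXn2r _ 2) ?nnegrE ?nm_ge0 // !nm_sqrE wE !ReImE /= /x'.
  rewrite addrAC subrr add0r lerD2l -[leLHS]real_normK ?num_real // -[leRHS]real_normK ?num_real //.
  by rewrite lerXn2r ?nnegrE.
have yy : y' - y = complex.Im h by rewrite /y'; ring.
by rewrite yy ler_wpM2l ?ler_Im // mulr_ge0 // ltW.
Qed.

(** Where [wirt f] stays within a quarter of its value at [z], the mean value estimate bounds the
    deviation of [f] from its linear part by half of that part, which excludes equal values. *)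
Lemma hol1_inj f z : hol1 f z -> wirt f z != 0 -> exists2 r : R, 0 < r &
  forall v w, nm (v - z) < r -> nm (w - z) < r -> f v = f w -> v = w.
Proof.
move=> /[dup] /hol1P [r r0 fh] /hol1_wirt /hol1_holat /holat_cts fc f0.
have n4 : 0 < nm (wirt f z) / 4 by rewrite divr_gt0 // nm_gt0.
have [d d0 dP] := fc _ n4; exists (Num.min r d); first by rewrite lt_min r0.
move=> v w; rewrite !lt_min => /andP[vr vd] /andP[wr wd] E.
have seg t : 0 <= t <= 1 -> nm (v + t%:C * (w - v) - z) < Num.min r d.
  move=> /andP[t0 t1]; rewrite (_ : _ - z = (1 - t)%:C * (v - z) + t%:C * (w - z)); last first.
    by rewrite rmorphB rmorph1 /=; ring.
  apply: le_lt_trans (nmD _ _) _; rewrite !nmM !nm_real !ger0_norm ?subr_ge0 //.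
  have m1 : nm (v - z) < Num.min r d by rewrite lt_min vr.
  have m2 : nm (w - z) < Num.min r d by rewrite lt_min wr.
  have [t00|tpos] := eqVneq t 0; first by rewrite t00 subr0 mul1r mul0r addr0.
  have tp : 0 < t by rewrite lt_neqAle eq_sym tpos.
  have := ler_wpM2l (_ : 0 <= 1 - t) (ltW m1); rewrite subr_ge0 => /(_ t1).
  have : t * nm (w - z) < t * Num.min r d by rewrite ltr_pM2l.
  lra.
have H := @MVT_affine _ (fun t => f (v + t%:C * (w - v))) (fun t => wirt f (v + t%:C * (w - v)) * (w - v)) 0 1
  (wirt f z * (w - v)) (nm (wirt f z) / 4 * nm (w - v)).
have {H} := H _ _; rewrite min_l ?max_r // => H.
have : nm (f (v + 1%:C * (w - v)) - f (v + 0%:C * (w - v)) - wirt f z * (w - v) * (1 - 0)%:C)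
    <= 2 * (nm (wirt f z) / 4 * nm (w - v)) * `|1 - 0|.
  apply: H => t /seg; rewrite lt_min => /andP[tr td].
    have := fr_rd (holat_wirt (fh _ tr)); by rewrite mul0r addr0.
  by rewrite -mulrBl nmM ler_wpM2r ?nm_ge0 // ltW // dP.
rewrite subr0 rmorph1 mul1r mul0r addr0 subrKC E subrr add0r normr1 !mulr1 nmN nmM => K.
apply/esym/eqP; rewrite -subr_eq0 -nm_eq0 eq_le nm_ge0 andbT.
have : nm (wirt f z) * (nm (w - v) / 2) <= 0 by lra.
by rewrite pmulr_rle0 ?nm_gt0 //; lra.
Qed.

Lemma cts_dense f g z : cts f z -> cts g z ->
  (forall d, 0 < d -> exists2 w, nm (w - z) < d & f w = g w) -> f z = g z.
Proof.
move=> fc gc H; apply/eqP; rewrite -subr_eq0 -nm_eq0 eq_le nm_ge0 andbT.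
apply/ler_addgt0Pr => e e0; rewrite add0r.
have e2 : 0 < e / 2 by rewrite divr_gt0.
have [d d0 dP] := fc _ e2; have [d' d'0 d'P] := gc _ e2.
have [|w] := H (Num.min d d'); first by rewrite lt_min d0.
rewrite lt_min => /andP[/dP h1 /d'P h2] E.
by have := nm_tri (f w) (f z) (g z); rewrite (nm_distC (f z) (f w)) {2}E; lra.
Qed.

Lemma cts_comp f g z : cts g z -> cts f (g z) -> cts (f \o g) z.
Proof. by move=> G F e /F [d d0 /= dP]; have [d' d'0 d'P] := G d d0; exists d' => // w /d'P /dP. Qed.

(* The inverse is [oint w f'(w) / (f w - a)] over [oint f'(w) / (f w - a)]; the
   residue theorem evaluates both at [a = f z] when [f' z != 0], and by
   continuity also at the zeros of [f'], which have empty interior. *)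
Lemma hol_inverse f z0 r : 0 < r -> (forall w, nm (w - z0) < r -> holat f w) ->
  (forall v w, nm (v - z0) < r -> nm (w - z0) < r -> f v = f w -> v = w) ->
  exists g, hol1 g (f z0) /\ \forall w \near (z0 : R[i]^o), g (f w) = w.
Proof.
move=> r0 fh inj; pose s := r / 4; have s0 : 0 < s by rewrite divr_gt0.
have sr : 4 * s = r by rewrite /s; field.
have inr w : sqr z0 s w -> nm (w - z0) < r by move=> /sqr_dist; lra.
have f1 w : nm (w - z0) < r -> hol1 f w.
  move=> wz; apply/hol1P; exists (r - nm (w - z0)); first by rewrite subr_gt0.
  by move=> v vw; apply: fh; have := nm_tri w v z0; lra.
have f'h w : nm (w - z0) < r -> holat (wirt f) w by move=> /f1 /hol1_wirt /hol1_holat.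
have x01 : complex.Re z0 - s <= complex.Re z0 + s by lra.
have y01 : complex.Im z0 - s <= complex.Im z0 + s by lra.
have zr : nm (z0 - z0) < r by rewrite subrr nm0.
have fne w : sqe z0 s w -> f w - f z0 != 0.
  move=> we; rewrite subr_eq0; apply/eqP => E.
  have := inj _ _ (inr _ (edge_rect we)) zr E => wz; subst w.
  by have := edge_dist (ltW s0) we; rewrite subrr nm0; lra.
have [M M0 MP] : exists2 M : R, 0 < M & forall w, sqe z0 s w -> nm ((f w - f z0)^-1) <= M.
  apply: edge_ub => // w we; apply: cts_inv; first exact: fne.
  by apply: cts_add; [exact/holat_cts/fh/inr/edge_rect|exact: cts_cst].
(* On the contour [f w] has distance at least [1 / M = 2 * d] from [f z0], hence at least [d] from
   every [a] within [d] of [f z0]. *)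
pose d := (2 * M)^-1; have d0 : 0 < d by rewrite invr_gt0 mulr_gt0.
have fd a w : nm (a - f z0) < d -> sqe z0 s w -> d <= nm (f w - a).
  move=> az we; have h1 : 2 * d <= nm (f w - f z0).
    rewrite /d invfM mulrA mulfV // mul1r -[leRHS]invrK lef_pV2 ?posrE ?invr_gt0 ?nm_gt0 ?fne //.
    by rewrite -nmV MP.
  by have := nm_tri a (f w) (f z0); lra.
pose N a := sqint (fun w => wirt f w * (f w - a)^-1) z0 s.
pose K a := sqint (fun w => w * wirt f w * (f w - a)^-1) z0 s.
have hN a : nm (a - f z0) < d -> holat N a.
  move=> az; eexists; apply: (oint_kernel x01 y01 (@kernel_pair1 R) d0) => w we.
  by have wr := inr _ (edge_rect we); split; [exact: f'h|exact: fh|exact: fd].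
have hK a : nm (a - f z0) < d -> holat K a.
  move=> az; eexists; apply: (oint_kernel x01 y01 (phi := fun w => w * wirt f w) (@kernel_pair1 R) d0) => w we.
  have wr := inr _ (edge_rect we); split; [|exact: fh|exact: fd].
  by apply: holatM; [exact: holat_id|exact: f'h].
have [d1 d10 d1P] : exists2 d1 : R, 0 < d1 & forall w, nm (w - z0) < d1 -> nm (f w - f z0) < d.
  by have [d1 d10 d1P] := holat_cts (fh z0 zr) d0; exists d1.
pose c b := sqint (fun w => (w - b)^-1) z0 s.
have c0 a : nm (a - z0) < s -> c a != 0.
  move=> az; have [/= ax ay] := disc_in az.
  by have := winding_gt0 ax ay; apply: contraTneq; rewrite /c /sqint => ->; rewrite ltxx.
have sqinj a w : nm (a - z0) < s -> sqr z0 s w -> f w = f a -> w = a.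
  by move=> az wr; apply: inj; [exact: inr|exact/inr/disc_sqr].
have resN a : nm (a - z0) < s -> wirt f a != 0 -> N (f a) = c a.
  move=> az f'a; have [ax ay] := disc_in az.
  have -> : N (f a) = sqint (fun w => (fun=> 1) w * wirt f w * (f w - f a)^-1) z0 s.
    by congr (sqint _ _ _); apply/funext => w; rewrite mul1r.
  rewrite /sqint (@residue _ _ _ _ _ (fun=> 1) f a ax ay) ?mul1r // => w; last exact: sqinj.
  by move=> /inr wr; split; [exact: holat_cst|exact: fh|exact: f'h].
have resK a : nm (a - z0) < s -> wirt f a != 0 -> K (f a) = a * c a.
  move=> az f'a; have [ax ay] := disc_in az.
  rewrite /K /sqint (@residue _ _ _ _ _ (fun w => w) f a ax ay) // => w; last exact: sqinj.
  by move=> /inr wr; split; [exact: holat_id|exact: fh|exact: f'h].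
have hc a : nm (a - z0) < s -> cts c a.
  move=> az; have e0 : 0 < s - nm (a - z0) by rewrite subr_gt0.
  have -> : c = fun b => sqint (fun w => 1 * (id w - b)^-1) z0 s.
    by apply/funext => b; rewrite /c; congr (sqint _ _ _); apply/funext => w; rewrite mul1r.
  apply: holat_cts; eexists.
  apply: (@oint_kernel _ _ _ _ _ (fun=> 1) id _ _ a _ x01 y01 (@kernel_pair1 R) e0) => w we.
  split; [exact: holat_cst|exact: holat_id|].
  by have /andP[? ?] := edge_dist (ltW s0) we; have := nm_tri a w z0; rewrite /=; lra.
pose m := Num.min s d1; have m0 : 0 < m by rewrite lt_min s0.
(* If the derivative vanished on a whole disc, [f] would be constant along a segment, against
   injectivity. *)
have dense a e : nm (a - z0) < m -> 0 < e -> exists2 w, nm (w - a) < e &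
    nm (w - z0) < m /\ wirt f w != 0.
  move=> am e0; pose e1 := Num.min e (m - nm (a - z0)).
  have e10 : 0 < e1 by rewrite lt_min e0 subr_gt0.
  apply: contrapT => H.
  have f'0 w : nm (w - a) < e1 -> wirt f w = 0.
    rewrite lt_min => /andP[w1 w2]; apply: contrapT => /eqP f'w; apply: H; exists w => //.
    by split => //; have := nm_tri a w z0; lra.
  have mr w : nm (w - z0) < m -> nm (w - z0) < r by rewrite lt_min => /andP[? _]; lra.
  have a1r w : nm (w - a) < e1 -> nm (w - z0) < r.
    rewrite lt_min => /andP[_ w2]; apply: mr; have := nm_tri a w z0; lra.
  have nt t : 0 <= t <= 1 -> nm (a + t%:C * (e1 / 2)%:C - a) < e1.
    move=> /andP[t0 t1]; rewrite addrAC subrr add0r nmM !nm_real !ger0_norm ?divr_ge0 ?(ltW e10) //.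
    have h0 : 0 <= e1 / 2 by rewrite divr_ge0 // ltW.
    by have := ler_wpM2r h0 t1; lra.
  have E : f (a + 0%:C * (e1 / 2)%:C) = f (a + 1%:C * (e1 / 2)%:C).
    apply: (@rd0_cst _ (fun t => f (a + t%:C * (e1 / 2)%:C))) => // t /nt ht.
    have := fr_rd (holat_wirt (fh _ (a1r _ ht))).
    by rewrite f'0 // !mul0r addr0.
  have n0 := nt 0; have n1 := nt 1; rewrite !lexx !ler01 in n0 n1.
  have := inj _ _ (a1r _ (n0 isT)) (a1r _ (n1 isT)) E => /eqP.
  rewrite mul0r addr0 rmorph1 mul1r -subr_eq0 opprD addrA subrr add0r oppr_eq0 -nm_eq0 nm_real.
  by rewrite gtr0_norm ?divr_gt0 // gt_eqF ?divr_gt0.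
have fcts a : nm (a - z0) < m -> cts f a.
  by rewrite lt_min => /andP[? _]; apply/holat_cts/fh; lra.
have allN a : nm (a - z0) < m -> N (f a) = c a.
  move=> /[dup] am; rewrite lt_min => /andP[a1 a2].
  apply: (@cts_dense (N \o f) c); [|exact: hc|].
    by apply: cts_comp; [exact: fcts|exact/holat_cts/hN/d1P].
  move=> e /(dense a e am) [w wa [wm f'w]]; exists w => //; apply: resN => //.
  by move: wm; rewrite lt_min => /andP[].
have allK a : nm (a - z0) < m -> K (f a) = a * c a.
  move=> /[dup] am; rewrite lt_min => /andP[a1 a2].
  apply: (@cts_dense (K \o f) (fun a => a * c a)).
  - by apply: cts_comp; [exact: fcts|exact/holat_cts/hK/d1P].
  - by apply: cts_mul; [exact/holat_cts/holat_id|exact: hc].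
  move=> e /(dense a e am) [w wa [wm f'w]]; exists w => //; apply: resK => //.
  by move: wm; rewrite lt_min => /andP[].
exists (fun a => K a * (N a)^-1); split; last first.
  apply/near_nm; exists m => // w wm; rewrite allK // allN // mulfK // c0 //.
  by move: wm; rewrite lt_min => /andP[].
have zm : nm (z0 - z0) < m by rewrite subrr nm0.
have fzd : nm (f z0 - f z0) < d by rewrite subrr nm0.
have N0 : 0 < nm (N (f z0)) by rewrite nm_gt0 allN // c0 // subrr nm0.
have [d2 d20 d2P] := holat_cts (hN _ fzd) N0.
apply/hol1P; exists (Num.min d d2) => [|a]; first by rewrite lt_min d0.
rewrite lt_min => /andP[ad /d2P h]; apply: holatM; first exact: hK.
apply: holatV; first exact: hN.
apply: contraTneq h => ->; by rewrite sub0r nmN ltxx.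
Qed.

Lemma near_fun f z (P : R[i] -> Prop) : cts f z ->
  (\forall a \near (f z : R[i]^o), P a) -> \forall w \near (z : R[i]^o), P (f w).
Proof.
move=> fc /near_nm [d d0 dP]; have [e e0 eP] := fc d d0.
by apply/near_nm; exists e => // w /eP /dP.
Qed.

Lemma nearI z (P Q : R[i] -> Prop) : (\forall w \near (z : R[i]^o), P w) ->
  (\forall w \near (z : R[i]^o), Q w) -> \forall w \near (z : R[i]^o), P w /\ Q w.
Proof.
move=> /near_nm [d d0 dP] /near_nm [e e0 eP]; apply/near_nm.
exists (Num.min d e); first by rewrite lt_min d0.
by move=> w; rewrite lt_min => /andP[/dP ? /eP ?].
Qed.

Lemma nearS z (P Q : R[i] -> Prop) : (forall w, P w -> Q w) ->
  (\forall w \near (z : R[i]^o), P w) -> \forall w \near (z : R[i]^o), Q w.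
Proof. by move=> PQ /near_nm [d d0 dP]; apply/near_nm; exists d => // w /dP /PQ. Qed.

(** The chain rule makes the derivative of [g] at [f z0] non-zero, so [g] is injective near that
    point, and [g (f (g a)) = g a] gives the other inverse relation. *)
Lemma hol_local_inverse f z0 r : hol1 f z0 -> 0 < r ->
  (forall v w, nm (v - z0) < r -> nm (w - z0) < r -> f v = f w -> v = w) ->
  exists g, [/\ hol1 g (f z0), \forall w \near (z0 : R[i]^o), g (f w) = w
    & \forall a \near (f z0 : R[i]^o), f (g a) = a].
Proof.
move=> /hol1P [r' r'0 fh] r0 inj; pose m := Num.min r r'.
have m0 : 0 < m by rewrite lt_min r0.
have [g [gh gf]] : exists g, hol1 g (f z0) /\ \forall w \near (z0 : R[i]^o), g (f w) = w.
  apply: (@hol_inverse f z0 m) => // [w|v w]; rewrite !lt_min; first by move=> /andP[_ /fh].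
  by move=> /andP[? _] /andP[? _]; exact: inj.
have fz : holat f z0 by apply: fh; rewrite subrr nm0.
have gz : g (f z0) = z0 := ex_near gf.
exists g; split => //.
have g'0 : wirt g (f z0) != 0.
  have h := fr_holcomp (holat_wirt fz) (holat_wirt (hol1_holat gh)).
  have h2 : fr (g \o f) z0 1 0.
    by apply: fr_ext (fr_id z0); apply: nearS gf => w /= ->.
  have [E _] := fr_uniq h h2; apply/eqP => E0; move: E.
  by rewrite E0 mul0r => /esym/eqP; rewrite oner_eq0.
have [d d0 dP] := hol1_inj gh g'0.
have gc := holat_cts (hol1_holat gh).
have fgc : cts (f \o g) (f z0) by apply: cts_comp => //; rewrite gz; exact: holat_cts.
have H1 : \forall a \near (f z0 : R[i]^o), nm (f (g a) - f z0) < d.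
  by have [e e0 eP] := fgc d d0; apply/near_nm; exists e => // a /eP /=; rewrite gz.
have H2 : \forall a \near (f z0 : R[i]^o), g (f (g a)) = g a.
  by apply: (near_fun (P := fun w => g (f w) = w) gc); rewrite gz.
have H3 : \forall a \near (f z0 : R[i]^o), nm (a - f z0) < d by apply/near_nm; exists d.
apply: nearS (nearI H1 (nearI H2 H3)) => a [h1 [h2 h3]].
exact: dP.
Qed.

Lemma hol1_id z : hol1 (@id R[i]) z.
Proof. by apply/hol1P; exists 1 => // *; exact: holat_id. Qed.
Lemma hol1_cst (c : R[i]) z : hol1 (fun=> c) z.
Proof. by apply/hol1P; exists 1 => // *; exact: holat_cst. Qed.
Lemma hol1_nearE f z : hol1 f z <-> \forall w \near (z : R[i]^o), holat f w.
Proof. by rewrite hol1P -near_nm. Qed.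
Lemma hol1D f g z : hol1 f z -> hol1 g z -> hol1 (fun w => f w + g w) z.
Proof. by move=> /hol1_nearE F /hol1_nearE G; apply/hol1_nearE; apply: nearS (nearI F G) => w [? ?]; exact: holatD. Qed.
Lemma hol1M f g z : hol1 f z -> hol1 g z -> hol1 (fun w => f w * g w) z.
Proof. by move=> /hol1_nearE F /hol1_nearE G; apply/hol1_nearE; apply: nearS (nearI F G) => w [? ?]; exact: holatM. Qed.
Lemma hol1N f z : hol1 f z -> hol1 (fun w => - f w) z.
Proof. by move=> /hol1_nearE F; apply/hol1_nearE; apply: nearS F => w; exact: holatN. Qed.
Lemma hol1_comp f g z : hol1 g z -> hol1 f (g z) -> hol1 (f \o g) z.
Proof.
move=> /[dup] G1 /hol1_nearE G /hol1_nearE F; apply/hol1_nearE.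
have H := near_fun (holat_cts (hol1_holat G1)) F.
by apply: nearS (nearI G H) => w [? ?]; exact: holat_comp.
Qed.
Lemma cts_neq0 f z : cts f z -> f z != 0 -> \forall w \near (z : R[i]^o), f w != 0.
Proof.
move=> fc f0; have n0 : 0 < nm (f z) by rewrite nm_gt0.
have [d d0 dP] := fc _ n0; apply/near_nm; exists d => // w /dP.
by apply: contraTneq => ->; rewrite sub0r nmN ltxx.
Qed.
Lemma hol1V f z : hol1 f z -> f z != 0 -> hol1 (fun w => (f w)^-1) z.
Proof.
move=> /[dup] F1 /hol1_nearE F f0; apply/hol1_nearE.
by apply: nearS (nearI F (cts_neq0 (holat_cts (hol1_holat F1)) f0)) => w [? ?]; exact: holatV.
Qed.
Lemma hol1_ext f g z : (\forall w \near (z : R[i]^o), f w = g w) -> hol1 f z -> hol1 g z.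
Proof.
move=> /near_nm [d d0 E] /hol1P [e e0 H]; apply: (@near_hol1 _ _ (Num.min d e)); first by rewrite lt_min d0.
move=> w; rewrite lt_min => /andP[wd we]; apply: holat_ext (H w we).
apply/near_nm; exists (d - nm (w - z)); first by rewrite subr_gt0.
by move=> v vw; apply: E; have := nm_tri w v z; lra.
Qed.

(** A local inverse of squaring at a root [b] of [a], where the derivative [b + b] does not
    vanish. *)
Lemma hol1_sqrt (a : R[i]) : a != 0 ->
  exists q, hol1 q a /\ \forall w \near (a : R[i]^o), q w ^+ 2 = w.
Proof.
move=> a0; pose b := sqrtc a; have ba : b * b = a by rewrite -expr2 sqr_sqrtc.
have b0 : b != 0 by apply: contraNneq a0 => b0; rewrite -ba b0 mul0r.
have fh z : fr (fun w => w * w) z (z + z) 0.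
  by apply: (fr_eq (fr_mul (fr_id z) (fr_id z))); rewrite /=; ring.
have sh : hol1 (fun w : R[i] => w * w) b by apply: hol1M; exact: hol1_id.
have [r r0 inj] : exists2 r, 0 < r &
  forall v w, nm (v - b) < r -> nm (w - b) < r -> v * v = w * w -> v = w.
  apply: (hol1_inj sh); have [-> _] := fr_wirt (fh b).
  by rewrite -mulr2n mulrn_eq0.
have [q [qh _ qq]] := hol_local_inverse sh r0 inj.
by exists q; rewrite -ba; split => //; apply: nearS qq => w; rewrite expr2.
Qed.

(** The exponential is used near a single point. It is the local inverse of a primitive [L] of
    [1 / w] near 1, and the base point [c = L 1] absorbs the constant of integration. *)
Lemma hol1_exp : exists (E : R[i] -> R[i]) (c : R[i]),
  \forall a \near (c : R[i]^o), fr E a (E a) 0 /\ E a != 0.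
Proof.
have h1 : hol1 (fun w : R[i] => w^-1) 1 by apply: hol1V; [exact: hol1_id|exact: oner_neq0].
have [L LP] := hol1_prim h1.
have Lh : hol1 L 1 by apply/hol1_nearE; apply: nearS LP => w H; exists w^-1.
have L'1 : wirt L 1 = 1.
  by have [-> _] := fr_wirt (ex_near LP); rewrite invr1.
have [r r0 inj] : exists2 r, 0 < r &
  forall v w, nm (v - 1) < r -> nm (w - 1) < r -> L v = L w -> v = w.
  by apply: (hol1_inj Lh); rewrite L'1 oner_neq0.
have [E [Eh EL LE]] := hol_local_inverse Lh r0 inj.
exists E, (L 1).
have E1 : E (L 1) = 1 := ex_near EL.
have Ec := holat_cts (hol1_holat Eh).
have E0 : \forall a \near (L 1 : R[i]^o), E a != 0 by apply: cts_neq0 => //; rewrite E1 oner_neq0.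
have LEp : \forall a \near (L 1 : R[i]^o), fr L (E a) (E a)^-1 0.
  by apply: (near_fun (P := fun w => fr L w w^-1 0)); rewrite ?E1.
have LE2 : \forall a \near (L 1 : R[i]^o), \forall b \near (a : R[i]^o), L (E b) = b.
  move: LE => /near_nm [d d0 dP]; apply/near_nm; exists d => // a ad.
  apply/near_nm; exists (d - nm (a - L 1)); first by rewrite subr_gt0.
  by move=> b ba; apply: dP; have := nm_tri a b (L 1); lra.
move/hol1_nearE: Eh => Eh.
apply: nearS (nearI (nearI Eh E0) (nearI LEp LE2)) => a [[k1 k2] [k3 k4]]; split => //.
have K := fr_holcomp (holat_wirt k1) k3.
have [K1 _] := fr_uniq K (fr_ext (nearS (fun b (e : L (E b) = b) => esym e) k4) (fr_id a)).
have -> : E a = wirt E a; last exact: holat_wirt.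
by rewrite -[RHS](mulKf k2) mulrCA K1 mulr1.
Qed.

End Holomorphic.

(** * Rings of functions: products and determinants of matrices *)

Section RingClosure.
Variables (K : comUnitRingType) (T : Type) (P : (T -> K) -> Prop).
Hypotheses (PC : forall c, P (fun=> c))
  (PD : forall f g, P f -> P g -> P (fun x => f x + g x))
  (PM : forall f g, P f -> P g -> P (fun x => f x * g x)).

Lemma closed_sum (I : Type) (s : seq I) (Q : pred I) (F : I -> T -> K) :
  (forall i, P (F i)) -> P (fun x => \sum_(i <- s | Q i) F i x).
Proof.
move=> H; elim: s => [|i s IH].
  by rewrite (_ : (fun _ => _) = fun=> 0) //; apply/funext => x; rewrite big_nil.
rewrite (_ : (fun _ => _) = fun x => (if Q i then F i x else 0) + \sum_(i <- s | Q i) F i x).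
  by apply: PD => //; case: (Q i).
by apply/funext => x; rewrite big_cons; case: (Q i); rewrite ?add0r.
Qed.

Lemma closed_prod (I : Type) (s : seq I) (F : I -> T -> K) :
  (forall i, P (F i)) -> P (fun x => \prod_(i <- s) F i x).
Proof.
move=> H; elim: s => [|i s IH].
  by rewrite (_ : (fun _ => _) = fun=> 1) //; apply/funext => x; rewrite big_nil.
rewrite (_ : (fun _ => _) = fun x => F i x * \prod_(i <- s) F i x).
  exact: PM.
by apply/funext => x; rewrite big_cons.
Qed.

Definition closedmx m n (A : T -> 'M[K]_(m, n)) := forall i j, P (fun x => A x i j).

Lemma closed_mulmx m n p (A : T -> 'M[K]_(m, n)) (B : T -> 'M[K]_(n, p)) :
  closedmx A -> closedmx B -> closedmx (fun x => A x *m B x).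
Proof.
move=> HA HB i j; under eq_fun do rewrite mxE.
by apply: closed_sum => k; exact: PM.
Qed.

Lemma closed_det n (A : T -> 'M[K]_n) : closedmx A -> P (fun x => \det (A x)).
Proof.
move=> HA; rewrite /determinant; apply: closed_sum => s; apply: PM => //.
exact: closed_prod.
Qed.

End RingClosure.

Lemma invmxM (K : comUnitRingType) n (A B : 'M[K]_n) : A \in unitmx -> B \in unitmx ->
  invmx (A *m B) = invmx B *m invmx A.
Proof.
move=> uA uB; have uAB : A *m B \in unitmx by rewrite unitmx_mul uA.
rewrite -[RHS]mulmx1 -(mulmxV uAB) !mulmxA -[invmx B *m _ *m A]mulmxA mulVmx //.
by rewrite mulmx1 mulVmx // mul1mx.
Qed.

(** * Metrics factored through holomorphic matrices *)

Section Gram.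
Variable R : realType.
Implicit Types (f g h F d : R[i] -> R[i]) (z w a : R[i]).

Lemma nearJ z (P : R[i] -> Prop) : (\forall w \near (z : R[i]^o), P w) ->
  \forall w \near (z : R[i]^o), \forall v \near (w : R[i]^o), P v.
Proof.
move=> /near_nm [d d0 dP]; apply/near_nm; exists d => // w wz.
apply/near_nm; exists (d - nm (w - z)); first by rewrite subr_gt0.
by move=> v vw; apply: dP; have := nm_tri w v z; lra.
Qed.

Lemma near_all z (I : finType) (P : I -> R[i] -> Prop) :
  (forall i, \forall w \near (z : R[i]^o), P i w) ->
  \forall w \near (z : R[i]^o), forall i, P i w.
Proof.
move=> H; have K (s : seq I) : \forall w \near (z : R[i]^o), forall i, i \in s -> P i w.
  elim: s => [|i s IH]; first by apply/near_nm; exists 1.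
  apply: nearS (nearI (H i) IH) => w [h1 h2] j; rewrite inE => /orP[/eqP ->//|]; exact: h2.
by apply: nearS (K (enum I)) => w Pw i; apply: Pw; rewrite mem_enum.
Qed.

(* The functions [\sum_p p.1 * p.2^*] with [p.1], [p.2] holomorphic are stable
   under both partial derivatives. *)
Definition sesq (s : seq ((R[i] -> R[i]) * (R[i] -> R[i]))) (w : R[i]) :=
  \sum_(p <- s) p.1 w * (p.2 w)^*.

Fixpoint sesq_hol (U : set R[i]^o) (s : seq ((R[i] -> R[i]) * (R[i] -> R[i]))) : Prop :=
  if s is p :: s' then
    [/\ forall z, U z -> holat p.1 z, forall z, U z -> holat p.2 z & sesq_hol U s']
  else True.

Lemma open_wirt (U : set R[i]^o) f : open U -> (forall z, U z -> holat f z) ->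
  forall z, U z -> holat (wirt f) z.
Proof.
move=> oU fh z Uz; have [d d0 dP] := open_nm oU Uz.
by apply: (hol1_wirt_at d0) => w /dP /fh.
Qed.

Lemma sesq_cons p s : sesq (p :: s) = fun w => p.1 w * (p.2 w)^* + sesq s w.
Proof. by apply/funext => w; rewrite /sesq big_cons. Qed.

Lemma fr_sesq (U : set R[i]^o) s z : sesq_hol U s -> U z ->
  fr (sesq s) z (sesq [seq (wirt p.1, p.2) | p <- s] z) (sesq [seq (p.1, wirt p.2) | p <- s] z).
Proof.
move=> + Uz; elim: s => [_|p s IH [h1 h2 /IH h3]].
  rewrite /sesq /= !big_nil (_ : (fun _ => _) = fun=> 0); first exact: fr_cst.
  by apply/funext => w; rewrite big_nil.
rewrite sesq_cons /= !sesq_cons; apply: fr_add => //.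
have := fr_mul (holat_wirt (h1 z Uz)) (fr_conj (holat_wirt (h2 z Uz))).
by rewrite cj0 mulr0 mul0r addr0 add0r.
Qed.

Lemma sesq_cat s t w : sesq (s ++ t) w = sesq s w + sesq t w.
Proof. by rewrite /sesq big_cat. Qed.

Lemma sesq_hol_cat U s t : sesq_hol U s -> sesq_hol U t -> sesq_hol U (s ++ t).
Proof. by move=> + Ht; elim: s => //= p s IH [? ? /IH]. Qed.

(** Derivatives at a point of the open set [U] depend on the values in [U] alone, so equality on [U]
    passes to every order. *)
Lemma Ck_ext (k : nat) (U : set R[i]^o) g h : open U -> (forall z, U z -> g z = h z) ->
  Ck k U g -> Ck k U h.
Proof.
move=> oU; elim: k g h => [|k IH] g h E /= H.
  move=> z Uz; apply/ctsP => e e0; have /ctsP /(_ e e0) [d d0 dP] := H z Uz.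
  have [d' d'0 d'P] := open_nm oU Uz; exists (Num.min d d'); first by rewrite lt_min d0.
  by move=> w; rewrite lt_min => /andP[/dP h1 /d'P h2]; rewrite -!E.
move=> v vi; have [H1 H2] := H v vi.
have rdE z w : U z -> rd (fun t => g (z + t%:C * v)) 0 w -> rd (fun t => h (z + t%:C * v)) 0 w.
  move=> Uz K e e0; have [d d0 dP] := K e e0; have [d' d'0 d'P] := open_nm oU Uz.
  have v0 : 0 < nm v + 1 by rewrite ltr_pwDr // nm_ge0.
  exists (Num.min d (d' / (nm v + 1))) => [|t]; first by rewrite lt_min d0 divr_gt0.
  rewrite lt_min add0r => /andP[td]; rewrite ltr_pdivlMr // => td'.
  rewrite -!E; [by have := dP t td; rewrite add0r| |].
    by rewrite mul0r addr0.
  apply: d'P; rewrite addrAC subrr add0r nmM nm_real; apply: le_lt_trans td'.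
  by rewrite ler_wpM2l // lerDl.
have R1 z : U z -> [/\ derivable (line_re h z v) 0 1, derivable (line_im h z v) 0 1 & pder v h z = pder v g z].
  by move=> Uz; have [d1 d2] := H1 z Uz; apply: rd_pder; apply: rdE => //; exact: pder_rd.
split; first by move=> z /R1 [].
by apply: IH H2 => z /R1 [].
Qed.

Lemma sesq_Ck (k : nat) (U : set R[i]^o) s : open U -> sesq_hol U s -> Ck k U (sesq s).
Proof.
move=> oU; elim: k s => [|k IH] s sh /=.
  by move=> z Uz; apply/ctsP; exact: fr_cts (fr_sesq sh Uz).
move=> v _; split=> [z Uz|].
  by have [] := fr_pder v (fr_sesq sh Uz).
pose s1 := [seq ((fun w => v * wirt p.1 w), p.2) | p <- s].
pose s2 := [seq ((fun w => v^* * p.1 w), wirt p.2) | p <- s].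
apply: (@Ck_ext _ _ (sesq (s1 ++ s2))) => // [z Uz|].
  have [_ _ ->] := fr_pder v (fr_sesq sh Uz).
  rewrite sesq_cat /s1 /s2 /sesq !big_map !mulr_suml.
  by congr (_ + _); apply: eq_bigr => p _ /=; ring.
apply: IH; apply: sesq_hol_cat; rewrite /s1 /s2; elim: (s) sh => //= p t IHt [h1 h2 /IHt h3].
  split => // z Uz; apply: holatM; first exact: holat_cst.
  exact: (open_wirt oU h1).
split => // z Uz; first by apply: holatM; [exact: holat_cst|exact: h1].
exact: (open_wirt oU h2).
Qed.

Lemma gramE m r (A : 'M[R[i]]_(m, r)) i j : (A^t* *m A) i j = \sum_k A k j * (A k i)^*.
Proof. by rewrite mxE; apply: eq_bigr => k _; rewrite !mxE mulrC. Qed.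

Lemma gram_sesq m r (A : R[i] -> 'M[R[i]]_(m, r)) i j w : ((A w)^t* *m A w) i j =
  sesq [seq ((fun w => A w k j), (fun w => A w k i)) | k <- index_enum 'I_m] w.
Proof. by rewrite gramE /sesq big_map. Qed.

Lemma gram_sesq_hol m r (A : R[i] -> 'M[R[i]]_(m, r)) i j (U : set R[i]^o) :
  (forall z, U z -> forall k l, holat (fun w => A w k l) z) ->
  sesq_hol U [seq ((fun w => A w k j), (fun w => A w k i)) | k <- index_enum 'I_m].
Proof. by move=> H; elim: (index_enum _) => //= k s IH; split => // z /H. Qed.

Lemma gram_smooth m r (A : R[i] -> 'M[R[i]]_(m, r)) i j z :
  (forall k l, hol1 (fun w => A w k l) z) ->
  smooth_at (fun w => ((A w)^t* *m A w) i j) z.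
Proof.
move=> Ah; have : \forall w \near (z : R[i]^o), forall p : 'I_m * 'I_r, holat (fun w => A w p.1 p.2) w.
  by apply: near_all => p; apply/hol1_nearE; exact: Ah.
move=> /near_nm [d d0 dP]; exists [set w | nm (w - z) < d]; split.
- exact: open_disc.
- by rewrite /= subrr nm0.
move=> k; apply: (@Ck_ext _ _ (sesq [seq ((fun w => A w k j), (fun w => A w k i)) | k <- index_enum 'I_m])).
- exact: open_disc.
- by move=> w _; rewrite gram_sesq.
apply: sesq_Ck; first exact: open_disc.
by apply: gram_sesq_hol => w /dP H k' l; exact: (H (k', l)).
Qed.

Lemma hol1_det z r (A : R[i] -> 'M[R[i]]_r) : (forall k l, hol1 (fun w => A w k l) z) ->
  hol1 (fun w => \det (A w)) z.
Proof.
exact: (@closed_det (R[i] : comUnitRingType) R[i] (fun f => hol1 f z) (fun c => hol1_cst c z)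
  (fun f g p q => hol1D p q) (fun f g p q => hol1M p q) r A).
Qed.

Lemma hol1_mulmx z m n p (A : R[i] -> 'M[R[i]]_(m, n)) (B : R[i] -> 'M[R[i]]_(n, p)) :
  (forall k l, hol1 (fun w => A w k l) z) -> (forall k l, hol1 (fun w => B w k l) z) ->
  forall k l, hol1 (fun w => (A w *m B w) k l) z.
Proof.
exact: (@closed_mulmx (R[i] : comUnitRingType) R[i] (fun f => hol1 f z) (fun c => hol1_cst c z)
  (fun f g p q => hol1D p q) (fun f g p q => hol1M p q) m n p A B).
Qed.

(** The operator [d'] kills the conjugated factor, so [H^-1 (d' H) = A^-1 (d' A)]; this is
    holomorphic and is therefore killed by [d'']. *)
Lemma gram_flat r (A H : R[i] -> 'M[R[i]]_r) z :
  (forall k l, hol1 (fun w => A w k l) z) -> A z \in unitmx ->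
  (\forall w \near (z : R[i]^o), H w = (A w)^t* *m A w) -> chern_curv H z = 0.
Proof.
move=> Ah uA HE.
have dh := hol1_det Ah.
have nA : \forall w \near (z : R[i]^o), A w \in unitmx.
  have d0 : \det (A z) != 0 by rewrite -unitfE -unitmxE.
  by apply: nearS (cts_neq0 (holat_cts (hol1_holat dh)) d0) => w; rewrite unitmxE unitfE.
have nh : \forall w \near (z : R[i]^o), forall p : 'I_r * 'I_r, holat (fun w => A w p.1 p.2) w.
  by apply: near_all => p; apply/hol1_nearE; exact: Ah.
pose A' w : 'M[R[i]]_r := \matrix_(k, l) wirt (fun w => A w k l) w.
(* The cofactor formula has visibly holomorphic entries and agrees with [invmx] where [A] is
   invertible. *)
pose Ai w : 'M[R[i]]_r := (\det (A w))^-1 *: \adj (A w).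
have wE : \forall w \near (z : R[i]^o),
    invmx (H w) *m \matrix_(k', l') wirt (fun w' => H w' k' l') w = Ai w *m A' w.
  apply: nearS (nearI nA (nearI (nearJ HE) (nearJ nh))) => w [uw [HEw /near_nm [d d0 hw]]].
  have hw0 : forall k l, holat (fun w => A w k l) w.
    by move=> k l; apply: (hw w _ (k, l)); rewrite subrr nm0.
  have -> : \matrix_(k', l') wirt (fun w' => H w' k' l') w = (A w)^t* *m A' w.
    apply/matrixP => k l; rewrite mxE [RHS]mxE.
    have shU : sesq_hol [set v | nm (v - w) < d]
       [seq ((fun w => A w k0 l), (fun w => A w k0 k)) | k0 <- index_enum 'I_r].
      by apply: gram_sesq_hol => v /hw K k' l'; exact: (K (k', l')).
    have Uw : [set v | nm (v - w) < d] w by rewrite /= subrr nm0.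
    have F := fr_sesq shU Uw.
    have EF : \forall v \near (w : R[i]^o), sesq [seq ((fun w => A w k0 l), (fun w => A w k0 k)) | k0 <- index_enum 'I_r] v = H v k l.
      by apply: nearS HEw => v ->; rewrite gram_sesq.
    have [-> _] := fr_wirt (fr_ext EF F).
    by rewrite /sesq !big_map; apply: eq_bigr => k' _ /=; rewrite !mxE mulrC.
  rewrite (ex_near HEw).
  have uAt : (A w)^t* \in unitmx by rewrite map_unitmx unitmx_tr.
  rewrite /Ai -[(\det _)^-1 *: _]/((\det (A w))^-1 *: \adj (A w)).
  have <- : invmx (A w) = (\det (A w))^-1 *: \adj (A w) by rewrite /invmx uw.
  by rewrite invmxM // -mulmxA mulKmx.
have h1 : forall k l, hol1 (fun w => (Ai w *m A' w) k l) z.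
  apply: hol1_mulmx.
    move=> k l; under eq_fun do rewrite !mxE.
    apply: hol1M; first by apply: hol1V => //; rewrite -unitfE -unitmxE.
    apply: hol1M; first exact: hol1_cst.
    by apply: hol1_det => i j; under eq_fun do rewrite !mxE; exact: Ah.
  by move=> k l; under eq_fun do rewrite !mxE; apply: hol1_wirt; exact: Ah.
apply/matrixP => k l; rewrite mxE [RHS]mxE.
have EF : \forall w \near (z : R[i]^o), (Ai w *m A' w) k l =
   (invmx (H w) *m \matrix_(k', l') wirt (fun w' => H w' k' l') w) k l.
  by apply: nearS wE => w ->.
by have [_ ->] := fr_wirt (fr_ext EF (holat_wirt (hol1_holat (h1 k l)))).
Qed.

End Gram.

(** * Ratios of metrics with the same curvature *)

Section HarmonicRatio.
Variable R : realType.
Implicit Types (f g h F d : R[i] -> R[i]) (z w a : R[i]).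

Lemma conj_pos (x : R[i]) : 0 < x -> x^* = x.
Proof. by move=> x0; apply/CrealP; rewrite gtr0_real. Qed.

(** The hypothesis says that [d' (log d)] has the holomorphic coefficient [phi]. If [G] is the
    exponential of a primitive of [phi], the quotient of [d] by [|G|^2] has vanishing derivatives,
    so it is a positive constant, and its square root turns [G] into [f]. *)
Lemma hol_abs_sq d phi z0 :
  (\forall z \near (z0 : R[i]^o), 0 < d z /\ fr d z (d z * phi z) (d z * phi z)^*) ->
  hol1 phi z0 ->
  exists f, hol1 f z0 /\ \forall z \near (z0 : R[i]^o), f z != 0 /\ d z = f z * (f z)^*.
Proof.
move=> dP ph; have [F FP] := hol1_prim ph.
have [E [c EP]] := hol1_exp R.
(* The primitive is shifted to take at [z0] the value [c], near which [E] is known. *)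
pose t z := F z + (c - F z0).
have tP : \forall z \near (z0 : R[i]^o), fr t z (phi z) 0.
  apply: nearS FP => z h; have := fr_add h (fr_cst (c - F z0) z); by rewrite !addr0.
have tz0 : t z0 = c by rewrite /t addrC subrK.
have tc : cts t z0 := fr_cts (ex_near tP).
have EtP : \forall z \near (z0 : R[i]^o), fr E (t z) (E (t z)) 0 /\ E (t z) != 0.
  by apply: (near_fun (P := fun a => fr E a (E a) 0 /\ E a != 0) tc); rewrite tz0.
pose G z := E (t z).
have GP : \forall z \near (z0 : R[i]^o), fr G z (G z * phi z) 0 /\ G z != 0.
  by apply: nearS (nearI tP EtP) => z [h1 [h2 h3]]; split => //; exact: fr_holcomp h1 h2.
pose u z := d z * ((G z)^-1 * ((G z)^-1)^*).
have uP : \forall z \near (z0 : R[i]^o), fr u z 0 0.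
  apply: nearS (nearI dP GP) => z [[d0 h1] [h2 G0]].
  have h3 := fr_holcomp h2 (fr_inv G0).
  have h4 := fr_mul h1 (fr_mul h3 (fr_conj h3)).
  have dJ := conj_pos d0.
  have gi : ((G z)^-1)^* = ((G z)^*)^-1 by rewrite fmorphV.
  have gi2 : ((G z) ^- 2)^* = (G z)^* ^- 2 by rewrite fmorphV rmorphXn.
  apply: (fr_eq h4); rewrite /= ?cjE ?gi ?gi2 ?dJ.
    by field; rewrite ?conjC_eq0 G0.
  by field; rewrite ?conjC_eq0 G0.
have [r r0 rP] := (near_nm _ _).1 uP.
have uE z : nm (z - z0) < r -> u z = u z0.
  move=> zr; have := @rd0_cst _ (fun t => u (z0 + t%:C * (z - z0))) 0 1 ler01.
  rewrite mul0r addr0 rmorph1 mul1r subrKC => <- // s /andP[s0 s1].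
  have sr : nm (z0 + s%:C * (z - z0) - z0) < r.
    rewrite addrAC subrr add0r nmM nm_real ger0_norm //; apply: le_lt_trans zr.
    by rewrite ler_piMl ?nm_ge0.
  by have := fr_rd (rP _ sr); rewrite !mul0r addr0.
have [d0 _] := ex_near dP; have [_ G0] := ex_near GP.
have mJ (x : R[i]) : x != 0 -> 0 < x * x^*.
  by move=> x0; rewrite mulrC mulJE ltcR exprn_gt0 // nm_gt0.
have u0 : 0 < u z0 by rewrite /u mulr_gt0 // mJ // invr_eq0.
pose q := sqrtc (u z0).
have q0 : 0 < q by rewrite lt_neqAle eq_sym sqrtc_eq0 gt_eqF //= sqrtc_ge0 ltW.
have qq : q * q = u z0 by rewrite -expr2 sqr_sqrtc.
exists (fun z => q * G z); split.
  apply: hol1M; first exact: hol1_cst.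
  by apply/hol1_nearE; apply: nearS GP => z [h _]; exists (G z * phi z).
have ur : \forall z \near (z0 : R[i]^o), u z = u z0 by apply/near_nm; exists r.
apply: nearS (nearI ur GP) => z [uz [_ Gz]]; split.
  by rewrite mulf_neq0 // gt_eqF.
rewrite cjM (conj_pos q0) mulrACA qq -uz /u fmorphV.
by field; rewrite conjC_eq0 Gz.
Qed.

Lemma smooth_fr d z0 : smooth_at d z0 -> \forall z \near (z0 : R[i]^o),
  fr d z (wirt d z) (wirtbar d z) /\
  fr (wirt d) z (wirt (wirt d) z) (wirtbar (wirt d) z).
Proof.
case=> U [oU Uz0 dU]; have [r r0 rU] := open_nm oU Uz0.
apply/near_nm; exists r => // z /rU Uz.
have C1 g : Ck 1 U g -> fr g z (wirt g z) (wirtbar g z).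
  move=> gC; apply: (C1_fr oU Uz) => v vi; have [h1 h2] := gC v vi; split => // w Uw.
  exact/ctsP/h2.
split; first exact: C1 (dU 1%N).
have h1 := C1 _ ((dU 2%N) 1 (mem_head _ _)).2.
have i_in : 'i \in [:: 1; 'i : R[i]] by rewrite !inE eqxx orbT.
have h2 := C1 _ ((dU 2%N) 'i i_in).2.
have := fr_mul (fr_add h1 (fr_opp (fr_mul (fr_cst 'i z) h2))) (fr_cst 2^-1 z).
by move=> /[dup] /fr_wirt [<- <-].
Qed.

Lemma real_fr d z0 : (\forall z \near (z0 : R[i]^o), 0 < d z) ->
  forall a b, fr d z0 a b -> b = a^*.
Proof.
move=> dpos a b H.
have E : \forall z \near (z0 : R[i]^o), (d z)^* = d z by apply: nearS dpos => z /conj_pos.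
have [_ ->] := fr_uniq H (fr_ext E (fr_conj H)).
by [].
Qed.

(** Here [phi] is the logarithmic [d']-derivative of [d1] over the pullback of [d2] by [tau].
    Equality of the curvatures, with the Jacobian factor of [tau], says that [d''] of [phi]
    vanishes, so [hol_abs_sq] applies to the ratio. *)
Lemma flat_ratio d1 d2 tau z0 : smooth_at d1 z0 -> smooth_at d2 (tau z0) -> hol1 tau z0 ->
  (\forall z \near (z0 : R[i]^o), 0 < d1 z) ->
  (\forall z \near (tau z0 : R[i]^o), 0 < d2 z) ->
  (\forall z \near (z0 : R[i]^o),
     wirtbar (fun w => (d1 w)^-1 * wirt d1 w) z =
     wirtbar (fun w => (d2 w)^-1 * wirt d2 w) (tau z) * `|wirt tau z| ^+ 2) ->
  exists f, hol1 f z0 /\ \forall z \near (z0 : R[i]^o),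
    f z != 0 /\ d1 z / d2 (tau z) = f z * (f z)^*.
Proof.
move=> s1 s2 th p1 p2 curv.
have tc := holat_cts (hol1_holat th).
have S1 := smooth_fr s1.
have S2 := near_fun tc (nearI (smooth_fr s2) (nearJ p2)).
have T1 : \forall z \near (z0 : R[i]^o), hol1 tau z := hol1_near th.
pose phi1 w := (d1 w)^-1 * wirt d1 w; pose phi2 w := (d2 w)^-1 * wirt d2 w.
pose phi w := phi1 w - phi2 (tau w) * wirt tau w.
have logder d z : 0 < d z -> fr d z (wirt d z) (wirtbar d z) ->
    fr (wirt d) z (wirt (wirt d) z) (wirtbar (wirt d) z) ->
    fr (fun w => (d w)^-1 * wirt d w) z (wirt (fun w => (d w)^-1 * wirt d w) z)
       (wirtbar (fun w => (d w)^-1 * wirt d w) z).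
  move=> dz h1 h2; have dz0 : d z != 0 by rewrite gt_eqF.
  have := fr_mul (fr_comp h1 (fr_inv dz0)) h2.
  by move=> /[dup] /fr_wirt [<- <-].
have phih : \forall z \near (z0 : R[i]^o), holat phi z.
  apply: nearS (nearI (nearI S1 S2) (nearI (nearI T1 curv) p1)) => z.
  move=> [[[h1 h2] [[h3 h4] /ex_near y0]] [[Th E] x0]].
  have g1 := logder _ _ x0 h1 h2; have g2 := logder _ _ y0 h3 h4.
  have T0 := holat_wirt (hol1_holat Th); have T2 := holat_wirt (hol1_holat (hol1_wirt Th)).
  have := fr_add g1 (fr_opp (fr_mul (fr_comp T0 g2) T2)).
  move=> H; eexists; apply: (fr_eq H); first by reflexivity.
  by rewrite E normCK; ring.
apply: (@hol_abs_sq (fun z => d1 z * (d2 (tau z))^-1) phi z0); last exact/hol1_nearE.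
apply: nearS (nearI (nearI S1 S2) (nearI T1 (nearI p1 (nearJ p1)))) => z.
move=> [[[h1 h2] [[h3 h4] np2]] [Th [x0 np1]]].
have y0 := ex_near np2.
have T0 := holat_wirt (hol1_holat Th).
have yn0 : d2 (tau z) != 0 by rewrite gt_eqF.
have xn0 : d1 z != 0 by rewrite gt_eqF.
split; first by rewrite divr_gt0.
have k1 := real_fr np1 h1; have k2 := real_fr np2 h3.
have xJ := conj_pos x0; have yJ := conj_pos y0.
have := fr_mul h1 (fr_comp (fr_comp T0 h3) (fr_inv yn0)).
have gi1 : ((d1 z)^-1)^* = (d1 z)^-1 by rewrite conj_pos // invr_gt0.
have gi2 : ((d2 (tau z))^-1)^* = (d2 (tau z))^-1 by rewrite conj_pos // invr_gt0.
move=> H; apply: (fr_eq H); rewrite ?k1 ?k2 /phi /phi1 /phi2 /= ?cjE ?gi1 ?gi2 ?xJ ?yJ;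
  move: xn0 yn0; move: (d1 z) (d2 (tau z)) => x y xn0 yn0.
  move: (wirt d1 z) (wirt d2 (tau z)) (wirt tau z) => a b c.
  by field; rewrite xn0 yn0.
move: (wirt d1 z)^* (wirt d2 (tau z))^* (wirt tau z)^* => a b c.
by field; rewrite xn0 yn0.
Qed.

End HarmonicRatio.

Opaque hol1.

Lemma germ_at (R : realType) (X : topologicalType) (A : Type) (phi : X -> R[i])
  (x : X) (f : X -> A) (g : R[i] -> A) : germ_eq phi x f g -> f x = g (phi x).
Proof. by move=> H; exact: (nbhs_singleton (H : nbhs x _)). Qed.

(** * Holomorphic functions and maps on surfaces *)

Section LocalCoordinates.
Variables (R : realType) (X : surface R).
Implicit Types (c : chart X) (x y : X) (f : X -> R[i]).

Lemma near_coord c x (P : R[i] -> Prop) : dom c x ->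
  (\forall z \near (coord c x : R[i]^o), P z) -> \forall y \near x, P (coord c y).
Proof. by move=> cx; exact: (coord_cont cx). Qed.

Lemma near_dom c x : dom c x -> \forall y \near x, dom c y.
Proof. by move=> cx; apply: open_nbhs_nbhs; split => //; exact: dom_open. Qed.

(* A right inverse of [coord c], with junk value [x]. *)
Definition icoord c x (z : R[i]) : X :=
  if pselect (exists2 y, dom c y & coord c y = z) is left h then projT1 (cid2 h) else x.

Lemma icoordK c x y : dom c y -> icoord c x (coord c y) = y.
Proof.
move=> cy; rewrite /icoord; case: pselect => [h|[]]; last by exists y.
by case: cid2 => u /= cu; exact: coord_inj.
Qed.

Lemma near_icoord c x (P : X -> Prop) : dom c x -> (\forall y \near x, P y) ->
  \forall z \near (coord c x : R[i]^o),
    [/\ dom c (icoord c x z), coord c (icoord c x z) = z & P (icoord c x z)].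
Proof.
move=> cx HP; have : nbhs x P by exact: HP.
rewrite nbhsE => -[W [oO Ox] OP].
have oU : open (W `&` dom c) by apply: openI => //; exact: dom_open.
have oV := coord_open oU (fun y (p : (W `&` dom c) y) => proj2 p).
have : nbhs (coord c x : R[i]^o) (coord c @` (W `&` dom c)).
  by apply: open_nbhs_nbhs; split => //; exists x.
move=> /near_nm [d d0 dP]; apply/near_nm; exists d => // z /dP [y [Oy cy] <-].
by rewrite icoordK //; split => //; exact: OP.
Qed.

(** One chart suffices, as [hol_atE] passes to any other by the holomorphic change of coordinates.
    Working with germs at a point suits local sections and square roots, which exist only locally;
    [hol_onP] gives the link with open sets. *)
Definition hol_at x f := exists c g, [/\ dom c x, hol1 g (coord c x) & germ_eq (coord c) x f g].

Lemma hol_atE c x f : dom c x -> hol_at x f ->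
  exists2 g, hol1 g (coord c x) & germ_eq (coord c) x f g.
Proof.
move=> cx [c' [g [c'x gh fg]]].
have [t th tE] := coord_hol cx c'x; exists (g \o t).
  by apply: (hol1_comp th); rewrite -(germ_at tE).
by apply: filterS2 fg tE => y -> ->.
Qed.

Lemma hol_at_icoord c x f : dom c x -> hol_at x f <-> hol1 (f \o icoord c x) (coord c x).
Proof.
move=> cx; split=> [/(hol_atE cx) [g gh fg]|H].
  apply: hol1_ext gh; apply: nearS (near_icoord cx fg) => z [_ e1 e2] /=.
  by rewrite e2 e1.
exists c, (f \o icoord c x); split => //.
by apply: filterS (near_dom cx) => y cy /=; rewrite icoordK.
Qed.

Lemma hol_onP (U : set X) f : hol_on U f <-> forall x, U x -> hol_at x f.
Proof.
split=> [H x Ux|H c x Ux cx]; last exact: hol_atE (H x Ux).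
have [c cx] := dom_cover x; have [g gh fg] := H c x Ux cx.
by exists c, g.
Qed.

Lemma hol_at_ext x f g : (\forall y \near x, f y = g y) -> hol_at x f -> hol_at x g.
Proof.
move=> E [c [h [cx hh fh]]]; exists c, h; split => //.
by apply: filterS2 E fh => y <-.
Qed.

Lemma hol_at_cst (k : R[i]) x : hol_at x (fun=> k).
Proof.
have [c cx] := dom_cover x; exists c, (fun=> k); split => //; first exact: hol1_cst.
by apply: filterE.
Qed.

Lemma hol_at_coord c x : dom c x -> hol_at x (coord c).
Proof.
move=> cx; exists c, id; split => //; first exact: hol1_id.
by apply: filterE.
Qed.

Lemma hol_atD x f g : hol_at x f -> hol_at x g -> hol_at x (fun y => f y + g y).
Proof.
have [c cx] := dom_cover x; move=> /(hol_at_icoord _ cx) F /(hol_at_icoord _ cx) G.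
by apply/(hol_at_icoord _ cx); exact: hol1D F G.
Qed.

Lemma hol_atM x f g : hol_at x f -> hol_at x g -> hol_at x (fun y => f y * g y).
Proof.
have [c cx] := dom_cover x; move=> /(hol_at_icoord _ cx) F /(hol_at_icoord _ cx) G.
by apply/(hol_at_icoord _ cx); exact: hol1M F G.
Qed.

Lemma hol_atN x f : hol_at x f -> hol_at x (fun y => - f y).
Proof.
have [c cx] := dom_cover x; move=> /(hol_at_icoord _ cx) F.
by apply/(hol_at_icoord _ cx); exact: hol1N F.
Qed.

Lemma hol_at_comp x f (g : R[i] -> R[i]) : hol_at x f -> hol1 g (f x) -> hol_at x (g \o f).
Proof.
have [c cx] := dom_cover x; move=> /(hol_at_icoord _ cx) F G.
apply/(hol_at_icoord _ cx); apply: (hol1_comp (f := g) F).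
by rewrite /= icoordK.
Qed.

Lemma hol_atV x f : hol_at x f -> f x != 0 -> hol_at x (fun y => (f y)^-1).
Proof.
move=> F f0; apply: (hol_at_comp (g := fun w => w^-1) F).
by apply: hol1V => //; exact: hol1_id.
Qed.

Lemma hol_at_near x f (P : R[i] -> Prop) : hol_at x f ->
  (\forall z \near (f x : R[i]^o), P z) -> \forall y \near x, P (f y).
Proof.
move=> [c [g [cx gh fg]]] H.
have H2 : \forall z \near (coord c x : R[i]^o), P (g z).
  by apply: near_fun; [exact: holat_cts (hol1_holat gh)|rewrite -(germ_at fg)].
by apply: filterS2 (near_coord cx H2) fg => y ? ->.
Qed.

Lemma hol_at_neq0 x f : hol_at x f -> f x != 0 -> \forall y \near x, f y != 0.
Proof.
move=> F f0; apply: (hol_at_near (P := fun w => w != 0) F).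
by apply: (@cts_neq0 _ id) => //; exact/holat_cts/holat_id.
Qed.

Lemma hol_at_sqrt x f : hol_at x f -> f x != 0 ->
  exists q, hol_at x q /\ \forall y \near x, q y * q y = f y.
Proof.
move=> F f0; have [s [sh sE]] := hol1_sqrt f0.
exists (s \o f); split; first exact: hol_at_comp.
by apply: filterS (hol_at_near F sE) => y; rewrite expr2.
Qed.

Definition hol_mx x m n (A : X -> 'M[R[i]]_(m, n)) := closedmx (hol_at x) A.

Lemma hol_mxM x m n p (A : X -> 'M[R[i]]_(m, n)) (B : X -> 'M[R[i]]_(n, p)) :
  hol_mx x A -> hol_mx x B -> hol_mx x (fun y => A y *m B y).
Proof.
by apply: closed_mulmx; [move=> k; exact: hol_at_cst|exact: hol_atD|exact: hol_atM].
Qed.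

Lemma hol_at_det x n (A : X -> 'M[R[i]]_n) : hol_mx x A -> hol_at x (fun y => \det (A y)).
Proof.
by apply: closed_det; [move=> k; exact: hol_at_cst|exact: hol_atD|exact: hol_atM].
Qed.

Lemma hol_mx_ext x m n (A B : X -> 'M[R[i]]_(m, n)) : (\forall y \near x, A y = B y) ->
  hol_mx x A -> hol_mx x B.
Proof. by move=> E H i j; apply: hol_at_ext (H i j); apply: filterS E => y ->. Qed.

Lemma hol_mxT x m n (A : X -> 'M[R[i]]_(m, n)) : hol_mx x A -> hol_mx x (fun y => (A y)^T).
Proof. by move=> H i j; under eq_fun do rewrite mxE; exact: H. Qed.

Lemma hol_mxZ x m n f (A : X -> 'M[R[i]]_(m, n)) : hol_at x f -> hol_mx x A ->
  hol_mx x (fun y => f y *: A y).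
Proof. by move=> F H i j; under eq_fun do rewrite mxE; exact: hol_atM. Qed.

Lemma hol_mx_unit x n (A : X -> 'M[R[i]]_n) : hol_mx x A -> A x \in unitmx ->
  \forall y \near x, A y \in unitmx.
Proof.
move=> H; rewrite unitmxE unitfE => d0.
by apply: filterS (hol_at_neq0 (hol_at_det H) d0) => y; rewrite unitmxE unitfE.
Qed.

Lemma hol_mxV x n (A : X -> 'M[R[i]]_n) : hol_mx x A -> A x \in unitmx ->
  hol_mx x (fun y => invmx (A y)).
Proof.
move=> H uA; have nu := hol_mx_unit H uA.
apply: (@hol_mx_ext x _ _ (fun y => (\det (A y))^-1 *: \adj (A y))).
  by apply: filterS nu => y uy; rewrite /invmx uy.
apply: hol_mxZ; first by apply: hol_atV; [exact: hol_at_det|rewrite -unitfE -unitmxE].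
move=> i j; under eq_fun do rewrite !mxE.
apply: hol_atM; first exact: hol_at_cst.
by apply: hol_at_det => k l; under eq_fun do rewrite !mxE; exact: H.
Qed.

End LocalCoordinates.

(** * Germs of holomorphic maps and their local inverses *)

Section Maps.
Variable R : realType.
Implicit Types (X Y Z : surface R).

(** A holomorphic germ at [x]: the map may take junk values far from [x], so continuity is stated at
    this point only, by pulling back neighbourhoods. *)
Definition hmap X Y (x : X) (s : X -> Y) :=
  (forall P : Y -> Prop, (\forall y \near s x, P y) -> \forall u \near x, P (s u)) /\
  forall c : chart Y, dom c (s x) -> hol_at x (fun u => coord c (s u)).

Lemma hol_map_hmap X Y (s : X -> Y) x : hol_map s -> hmap x s.
Proof.
case=> sc sh; split=> [P H|c cx]; first exact: sc.
have /hol_onP := sh c; exact.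
Qed.

Lemma hmap_hol X Y (x : X) (s : X -> Y) (f : Y -> R[i]) :
  hmap x s -> hol_at (s x) f -> hol_at x (f \o s).
Proof.
case=> sc sh [c [g [cx gh fg]]].
apply: (@hol_at_ext _ _ x (g \o (fun u => coord c (s u)))).
  by apply: filterS (sc _ fg) => u /= ->.
by apply: hol_at_comp; [exact: sh|].
Qed.

Lemma hmap_hol_mx X Y (x : X) (s : X -> Y) m n (A : Y -> 'M[R[i]]_(m, n)) :
  hmap x s -> hol_mx (s x) A -> hol_mx x (A \o s).
Proof. by move=> H HA i j; exact: (hmap_hol H (HA i j)). Qed.

Lemma hmap_comp X Y Z (x : X) (s : X -> Y) (t : Y -> Z) :
  hmap x s -> hmap (s x) t -> hmap x (t \o s).
Proof.
move=> [sc sh] [tc th]; split=> [P /tc /sc //|c cx].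
exact: (@hmap_hol X Y x s (fun u => coord c (t u)) (conj sc sh) (th c cx)).
Qed.

(** In charts this is [hol_local_inverse]. Local injectivity is the form in which the information is
    available for [p2]; for [pi] it comes from the derivative. *)
Lemma hmap_local_inverse X Y (f : Y -> X) (y : Y) : hmap y f ->
  (exists2 N : set Y, nbhs y N & forall u v, N u -> N v -> f u = f v -> u = v) ->
  exists s : X -> Y, [/\ hmap (f y) s, s (f y) = y & \forall x \near f y, f (s x) = x].
Proof.
move=> [fc fh] [N Ny Ninj].
have [e ey] := dom_cover y; have [c cfy] := dom_cover (f y).
have fcn : \forall v \near y, dom c (f v) by apply: fc; exact: near_dom.
pose F := (fun v => coord c (f v)) \o icoord e y.
have Fh : hol1 F (coord e y) by apply/(hol_at_icoord _ ey); exact: fh.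
have FE : F (coord e y) = coord c (f y) by rewrite /F /= icoordK.
have /near_nm [r r0 rP] : \forall z \near (coord e y : R[i]^o), [/\ dom e (icoord e y z),
    coord e (icoord e y z) = z & N (icoord e y z) /\ dom c (f (icoord e y z))].
  by apply: (near_icoord (P := fun v => N v /\ dom c (f v)) ey); exact: filterI.
have [g [gh gF Fg]] : exists g, [/\ hol1 g (F (coord e y)),
    \forall w \near (coord e y : R[i]^o), g (F w) = w
    & \forall a \near (F (coord e y) : R[i]^o), F (g a) = a].
  apply: (hol_local_inverse Fh r0) => v w /rP [v1 v2 [v3 v4]] /rP [w1 w2 [w3 w4]] E.
  rewrite -v2 -w2; congr (coord e _); apply: Ninj => //.
  exact: coord_inj E.
have gE : g (coord c (f y)) = coord e y by rewrite -FE; exact: (ex_near gF).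
rewrite FE in gh Fg.
have gc := holat_cts (hol1_holat gh).
exists (fun x => icoord e y (g (coord c x))); split.
- split=> [P|e' e'y].
    rewrite gE icoordK // => HP; have HPi := near_icoord ey HP.
    have := near_coord cfy (near_fun (P := fun z => [/\ dom e (icoord e y z),
       coord e (icoord e y z) = z & P (icoord e y z)]) gc _).
    by rewrite gE => /(_ HPi); apply: filterS => x [].
  rewrite gE icoordK // in e'y.
  have H : hol1 (coord e' \o icoord e y) (coord e y).
    by apply/(hol_at_icoord _ ey); exact: hol_at_coord.
  apply: (hol_at_comp (f := fun x => g (coord c x)) (g := coord e' \o icoord e y)).
    by apply: hol_at_comp => //; exact: hol_at_coord.
  by rewrite gE.
- by rewrite gE icoordK.
have H1 := near_coord cfy Fg.
have H2 : \forall x \near f y, nm (g (coord c x) - coord e y) < r.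
  apply: (near_coord cfy (P := fun z => nm (g z - coord e y) < r)).
  by have [d d0 dP] := gc r r0; apply/near_nm; exists d => // w /dP; rewrite gE.
near=> x.
have Fx : F (g (coord c x)) = coord c x by near: x.
have [h1 h2 [h3 h4]] : [/\ dom e (icoord e y (g (coord c x))),
    coord e (icoord e y (g (coord c x))) = g (coord c x)
    & N (icoord e y (g (coord c x))) /\ dom c (f (icoord e y (g (coord c x))))].
  by apply: rP; near: x.
by apply: (coord_inj h4 _ Fx); near: x; exact: near_dom.
Unshelve. all: by end_near. Qed.

End Maps.

(** * Derivatives with respect to charts *)

Section CoordinateDerivative.
Variable R : realType.
Implicit Types (X Y : surface R).

Lemma near_dnbhs_coord X (c : chart X) (x : X) (P : X -> Prop) : dom c x ->
  (\forall y \near x, coord c y != coord c x -> P y) -> \forall y \near x^', P y.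
Proof.
move=> cx H; rewrite /dnbhs; apply: filterS2 (near_dom cx) H => y cy Py yx.
by apply: Py; apply: contra_neq yx => /coord_inj; exact.
Qed.

(** A chart is open onto its image, so no point is isolated; this makes limits over punctured
    neighbourhoods unique. *)
Lemma dnbhs_proper X (x : X) : ProperFilter x^'.
Proof.
split; last exact: dnbhs_filter.
move=> H; have [c cx] := dom_cover x.
have {}H : \forall y \near x, y = x.
  have K : nbhs x (fun y => y != x -> set0 y) := H.
  by apply: filterS K => y Hy; apply: contrapT => /eqP /Hy.
have /near_nm [d d0 dP] := near_icoord cx H.
have [|_ h1 h2] := dP (coord c x + (d / 2)%:C) _.
  by rewrite addrAC subrr add0r nm_real gtr0_norm ?divr_gt0 //; lra.
move: h1; rewrite h2 -[LHS]addr0 => /addrI /esym /eqP.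
by rewrite -nm_eq0 nm_real gtr0_norm ?divr_gt0 // gt_eqF // divr_gt0.
Qed.

Lemma dcoordE X (c : chart X) (x : X) f (g : R[i] -> R[i]) : dom c x ->
  germ_eq (coord c) x f g -> holat g (coord c x) -> dcoord c f x = wirt g (coord c x).
Proof.
move=> cx fg gh; rewrite /dcoord.
have PF := dnbhs_proper x.
pose q y : R[i]^o := (f y - f x) / (coord c y - coord c x).
suff L : q y @[y --> x^'] --> (wirt g (coord c x) : R[i]^o).
  exact: (cvg_lim (@norm_hausdorff _ (R[i]^o)) L).
apply: (iffRL (cvgrPdist_le (F := x^') q _)).
move=> e e0.
have e0' : 0 < complex.Re e by move: e0; rewrite ltcE => /andP[_].
have eE : e = (complex.Re e)%:C by rewrite RRe_real // gtr0_real.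
have [d d0 dP] := holat_wirt gh e0'.
apply: (near_dnbhs_coord cx).
have H : \forall y \near x, nm (coord c y - coord c x) < d.
  by apply: (near_coord cx (P := fun z => nm (z - coord c x) < d)); apply/near_nm; exists d.
have fx := germ_at fg.
apply: filterS2 fg H => y fy /dP; rewrite subrKC mul0r addr0 => K yx.
rewrite eE nmE lecR nm_distC /q fy fx.
have n0 : coord c y - coord c x != 0 by rewrite subr_eq0.
have -> : (g (coord c y) - g (coord c x)) / (coord c y - coord c x) - wirt g (coord c x) =
  (g (coord c y) - g (coord c x) - wirt g (coord c x) * (coord c y - coord c x)) / (coord c y - coord c x).
  by field.
by rewrite nmM nmV ler_pdivrMr ?nm_gt0.
Qed.

Lemma dcoord_chain X Y (p : Y -> X) (e : chart Y) (c : chart X) (y : Y) (f : X -> R[i]) :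
  dom e y -> dom c (p y) -> hmap y p -> hol_at (p y) f ->
  dcoord e (fun v => f (p v)) y = dcoord c f (p y) * dcoord e (fun v => coord c (p v)) y.
Proof.
move=> ey cy hp fh; have [g gh fg] := hol_atE cy fh.
have [_ /(_ c cy) ph] := hp; have [q qh pq] := hol_atE ey ph.
rewrite (dcoordE cy fg (hol1_holat gh)) (dcoordE ey pq (hol1_holat qh)).
have qy := germ_at pq.
have gq : hol1 g (q (coord e y)) by rewrite -qy.
have E : germ_eq (coord e) y (fun v => f (p v)) (g \o q).
  by apply: filterS2 (hp.1 _ fg) pq => v -> /= ->.
rewrite (dcoordE ey E); last by apply: holat_comp; [exact: hol1_holat qh|exact: hol1_holat gq].
rewrite qy.
by have [-> _] := fr_wirt (fr_holcomp (holat_wirt (hol1_holat qh)) (holat_wirt (hol1_holat gq))).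
Qed.

Lemma hmap_id X (x : X) : hmap x id.
Proof. by split=> // c; exact: hol_at_coord. Qed.

Lemma dcoord_self X (c : chart X) (x : X) : dom c x -> dcoord c (coord c) x = 1.
Proof.
move=> cx; rewrite (@dcoordE _ _ _ _ id) //; first by rewrite wirt_id.
  by apply: filterE.
exact: holat_id.
Qed.

Lemma dcoord_neq0 X (c c' : chart X) (x : X) : dom c x -> dom c' x ->
  dcoord c (coord c') x != 0.
Proof.
move=> cx c'x; have := @dcoord_chain X X id c c' x (coord c) cx c'x (hmap_id x) (hol_at_coord cx).
rewrite dcoord_self // => E; apply/eqP => E0; move: E; rewrite E0 mulr0 => /eqP.
by rewrite oner_eq0.
Qed.

Lemma hol_at_dcoord X (c : chart X) (x : X) f : dom c x -> hol_at x f ->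
  hol_at x (dcoord c f).
Proof.
move=> cx fh; have [g gh fg] := hol_atE cx fh.
exists c, (wirt g); split; [exact: cx|exact: hol1_wirt|].
have J : \forall y \near x, germ_eq (coord c) y f g by apply: near_join.
apply: filterS3 (near_dom cx) J (near_coord cx (hol1_near gh)) => y cy Jy Hy.
exact: dcoordE cy Jy (hol1_holat Hy).
Qed.

Lemma dcoord_local_inj X Y (p : Y -> X) (e : chart Y) (c : chart X) (y : Y) :
  dom e y -> dom c (p y) -> hmap y p -> dcoord e (fun v => coord c (p v)) y != 0 ->
  exists2 N : set Y, nbhs y N & forall u v, N u -> N v -> p u = p v -> u = v.
Proof.
move=> ey cy [pc ph] d0; have H := ph c cy.
have [g gh pg] := hol_atE ey H.
rewrite (dcoordE ey pg (hol1_holat gh)) in d0.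
have [r r0 rP] := hol1_inj gh d0.
exists [set v | [/\ dom e v, nm (coord e v - coord e y) < r & coord c (p v) = g (coord e v)]].
  have H1 := near_dom ey.
  have H2 : \forall v \near y, nm (coord e v - coord e y) < r.
    by apply: (near_coord ey (P := fun z => nm (z - coord e y) < r)); apply/near_nm; exists r.
  near=> v; split; near: v => //.
move=> u v [u1 u2 u3] [v1 v2 v3] E; apply: (coord_inj u1 v1).
by apply: rP => //; rewrite -u3 -v3 E.
Unshelve. all: by end_near. Qed.

End CoordinateDerivative.

(** * Orthogonal and adjoint Higgs fields on a fibre *)

Section LinearAlgebra.
Variable K : fieldType.

Lemma unitmx_ker n (B : 'M[K]_n) :
  (forall x : 'cV_n, B *m x = 0 -> x = 0) -> B \in unitmx.
Proof.
move=> H; rewrite -unitmx_tr -row_free_unit -kermx_eq0; apply/eqP/row_matrixP => i.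
rewrite row0; apply: trmx_inj; rewrite trmx0; apply: H.
by apply: trmx_inj; rewrite trmx_mul trmxK trmx0 -row_mul mulmx_ker row0.
Qed.

Lemma rank_inj m n p (J : 'M[K]_(m, n)) (x : 'M[K]_(n, p)) : \rank J = n -> J *m x = 0 -> x = 0.
Proof.
move=> rJ Jx; apply: trmx_inj; rewrite trmx0; apply/eqP.
have fJ : row_free J^T by rewrite /row_free mxrank_tr rJ.
by rewrite -(mulmx_free_eq0 _ fJ) -trmx_mul Jx trmx0.
Qed.

(** The determinant of a rank one perturbation, from two triangular completions of the same block
    matrix. The factor ['X] on both sides avoids inverting ['X%:M]. *)
Lemma det_mul_col_row n (u : 'cV[{poly K}]_n) (s : 'rV[{poly K}]_n) :
  \det ('X%:M - u *m s) * 'X = 'X ^+ n * ('X - (s *m u) 0 0).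
Proof.
have E1 : block_mx ('X%:M : 'M[{poly K}]_n) u s (1%:M : 'M[{poly K}]_1) *m block_mx 1%:M 0 (- s) 1%:M =
  block_mx ('X%:M - u *m s) u 0 1%:M.
  by rewrite mulmx_block !mulmx1 !mulmx0 !mul1mx !mulmxN !add0r subrr.
have E2 : block_mx ('X%:M : 'M[{poly K}]_n) u s (1%:M : 'M[{poly K}]_1) *m block_mx 1%:M (- u) 0 'X%:M =
  block_mx 'X%:M 0 s ('X%:M - s *m u).
  rewrite mulmx_block !mulmx1 !mulmx0 !mul1mx !mulmxN !addr0.
  by rewrite mul_scalar_mx mul_mx_scalar addNr [- _ + _]addrC.
have /(congr1 determinant) := E1; have /(congr1 determinant) := E2.
rewrite !det_mulmx det_ublock det_lblock det_lblock det_ublock !det1 !mulr1 !mul1r !det_scalar.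
move=> D1 <-; rewrite expr1 in D1; rewrite D1; congr (_ * _).
by rewrite {1}[s *m u]mx11_scalar -rmorphB /= det_scalar expr1.
Qed.

(** Adding [v *m s] moves the eigenvalue of [v] from 0 to 1 and leaves the rest of the
    characteristic polynomial alone. Comparing coefficients of degree one in [D] identifies the
    determinant, up to sign, with the linear coefficient for [A]. *)
Lemma det_add_kernel n (A : 'M[K]_n) (v : 'cV_n) (s : 'rV_n) :
  A *m v = 0 -> s *m v = 1%:M -> (char_poly A)`_1 != 0 -> \det (A + v *m s) != 0.
Proof.
move=> Av sv p1.
pose u := map_mx polyC v; pose t := map_mx polyC s.
have tu : (t *m u) 0 0 = 1 by rewrite -map_mxM /= sv !mxE eqxx.
have cE : char_poly_mx (A + v *m s) = char_poly_mx A - u *m t.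
  by rewrite /char_poly_mx map_mxD map_mxM /= opprD addrA.
have E : char_poly_mx A *m ('X%:M - u *m t) = 'X *: char_poly_mx (A + v *m s).
  have K1 : char_poly_mx A *m (u *m t) = 'X *: (u *m t).
    rewrite mulmxA /char_poly_mx mulmxBl -map_mxM /= Av map_mx0 subr0 mul_scalar_mx.
    by rewrite -scalemxAl.
  by rewrite cE mulmxBr mul_mx_scalar [RHS]scalerBr K1.
have D : char_poly A * ('X - 1) = 'X * char_poly (A + v *m s).
  have := congr1 determinant E; rewrite det_mulmx detZ -/(char_poly _) -/(char_poly _) => D.
  have := congr1 (fun p => p * 'X) D; rewrite -mulrA det_mul_col_row tu => D2.
  apply: (@mulIf _ ('X ^+ n)); first by rewrite expf_neq0 // polyX_eq0.
  by rewrite -mulrA [(_ - 1) * _]mulrC D2; ring.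
have D0 := congr1 (fun p : {poly K} => p`_0) D; have D1 := congr1 (fun p : {poly K} => p`_1) D.
rewrite /= mulrBr mulr1 !coefB coefMX coefXM /= sub0r in D0.
rewrite /= mulrBr mulr1 !coefB coefMX coefXM /= in D1.
have p0 : (char_poly A)`_0 = 0 by apply/eqP; rewrite -oppr_eq0 D0.
rewrite p0 sub0r char_poly_det in D1.
by apply: contraNneq p1 => d0; rewrite -oppr_eq0 D1 d0 mulr0.
Qed.

(** If [v] were isotropic, [v^T *m w] would annihilate both [A], by skewness, and [v *m s]. With [s]
    dual to [v] their sum is invertible, so [v^T *m w] would vanish, against non-degeneracy. *)
Lemma kernel_nonisotropic n (A w : 'M[K]_n) (v : 'cV_n) : v != 0 -> A *m v = 0 ->
  A^T *m w = - (w *m A) -> w \in unitmx -> (char_poly A)`_1 != 0 ->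
  (v^T *m w *m v) 0 0 != 0.
Proof.
move=> v0 Av skew wu p1; apply/eqP => iso.
have [i vi] : exists i, v i 0 != 0.
  apply: contrapT => H; move/eqP: v0; apply; apply/colP => i; rewrite mxE.
  by apply: contrapT => /eqP vi; apply: H; exists i.
pose s : 'rV_n := (v i 0)^-1 *: delta_mx 0 i.
have sv : s *m v = 1%:M.
  apply/matrixP => a b; rewrite !ord1 /s -scalemxAl mxE -rowE !mxE.
  by rewrite mulVf.
have := det_add_kernel Av sv p1; rewrite -unitfE -[_ \is a _]/(_ \in unitmx) => uA.
have r0 : v^T *m w *m (A + v *m s) = 0.
  rewrite mulmxDr mulmxA [v^T *m w *m v]mx11_scalar iso mul_scalar_mx scale0r addr0.
  by rewrite -mulmxA -[w *m A]opprK -skew mulmxN mulmxA -trmx_mul Av trmx0 mul0mx oppr0.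
have : v^T *m w = 0 by rewrite -[LHS](mulmxK uA) r0 mul0mx.
move/(congr1 (mulmx^~ (invmx w))); rewrite mulmxK // mul0mx => /(congr1 trmx).
by rewrite trmxK trmx0 => /eqP; rewrite (negbTE v0).
Qed.

Lemma row_mx_unit n (w : 'M[K]_(1 + n)) (v : 'cV_(1 + n)) (J : 'M[K]_(1 + n, n)) :
  (v^T *m w *m v) 0 0 != 0 -> v^T *m w *m J = 0 -> \rank J = n -> row_mx v J \in unitmx.
Proof.
move=> vv vJ rJ; apply: unitmx_ker => x.
rewrite -[x]vsubmxK mul_row_col => E.
have u0 : usubmx x = 0.
  have := congr1 (mulmx (v^T *m w)) E; rewrite mulmxDr !mulmxA vJ mul0mx addr0 mulmx0.
  rewrite [v^T *m w *m v]mx11_scalar mul_scalar_mx => /eqP.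
  by rewrite scaler_eq0 (negbTE vv) => /eqP.
rewrite u0 mulmx0 add0r in E; rewrite u0 (rank_inj rJ E).
by rewrite col_mx0.
Qed.

Lemma perp_form_unit n (w : 'M[K]_(1 + n)) (v : 'cV_(1 + n)) (J : 'M[K]_(1 + n, n)) :
  w^T = w -> w \in unitmx -> v^T *m w *m J = 0 -> row_mx v J \in unitmx ->
  J^T *m w *m J \in unitmx.
Proof.
move=> ws wu vJ uB.
have Jv : J^T *m w *m v = 0.
  by apply: trmx_inj; rewrite !trmx_mul trmxK ws mulmxA vJ trmx0.
have : (row_mx v J)^T *m w *m row_mx v J \in unitmx by rewrite !unitmx_mul unitmx_tr uB wu.
rewrite tr_row_mx mul_col_mx mul_col_row vJ Jv.
by rewrite !unitmxE det_ublock unitrM => /andP[].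
Qed.

Lemma rank_sum_le (I : Type) (s : seq I) m n (F : I -> 'M[K]_(m, n)) k :
  (forall i, (\rank (F i) <= k)%N) -> (\rank (\sum_(i <- s) F i)%R <= k * size s)%N.
Proof.
move=> H; elim: s => [|i s IH]; first by rewrite big_nil mxrank0.
rewrite big_cons /= mulnS; apply: leq_trans (mxrank_add _ _) _.
exact: leq_add.
Qed.

Lemma det_mx22 (A : 'M[K]_2) : \det A = A 0 0 * A 1 1 - A 0 1 * A 1 0.
Proof.
rewrite (expand_det_row _ 0) !big_ord_recl big_ord0 addr0 /cofactor !det_mx11 !mxE /=.
rewrite !expr0 expr1 mul1r mulN1r mulrN.
by congr (A _ _ * A _ _ - A _ _ * A _ _); apply/val_inj.
Qed.

Lemma tr_mx22 (A : 'M[K]_2) : \tr A = A 0 0 + A 1 1.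
Proof.
by rewrite /mxtrace !big_ord_recl big_ord0 addr0; congr (A _ _ + A _ _); apply/val_inj.
Qed.

Lemma ord2P (P : 'I_2 -> Prop) : P 0 -> P 1 -> forall i, P i.
Proof. by move=> p0 p1 [[|[|//]] ?]; [move: p0|move: p1]; congr P; apply/val_inj. Qed.

Lemma sum2 (V : nmodType) (f : 'I_2 -> V) : \sum_i f i = f 0 + f 1.
Proof. by rewrite !big_ord_recl big_ord0 addr0; congr (f _ + f _); apply/val_inj. Qed.

Lemma sqr_mx22 (A : 'M[K]_2) : \tr A = 0 -> A *m A = (- \det A)%:M.
Proof.
rewrite tr_mx22 => /eqP; rewrite addr_eq0 => /eqP a.
apply/matrixP => i j; rewrite !mxE sum2 det_mx22 a; move: i j.
by apply: ord2P; apply: ord2P; rewrite /= ?a ?mulr1n ?mulr0n; ring.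
Qed.

End LinearAlgebra.

Lemma col_mul (K : pzRingType) m n p (A : 'M[K]_(m, n)) (B : 'M[K]_(n, p)) j :
  col j (A *m B) = A *m col j B.
Proof. by rewrite !colE mulmxA. Qed.

(** * The adjoint action in an eigenbasis *)

Section Adjoint.
Variable R : realType.
Notation C := R[i].

Lemma ctrmx_mul m n p (A : 'M[C]_(m, n)) (B : 'M[C]_(n, p)) :
  (A *m B)^t* = B^t* *m A^t*.
Proof. by rewrite trmx_mul map_mxM. Qed.

Lemma ctrmxK m n (A : 'M[C]_(m, n)) : A^t*^t* = A.
Proof. by apply/matrixP => i j; rewrite !mxE conjCK. Qed.

Lemma ctrmx_unit n (A : 'M[C]_n) : (A^t* \in unitmx) = (A \in unitmx).
Proof. by rewrite map_unitmx unitmx_tr. Qed.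

Lemma ctrmx_inv n (A : 'M[C]_n) : (invmx A)^t* = invmx (A^t*).
Proof. by rewrite trmx_inv map_invmx. Qed.

Lemma ctrmx_scalar n (a : C) : (a%:M : 'M[C]_n)^t* = a^*%:M.
Proof. by rewrite tr_scalar_mx map_scalar_mx. Qed.

Lemma ctrmxZ m n (a : C) (A : 'M[C]_(m, n)) : (a *: A)^t* = a^* *: A^t*.
Proof. by apply/matrixP => i j; rewrite !mxE rmorphM. Qed.

Definition diag2 (a b : C) : 'M[C]_2 := \matrix_(i, j) if i == j then (if i == 0 then a else b) else 0.
(** The hyperbolic form: both coordinate lines are isotropic, and they are dual to each other. *)
Definition swap2 : 'M[C]_2 := \matrix_(i, j) (i != j)%:R.

Lemma diag2_mul a b c d : diag2 a b *m diag2 c d = diag2 (a * c) (b * d).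
Proof.
apply/matrixP => i j; rewrite !mxE sum2 !mxE; move: i j.
by apply: ord2P; apply: ord2P; rewrite /=; ring.
Qed.

Lemma diag2_ctr a b : (diag2 a b)^t* = diag2 a^* b^*.
Proof.
apply/matrixP => i j; rewrite !mxE; move: i j.
by apply: ord2P; apply: ord2P; rewrite /= ?conjC0.
Qed.

Lemma diag2_unit a b : a != 0 -> b != 0 -> diag2 a b \in unitmx.
Proof.
by move=> a0 b0; rewrite unitmxE det_mx22 !mxE /= mul0r subr0 unitfE mulf_neq0.
Qed.

Lemma invmx_uniq n (A B : 'M[C]_n) : A *m B = 1%:M -> invmx A = B.
Proof.
move=> AB; have [uA _] := mulmx1_unit AB.
by rewrite -[LHS]mulmx1 -AB mulKmx.
Qed.

Lemma diag2_inv a b : a != 0 -> b != 0 -> invmx (diag2 a b) = diag2 a^-1 b^-1.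
Proof.
move=> a0 b0; apply: invmx_uniq; rewrite diag2_mul !mulfV //.
apply/matrixP => i j; rewrite !mxE; move: i j.
by apply: ord2P; apply: ord2P.
Qed.

Lemma tr_mul22 (A B : 'M[C]_2) :
  \tr (A *m B) = A 0 0 * B 0 0 + A 0 1 * B 1 0 + (A 1 0 * B 0 1 + A 1 1 * B 1 1).
Proof. by rewrite tr_mx22 !mxE !sum2. Qed.

Lemma ad_diag01 a (N : 'M[C]_2) :
  (diag2 a (- a) *m N - N *m diag2 a (- a)) 0 1 = 2 * a * N 0 1.
Proof. by rewrite !mxE !sum2 !mxE /=; ring. Qed.

Lemma ad_diag10 a (N : 'M[C]_2) :
  (diag2 a (- a) *m N - N *m diag2 a (- a)) 1 0 = - (2 * a) * N 1 0.
Proof. by rewrite !mxE !sum2 !mxE /=; ring. Qed.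

Lemma madj_diag01 a b (N : 'M[C]_2) :
  (diag2 a^-1 b^-1 *m N^t* *m diag2 a b) 0 1 = (N 1 0)^* * (b / a).
Proof. by rewrite !mxE !sum2 !mxE !sum2 !mxE /=; ring. Qed.

Lemma madj_diag10 a b (N : 'M[C]_2) :
  (diag2 a^-1 b^-1 *m N^t* *m diag2 a b) 1 0 = (N 0 1)^* * (a / b).
Proof. by rewrite !mxE !sum2 !mxE !sum2 !mxE /=; ring. Qed.

Lemma swap2_form m n (A : 'M[C]_(2, m)) (B : 'M[C]_(2, n)) i j :
  (A^T *m swap2 *m B) i j = A 0 i * B 1 j + A 1 i * B 0 j.
Proof. by rewrite !mxE !sum2 !mxE !sum2 !mxE /=; ring. Qed.

Lemma diag2_form a b m n (A : 'M[C]_(2, m)) (B : 'M[C]_(2, n)) i j :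
  (A^t* *m diag2 a b *m B) i j = (A 0 i)^* * a * B 0 j + (A 1 i)^* * b * B 1 j.
Proof. by rewrite !mxE !sum2 !mxE !sum2 !mxE /=; ring. Qed.

Lemma diag2_mulE a b m (A : 'M[C]_(2, m)) j :
  (diag2 a b *m A) 0 j = a * A 0 j /\ (diag2 a b *m A) 1 j = b * A 1 j.
Proof. by rewrite !mxE !sum2 !mxE /= !mul0r addr0 add0r. Qed.

(** [N0] commutes with a diagonal matrix with distinct entries and has trace 0, so it is a non-zero
    multiple of [diag2 1 (- 1)]; orthogonality to it for the trace form kills the diagonal of
    [N]. *)
Lemma offdiag_mx a (N0 N : 'M[C]_2) : a != 0 ->
  diag2 a (- a) *m N0 - N0 *m diag2 a (- a) = 0 -> \tr N0 = 0 -> N0 != 0 -> \tr N = 0 ->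
  \tr (N0 *m N) = 0 -> N 0 0 = 0 /\ N 1 1 = 0.
Proof.
move=> a0 ad0 trN0 N00 trN trNN; have two0 : (2 : C) != 0 by rewrite pnatr_eq0.
have e01 : N0 0 1 = 0.
  have := congr1 (fun A : 'M[C]_2 => A 0 1) ad0; rewrite ad_diag01 mxE => /eqP.
  by rewrite !mulf_eq0 (negbTE two0) (negbTE a0) => /eqP.
have e10 : N0 1 0 = 0.
  have := congr1 (fun A : 'M[C]_2 => A 1 0) ad0; rewrite ad_diag10 mxE => /eqP.
  by rewrite !(mulf_eq0, oppr_eq0) (negbTE two0) (negbTE a0) => /eqP.
have t0 : N0 1 1 = - N0 0 0 by apply/eqP; rewrite -addr_eq0 addrC -tr_mx22 trN0.
have tN : N 1 1 = - N 0 0 by apply/eqP; rewrite -addr_eq0 addrC -tr_mx22 trN.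
have n00 : N0 0 0 != 0.
  apply: contra_neq N00 => n0; apply/matrixP => i j; rewrite [RHS]mxE; move: i j.
  by apply: ord2P; apply: ord2P; rewrite ?t0 ?n0 ?e01 ?e10 ?oppr0.
move: trNN; rewrite tr_mul22 e01 e10 t0 tN => E.
have {}E : 2 * N0 0 0 * N 0 0 = 0 by rewrite -E; ring.
move/eqP: E; rewrite !mulf_eq0 (negbTE two0) (negbTE n00) => /eqP E.
by rewrite E oppr0.
Qed.

Definition offdiag_by (N : 'M[C]_2) a b := [/\ N 0 0 = 0, N 1 1 = 0, N 0 1 = a & N 1 0 = b].

Lemma tr_offdiag (N N' : 'M[C]_2) a b a' b' : offdiag_by N a b -> offdiag_by N' a' b' ->
  \tr (N *m N') = a * b' + b * a'.
Proof.
by move=> [n00 n11 n01 n10] [m00 m11 m01 m10]; rewrite tr_mul22 n00 n11 n01 n10 m01 m10; ring.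
Qed.

Lemma tr_offdiag_herm (N N' : 'M[C]_2) x y a b a' b' : offdiag_by N a b -> offdiag_by N' a' b' ->
  \tr (N *m (diag2 x^-1 y^-1 *m N'^t* *m diag2 x y)) = a'^* * (x / y) * a + b'^* * (y / x) * b.
Proof.
move=> [n00 n11 n01 n10] [m00 m11 m01 m10].
by rewrite tr_mul22 madj_diag01 madj_diag10 n00 n11 n01 n10 m01 m10; ring.
Qed.

Definition conj_by (P m : 'M[C]_2) := invmx P *m m *m P.

Lemma conj_byM P m m' : P \in unitmx -> conj_by P (m *m m') = conj_by P m *m conj_by P m'.
Proof. by move=> uP; rewrite /conj_by !mulmxA mulmxK. Qed.

Lemma conj_by_tr P m : P \in unitmx -> \tr (conj_by P m) = \tr m.
Proof. by move=> uP; rewrite /conj_by mxtrace_mulC mulmxA mulmxV // mul1mx. Qed.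

Lemma conj_by_inj P m : P \in unitmx -> conj_by P m = 0 -> m = 0.
Proof.
move=> uP; rewrite /conj_by => E.
rewrite -mulmxA in E.
by rewrite -[m](mulmxK uP) -[m *m P](mulKVmx uP) E mulmx0 mul0mx.
Qed.

Lemma conj_by_madj P h m d1 d2 : P \in unitmx -> d1 != 0 -> d2 != 0 ->
  P^t* *m h *m P = diag2 d1 d2 ->
  conj_by P (madj h m) = diag2 d1^-1 d2^-1 *m (conj_by P m)^t* *m diag2 d1 d2.
Proof.
move=> uP d10 d20 hE; have uPt : P^t* \in unitmx by rewrite ctrmx_unit.
have hh : h = invmx (P^t*) *m diag2 d1 d2 *m invmx P.
  by rewrite -hE !mulmxA mulVmx // mul1mx mulmxK.
have hi : invmx h = P *m diag2 d1^-1 d2^-1 *m P^t*.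
  rewrite hh !invmxM ?unitmx_mul ?unitmx_inv ?uPt ?diag2_unit // !invmxK diag2_inv //.
  by rewrite mulmxA.
have L : invmx P *m invmx h = diag2 d1^-1 d2^-1 *m P^t* by rewrite hi -!mulmxA mulKmx.
have L' : h *m P = invmx (P^t*) *m diag2 d1 d2 by rewrite hh mulmxKV.
rewrite /conj_by /madj !ctrmx_mul ctrmx_inv -!mulmxA L' [invmx P *m (_ *m _)]mulmxA L.
by rewrite -!mulmxA.
Qed.

Definition offd (b : 'I_2) (N : 'M[C]_2) : C := if b == 0 then N 0 1 else N 1 0.

(** In an eigenbasis [P] of [Phi'] the kernel of the adjoint action is diagonal and its orthogonal
    complement off-diagonal; the two rows read off the off-diagonal entries, the coordinates along
    the eigenlines of the adjoint action. *)
Definition offmx (P : 'M[C]_2) (psi : 'I_3 -> 'M[C]_2) : 'M[C]_(2, 3) :=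
  \matrix_(b, l) offd b (conj_by P (psi l)).

Lemma offmxE P psi (v : 'cV[C]_3) b :
  (offmx P psi *m v) b 0 = offd b (conj_by P (lin_app psi v)).
Proof.
rewrite mxE /lin_app /conj_by mulmx_sumr mulmx_suml /offd; move: b.
apply: ord2P => /=; rewrite summxE; apply: eq_bigr => l _;
  by rewrite -scalemxAr -scalemxAl [RHS]mxE [offmx _ _ _ _]mxE mulrC.
Qed.

Lemma offmx_mul P psi m (J : 'M[C]_(3, m)) b j :
  (offmx P psi *m J) b j = offd b (conj_by P (lin_app psi (col j J))).
Proof. by rewrite -offmxE -col_mul !mxE. Qed.

Lemma lin_app_mul psi (A : 'M[C]_3) v :
  lin_app psi (A *m v) = \sum_l v l 0 *: lin_app psi (col l A).
Proof.
rewrite /lin_app; under eq_bigr do rewrite mxE scaler_suml.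
rewrite exchange_big; apply: eq_bigr => l _; rewrite scaler_sumr.
by apply: eq_bigr => k _; rewrite !mxE scalerA mulrC.
Qed.

Lemma bilinE m n p q (A : 'M[C]_(m, p)) (w : 'M[C]_(m, n)) (B : 'M[C]_(n, q)) i j :
  (A^T *m w *m B) i j = \sum_k \sum_l A k i * w k l * B l j.
Proof.
rewrite mxE exchange_big; apply: eq_bigr => l _.
by rewrite mxE mulr_suml; apply: eq_bigr => k _; rewrite !mxE.
Qed.

Section Fibre.
Variables (psi : 'I_3 -> 'M[C]_2) (w3 h3 Phi3 : 'M[C]_3) (Phi' h' P : 'M[C]_2).
Variables (mu d1 d2 : C).
Hypotheses (trpsi : forall l, \tr (psi l) = 0)
  (wpsi : forall k l, \tr (psi k *m psi l) = w3 k l) (w3u : w3 \in unitmx)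
  (adpsi : forall l, lin_app psi (col l Phi3) = Phi' *m psi l - psi l *m Phi')
  (hpsi : forall k l, h3 k l = \tr (psi l *m madj h' (psi k)))
  (uP : P \in unitmx) (mu0 : mu != 0) (eigP : Phi' *m P = P *m diag2 mu (- mu))
  (d10 : d1 != 0) (d20 : d2 != 0) (hP : P^t* *m h' *m P = diag2 d1 d2).

Lemma lin_app_tr v : \tr (lin_app psi v) = 0.
Proof. by rewrite /lin_app raddf_sum big1 // => l _; rewrite /= mxtraceZ trpsi mulr0. Qed.

Lemma lin_app_form m n (A : 'M[C]_(3, m)) (B : 'M[C]_(3, n)) i j :
  \tr (lin_app psi (col i A) *m lin_app psi (col j B)) = (A^T *m w3 *m B) i j.
Proof.
rewrite bilinE /lin_app mulmx_suml raddf_sum; apply: eq_bigr => k _.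
rewrite mulmx_sumr raddf_sum; apply: eq_bigr => l _ /=.
by rewrite -scalemxAl -scalemxAr !mxtraceZ wpsi !mxE; ring.
Qed.

Lemma madj_sum (v : 'cV[C]_3) : madj h' (lin_app psi v) = \sum_k (v k 0)^* *: madj h' (psi k).
Proof.
rewrite /madj /lin_app raddf_sum /=.
rewrite (_ : map_mx _ _ = \sum_k (v k 0)^* *: (psi k)^t*); last first.
  by rewrite raddf_sum /=; apply: eq_bigr => k _; rewrite -ctrmxZ.
rewrite mulmx_sumr mulmx_suml; apply: eq_bigr => k _.
by rewrite -scalemxAr -scalemxAl.
Qed.

Lemma lin_app_herm m n (A : 'M[C]_(3, m)) (B : 'M[C]_(3, n)) i j :
  \tr (lin_app psi (col j B) *m madj h' (lin_app psi (col i A))) = (A^t* *m h3 *m B) i j.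
Proof.
have -> : (A^t* *m h3 *m B) i j = \sum_k \sum_l (A k i)^* * h3 k l * B l j.
  rewrite -map_trmx bilinE; apply: eq_bigr => k _; apply: eq_bigr => l _.
  by rewrite mxE.
rewrite madj_sum mulmx_sumr raddf_sum; apply: eq_bigr => k _.
rewrite /lin_app mulmx_suml raddf_sum; apply: eq_bigr => l _ /=.
by rewrite -scalemxAl -scalemxAr !mxtraceZ hpsi !mxE; ring.
Qed.

Lemma lin_app_inj v : lin_app psi v = 0 -> v = 0.
Proof.
move=> v0; have E : v^T *m w3 = 0.
  apply/matrixP => i j; have := lin_app_form v (1%:M : 'M[C]_3) 0 j.
  have -> : col 0 v = v by apply/matrixP => a b; rewrite !mxE !ord1.
  rewrite v0 mul0mx mxtrace0 mulmx1 => E0.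
  by rewrite (ord1 i) [RHS]mxE -E0.
apply: trmx_inj; rewrite trmx0; have := congr1 (mulmx^~ (invmx w3)) E.
by rewrite mulmxK // mul0mx.
Qed.

Lemma lin_app_ad v : lin_app psi (Phi3 *m v) = Phi' *m lin_app psi v - lin_app psi v *m Phi'.
Proof.
rewrite lin_app_mul [lin_app psi v]/lin_app mulmx_sumr mulmx_suml -sumrB; apply: eq_bigr => l _.
by rewrite adpsi -scalemxAl -scalemxAr scalerBr.
Qed.

Lemma conj_by_eig : conj_by P Phi' = diag2 mu (- mu).
Proof. by rewrite /conj_by -mulmxA eigP mulKmx. Qed.

Lemma conj_by_ad v : conj_by P (lin_app psi (Phi3 *m v)) =
  diag2 mu (- mu) *m conj_by P (lin_app psi v) - conj_by P (lin_app psi v) *m diag2 mu (- mu).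
Proof.
rewrite lin_app_ad -conj_by_eig -!conj_byM // /conj_by.
by rewrite mulmxBr mulmxBl.
Qed.

Lemma offdiag (M : 'cV[C]_3) (v : 'cV[C]_3) : M != 0 -> Phi3 *m M = 0 -> M^T *m w3 *m v = 0 ->
  conj_by P (lin_app psi v) 0 0 = 0 /\ conj_by P (lin_app psi v) 1 1 = 0.
Proof.
move=> M0 PM Mv; apply: (@offdiag_mx mu (conj_by P (lin_app psi M))) => //.
- by rewrite -conj_by_ad PM /lin_app big1 ?/conj_by ?mulmx0 ?mul0mx // => l _; rewrite mxE scale0r.
- by rewrite conj_by_tr // lin_app_tr.
- by apply: contra_neq M0 => /(conj_by_inj uP) /lin_app_inj.
- by rewrite conj_by_tr // lin_app_tr.
rewrite -conj_byM // conj_by_tr // -[M](_ : col 0 M = M); last by apply/matrixP => a b; rewrite !mxE !ord1.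
rewrite -[v](_ : col 0 v = v); last by apply/matrixP => a b; rewrite !mxE !ord1.
by rewrite lin_app_form Mv mxE.
Qed.

Section Perp.
Variables (JM : 'M[C]_(3, 1)) (J : 'M[C]_(3, 2)) (PhiV : 'M[C]_2).
Hypotheses (JM0 : JM != 0) (PJM : Phi3 *m JM = 0) (JMJ : JM^T *m w3 *m J = 0)
  (PJ : Phi3 *m J = J *m PhiV).
Let Cm := offmx P psi *m J.

Lemma perp_offdiag j :
  offdiag_by (conj_by P (lin_app psi (col j J))) (Cm 0 j) (Cm 1 j).
Proof.
have Mv : JM^T *m w3 *m col j J = 0 by rewrite -col_mul JMJ; apply/matrixP => a b; rewrite !mxE.
by have [? ?] := offdiag JM0 PJM Mv; rewrite /Cm !offmx_mul.
Qed.

Lemma fibre_form : J^T *m w3 *m J = Cm^T *m swap2 *m Cm.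
Proof.
apply/matrixP => i j; rewrite -lin_app_form -(conj_by_tr _ uP) conj_byM // swap2_form.
exact: tr_offdiag (perp_offdiag i) (perp_offdiag j).
Qed.

(** The metric induced on endomorphisms does not change when [h'] is rescaled, so it depends on the
    ratio of [d1] and [d2] alone, with inverse ratios on the two off-diagonal entries. *)
Lemma fibre_herm : J^t* *m h3 *m J = Cm^t* *m diag2 (d1 / d2) (d2 / d1) *m Cm.
Proof.
apply/matrixP => i j; rewrite -lin_app_herm -(conj_by_tr _ uP) conj_byM //.
rewrite (conj_by_madj _ uP d10 d20 hP) diag2_form.
exact: tr_offdiag_herm (perp_offdiag j) (perp_offdiag i).
Qed.

Lemma fibre_phi : Cm *m PhiV = diag2 (2 * mu) (- (2 * mu)) *m Cm.
Proof.
apply/matrixP => b j; have [c0 c1] := diag2_mulE (2 * mu) (- (2 * mu)) Cm j.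
have [_ _ a3 a4] := perp_offdiag j.
rewrite {1}/Cm -mulmxA -PJ offmx_mul col_mul conj_by_ad; move: b.
by apply: ord2P; rewrite /offd /= ?ad_diag01 ?ad_diag10 ?c0 ?c1 ?a3 ?a4.
Qed.

End Perp.
End Fibre.
End Adjoint.

Lemma germ_eqJ (R : realType) (X : topologicalType) (A : Type) (phi : X -> R[i])
  (x : X) (f : X -> A) (g : R[i] -> A) : germ_eq phi x f g ->
  \forall y \near x, germ_eq phi y f g.
Proof. by move=> H; apply: near_join. Qed.

(** * The eigenline splitting on the quotient curve *)

Section BundleFrames.
Variables (R : realType) (X : surface R).

Lemma hom_hol_at r s (E : bundle X r) (F : bundle X s) U A i j x :
  hom_hol E F U A -> U x -> fdom (b := E) i x -> fdom (b := F) j x ->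
  hol_mx x (fun y => invmx (frame (b := F) j y) *m A y *m frame (b := E) i y).
Proof.
move=> H Ux ix jx k l; have /hol_onP := H i j k l.
by apply; do 2?split.
Qed.

Lemma mx11E (A : 'M[R[i]]_1) : A = (A 0 0)%:M.
Proof. exact: mx11_scalar. Qed.

Lemma lframeE (L : bundle X 1) (i : fidx L) x : frame i x = (lframe i x)%:M.
Proof. exact: mx11_scalar. Qed.

Lemma lframe_neq0 (L : bundle X 1) (i : fidx L) x : is_bundle L -> fdom i x -> lframe i x != 0.
Proof.
move=> HL ix; have := frame_unit HL ix.
by rewrite lframeE unitmxE det_scalar expr1 unitfE.
Qed.

Lemma lsec_hol_at (L : bundle X 1) U s i x :
  lsec_hol L U s -> U x -> fdom (b := L) i x -> hol_at x (fun y => (lframe i y)^-1 * s y).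
Proof.
move=> H Ux ix.
have := @hom_hol_at _ _ (triv X 1) L U (fun x => (s x)%:M) tt i x H Ux I ix 0 0.
under eq_fun do rewrite /= mulmx1 lframeE invmx_scalar -scalar_mxM mxE eqxx mulr1n.
by [].
Qed.

Lemma fdom_near r (E : bundle X r) (i : fidx E) x : is_bundle E -> fdom i x ->
  \forall y \near x, fdom i y.
Proof. by move=> HE ix; apply: open_nbhs_nbhs; split => //; exact: fdom_open. Qed.

End BundleFrames.

Section TwoByTwo.
Variable R : realType.
Notation C := R[i].

Lemma diag2_block (a b : C) : diag2 a b = block_mx a%:M 0 0 b%:M :> 'M[C]_(1 + 1).
Proof.
apply/matrixP => i j; case: (@split_ordP 1 1 i) => i' ->; case: (@split_ordP 1 1 j) => j' ->;
  by rewrite ?(block_mxEul, block_mxEur, block_mxEdl, block_mxEdr) !ord1 !mxE.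
Qed.

Lemma row_diag2 (A B : 'cV[C]_2) a b :
  (row_mx A B : 'M[C]_2) *m diag2 a b = row_mx (a *: A) (b *: B).
Proof.
have := mul_row_block A B a%:M 0 0 b%:M.
by rewrite -diag2_block !mulmx0 addr0 add0r !mul_mx_scalar.
Qed.

Lemma mul_row2 (M : 'M[C]_2) (A B : 'cV[C]_2) :
  M *m (row_mx A B : 'M[C]_2) = row_mx (M *m A) (M *m B).
Proof. exact: (@mul_mx_row _ 2 2 1 1 M A B). Qed.

Lemma row2E0 (A B : 'cV[C]_2) i : (row_mx A B : 'M[C]_2) i 0 = A i 0.
Proof. by rewrite -(row_mxEl A B i 0); congr (row_mx A B i _); apply/val_inj. Qed.

Lemma row2E1 (A B : 'cV[C]_2) i : (row_mx A B : 'M[C]_2) i 1 = B i 0.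
Proof. by rewrite -(row_mxEr A B i 0); congr (row_mx A B i _); apply/val_inj. Qed.

Lemma row2_mul (A B x : 'cV[C]_2) :
  (row_mx A B : 'M[C]_2) *m x = x 0 0 *: A + x 1 0 *: B.
Proof.
apply/matrixP => i j; rewrite !ord1 mxE sum2 row2E0 row2E1.
by rewrite !mxE [A _ _ * _]mulrC [B _ _ * _]mulrC.
Qed.

Lemma eigen_unit (M : 'M[C]_2) (A B : 'cV[C]_2) a : a != 0 -> A != 0 -> B != 0 ->
  M *m A = a *: A -> M *m B = - a *: B -> (row_mx A B : 'M[C]_2) \in unitmx.
Proof.
move=> a0 A0 B0 MA MB; apply: unitmx_ker => x.
rewrite row2_mul; suff H u v : u *: A + v *: B = 0 -> u = 0 /\ v = 0.
  move=> /H [x0 x1]; apply/matrixP => i j; rewrite !ord1 [RHS]mxE; move: i.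
  exact: ord2P.
move=> E.
have two0 : (2 : C) != 0 by rewrite pnatr_eq0.
have E2 : u *: A - v *: B = 0.
  have := congr1 (mulmx M) E; rewrite mulmxDr mulmx0 -!scalemxAr MA MB => F.
  apply: (scalerI a0); rewrite scaler0 -[RHS]F scalerBr scaleNr scalerN !scalerA.
  by rewrite [u * a]mulrC [v * a]mulrC.
have u0 : u = 0.
  have : (2 * u) *: A = 0.
    rewrite -[RHS](addr0 0) -{1}E -E2 mulr2n mulrDl mul1r scalerDl.
    by move: (u *: A) (v *: B) => p q; rewrite addrACA subrr addr0.
  by move/eqP; rewrite scaler_eq0 (negbTE A0) orbF mulf_eq0 (negbTE two0) => /eqP.
have v0 : v = 0.
  move: E; rewrite u0 scale0r add0r => /eqP.
  by rewrite scaler_eq0 (negbTE B0) orbF => /eqP.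
by [].
Qed.

Lemma herm_row (A B : 'cV[C]_2) (h : 'M[C]_2) d1 d2 :
  A^t* *m h *m A = d1%:M -> B^t* *m h *m B = d2%:M -> B^t* *m h *m A = 0 -> A^t* *m h *m B = 0 ->
  (row_mx A B : 'M[C]_2)^t* *m h *m (row_mx A B : 'M[C]_2) = diag2 d1 d2.
Proof.
move=> hA hB hBA hAB.
have -> : (row_mx A B : 'M[C]_2)^t* = col_mx (A^t*) (B^t*).
  exact: etrans (congr1 (map_mx _) (tr_row_mx A B)) (map_col_mx _ _ _).
have E : (col_mx (A^t*) (B^t*) : 'M[C]_(1 + 1, 2)) *m h *m (row_mx A B : 'M[C]_(2, 1 + 1)) =
    block_mx d1%:M 0 0 d2%:M by rewrite mul_col_mx mul_col_row hA hB hBA hAB.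
by rewrite diag2_block; exact: E.
Qed.

(** Scaling two dual isotropic lines inversely is an isometry of the hyperbolic form; this is the
    freedom used to normalise the metric. *)
Lemma swap2_diag (f : C) : f != 0 -> (diag2 f f^-1)^T *m swap2 R *m diag2 f f^-1 = swap2 R.
Proof.
move=> f0; apply/matrixP => i j; rewrite swap2_form !mxE; move: i j.
by apply: ord2P; apply: ord2P; rewrite /= ?mulfV ?mulVf //; ring.
Qed.

Lemma swap2_absorb (f : C) (A : 'M[C]_2) : f != 0 ->
  (diag2 f f^-1 *m A)^T *m swap2 R *m (diag2 f f^-1 *m A) = A^T *m swap2 R *m A.
Proof. by move=> f0; rewrite trmx_mul -[in RHS](swap2_diag f0) !mulmxA. Qed.

Lemma diag2_absorb (f d1 d2 : C) (A : 'M[C]_2) : d1 / d2 = f * f^* ->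
  (diag2 f f^-1 *m A)^t* *m (diag2 f f^-1 *m A) = A^t* *m diag2 (d1 / d2) (d2 / d1) *m A.
Proof.
move=> E; rewrite ctrmx_mul diag2_ctr !mulmxA -[_ *m diag2 _ _ *m diag2 _ _]mulmxA diag2_mul.
have -> : f^* * f = d1 / d2 by rewrite E mulrC.
have -> : (f^-1)^* / f = d2 / d1 by rewrite fmorphV -invfM mulrC -E invf_div.
by [].
Qed.

Lemma diag2_comm (a b c d : C) : diag2 a b *m diag2 c d = diag2 c d *m diag2 a b.
Proof. by rewrite !diag2_mul [a * c]mulrC [b * d]mulrC. Qed.

End TwoByTwo.

(** * Holomorphic coordinates along the eigenlines *)

Section EigenSplitting.
Variables (R : realType) (Y : surface R) (N : bundle Y 1).
Hypotheses (N_open : forall j, open (fdom (b := N) j))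
  (N_cover : forall y, exists j, fdom (b := N) j y)
  (N_neq0 : forall j y, fdom (b := N) j y -> lframe (L := N) j y != 0).
Variables (E3 : bundle Y 3) (Phi3 w3 h3 : Y -> 'M[R[i]]_3) (b2 : Y -> R[i]).
Hypotheses (E3_bundle : is_bundle E3) (w3u : forall y, w3 y \in unitmx)
  (cp3 : forall y, char_poly (Phi3 y) = 'X * ('X ^+ 2 + (b2 y)%:P)).
Variables (M3 : bundle Y 1) (JM3 : Y -> 'M[R[i]]_(3, 1)) (V3 : bundle Y 2)
  (J3 : Y -> 'M[R[i]]_(3, 2)) (PhiV3 : Y -> 'M[R[i]]_2).
Hypotheses (ker3 : is_kernel E3 Phi3 M3 JM3)
  (perp3 : @is_perp R Y 2 E3 Phi3 w3 JM3 V3 J3 PhiV3).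

Variables (E' : bundle Y 2) (Phi' : Y -> 'M[R[i]]_2) (psi : Y -> 'I_3 -> 'M[R[i]]_2)
    (OD : bundle Y 1) (sD kappa hdet : Y -> R[i])
    (S : surface R) (p2 : S -> Y) (la : S -> R[i]) (sg : S -> S)
    (L : bundle S 1) (JL : S -> 'M[R[i]]_(2, 1)) (hL : S -> R[i])
    (h' : Y -> 'M[R[i]]_2).
Hypotheses (adH : ad_induced N E3 Phi3 w3 E' Phi' psi)
  (ncH : normalised_cover N Phi' p2 la sg)
  (elH : eigenline_metric N E' Phi' OD sD kappa hdet p2 la sg L JL hL)
  (hL1 : forall s, la s != 0 -> (JL s)^t* *m h' (p2 s) *m JL s = (hL s)%:M)
  (hL2 : forall s, la s != 0 -> (JL (sg s))^t* *m h' (p2 s) *m JL s = 0)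
  (h3E : forall y k l, b2 y != 0 -> h3 y k l = \tr (psi y l *m madj (h' y) (psi y k))).

(* If [Phi'] were nilpotent at [y], so would be its adjoint [Phi3]. *)
Lemma det_neq0 y : b2 y != 0 -> \det (Phi' y) != 0.
Proof.
move=> b0; apply/eqP => d0.
have P2 : Phi' y *m Phi' y = 0 by rewrite (sqr_mx22 (ad_phi_tr adH y)) d0 oppr0 raddf0.
have ad v := lin_app_ad (ad_psi_phi adH y) v.
have P3 (v : 'cV[R[i]]_3) : Phi3 y *m (Phi3 y *m (Phi3 y *m v)) = 0.
  apply: (lin_app_inj (ad_psi_form adH y) (w3u y)); rewrite !ad.
  by rewrite !(mulmxBr, mulmxBl, mulmxA) P2 !(mul0mx, mulmx0) -!mulmxA P2 !(mul0mx, mulmx0) !subr0 ?sub0r ?subrr ?oppr0 ?addr0 ?subrr.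
have P4 : Phi3 y *m (Phi3 y *m Phi3 y) = 0.
  apply/matrixP => i j; have := congr1 (fun A : 'cV[R[i]]_3 => A i 0) (P3 (col j 1%:M)).
  by rewrite -!col_mul mulmx1 [LHS]mxE => ->; rewrite !mxE.
(* Since the cube of [Phi3 y] is 0, this identity leaves [b2 y *: Phi3 y = 0]; but a zero [Phi3 y]
   has characteristic polynomial ['X ^+ 3], whose linear coefficient is not [b2 y]. *)
have CH := Cayley_Hamilton (Phi3 y).
rewrite cp3 rmorphM rmorphD rmorphXn /= horner_mx_X horner_mx_C in CH.
have Z : Phi3 y = 0.
  have E : b2 y *: Phi3 y = 0.
    rewrite -mul_mx_scalar -[RHS]CH mulrDr exprS expr1 -!mulmxE.
    by rewrite P4 add0r.
  by move/eqP: E; rewrite scaler_eq0 (negbTE b0) => /eqP.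
have := cp3 y; rewrite Z /char_poly /char_poly_mx map_mx0 subr0 det_scalar.
move=> /(congr1 (fun p : {poly R[i]} => p`_1)).
rewrite coefXn coefXM coefD coefXn coefC /= add0r => E.
by rewrite -E eqxx in b0.
Qed.

Lemma la_sqr s : la s * la s = - \det (Phi' (p2 s)).
Proof.
have : (fun s => (p2 s, la s)) @` setT = [set b | root (char_poly (Phi' b.1)) b.2] := nc_range ncH.
move=> /seteqP [H _]; have : root (char_poly (Phi' (p2 s))) (la s).
  by have := H (p2 s, la s); apply; exists s.
rewrite -eigenvalue_root_char => /eigenvalueP [v Ev v0].
have E : v *m (Phi' (p2 s) *m Phi' (p2 s)) = (la s * la s) *: v.
  by rewrite mulmxA Ev -scalemxAl Ev scalerA.
rewrite (sqr_mx22 (ad_phi_tr adH _)) mul_mx_scalar in E.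
have /eqP : (la s * la s - - \det (Phi' (p2 s))) *: v = 0 by rewrite scalerBl E subrr.
by rewrite scaler_eq0 (negbTE v0) orbF subr_eq0 => /eqP.
Qed.

Lemma la_neq0 s : (la s != 0) = (\det (Phi' (p2 s)) != 0).
Proof. by rewrite -[\det _ == 0]oppr_eq0 -la_sqr mulf_eq0 orbb. Qed.

Lemma ex_eigenpoint y : b2 y != 0 -> exists2 s, p2 s = y & la s != 0.
Proof.
move=> b0; have d0 := det_neq0 b0.
have [l Hl] : exists l, root (char_poly (Phi' y)) l.
  by apply: closed_rootP; rewrite size_char_poly.
have /seteqP [_ H] := nc_range ncH.
have [s _ [ps ls]] := H (y, l) Hl.
by exists s => //; rewrite la_neq0 ps.
Qed.

Lemma sg_sg s : la s != 0 -> sg (sg s) = s.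
Proof.
move=> l0; apply: (nc_inj ncH); rewrite ?(nc_sg_p2 ncH) ?(nc_sg_la ncH) ?opprK //.
by rewrite -la_neq0.
Qed.

Lemma la_frame_hol j s : fdom (b := N) j (p2 s) ->
  hol_at s (fun t => (lframe (L := N) j (p2 t))^-1 * la t).
Proof. by move=> js; exact: (lsec_hol_at (nc_la ncH) I js). Qed.

Lemma p2_near (s : S) (P : Y -> Prop) : (\forall y \near p2 s, P y) -> \forall t \near s, P (p2 t).
Proof. exact: (hol_map_hmap s (nc_map ncH)).1. Qed.

(** Near [s0] two points of one fibre cannot have opposite eigenvalues. Their eigenvalues have the
    same square, so they agree, and [nc_inj] identifies the points. *)
Lemma p2_local_section s0 : la s0 != 0 ->
  exists t : Y -> S, [/\ hmap (p2 s0) t, t (p2 s0) = s0 & \forall y \near p2 s0, p2 (t y) = y].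
Proof.
move=> l0; have [j js] := N_cover (p2 s0).
apply: hmap_local_inverse; first exact: hol_map_hmap (nc_map ncH).
pose q t := (lframe (L := N) j (p2 t))^-1 * la t.
have qh : hol_at s0 q := la_frame_hol js.
have q0 : q s0 != 0 by rewrite mulf_neq0 // invr_eq0 N_neq0.
have nj : \forall t \near s0, fdom (b := N) j (p2 t).
  by apply: p2_near; apply: open_nbhs_nbhs.
(* This disc about [q s0] avoids 0 and contains no two opposite values: their sum would be 0, at
   distance [2 * nm (q s0)] from [2 * q s0]. *)
have nq : \forall t \near s0, nm (q t - q s0) < nm (q s0).
  by apply: (hol_at_near (P := fun z => nm (z - q s0) < nm (q s0)) qh); apply/near_nm;
     exists (nm (q s0)) => //; rewrite nm_gt0.
exists [set t | fdom (b := N) j (p2 t) /\ nm (q t - q s0) < nm (q s0)]; first exact: filterI.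
move=> u v [ju qu] [jv qv] puv.
have lu0 : la u != 0.
  apply/eqP => lu; move: qu; rewrite /q lu mulr0 sub0r nmN ltxx //.
apply: (nc_inj ncH) => //; first by rewrite -la_neq0.
have : la u * la u = la v * la v by rewrite !la_sqr puv.
move/eqP; rewrite -!expr2 eqf_sqr => /orP[/eqP //|/eqP E].
exfalso; have : nm (q u - q s0 + (q v - q s0)) < nm (q s0) + nm (q s0).
  exact: le_lt_trans (nmD _ _) (ltrD qu qv).
have -> : q u - q s0 + (q v - q s0) = - (2 * q s0) by rewrite /q puv E; ring.
rewrite nmN nmM -[2]/(2%:R) -(rmorph_nat (real_complex R)) nm_real ger0_norm //.
lra.
Qed.

Lemma JL_neq0 s : JL s != 0.
Proof.
have [_ _ rk] := el_sub elH; apply/eqP => J0; have := rk s.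
by rewrite J0 mxrank0.
Qed.

Lemma L_bundle : is_bundle L. Proof. by have [] := el_sub elH. Qed.

Lemma hL_gt0 s : la s != 0 -> 0 < hL s.
Proof.
move=> l0; have [HM _] := el_he elH.
have := hm_pos HM (v := 1%:M) (x := s); rewrite ctrmx_scalar conjC1 mul1mx mulmx1 mxE eqxx mulr1n.
by apply; [apply/eqP|exact: oner_neq0].
Qed.

(* [hL] at [s] and at [sg s] have the same curvature because the Kaehler form is
   pulled back from [Y], so their ratio is the square modulus of a holomorphic
   function. *)
Lemma eigenline_ratio s0 (i j : fidx L) : la s0 != 0 -> fdom i s0 -> fdom j (sg s0) ->
  exists f, hol_at s0 f /\ \forall s \near s0, f s != 0 /\
    (hL s * `|lframe i s| ^+ 2) / (hL (sg s) * `|lframe j (sg s)| ^+ 2) = f s * (f s)^*.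
Proof.
move=> l0 is0 js0.
have [HM [gam curv]] := el_he elH.
have [c1 c1s] := dom_cover s0; have [c2 c2s] := dom_cover (sg s0).
have sgl0 : la (sg s0) != 0 by rewrite (nc_sg_la ncH) oppr_eq0.
have nS s : la s != 0 -> ~ [set s | la s = 0] s by move=> /eqP.
have [H1 H1E H1s] := hm_smooth HM (nS _ l0) c1s is0.
have [H2 H2E H2s] := hm_smooth HM (nS _ sgl0) c2s js0.
have hsg s := hol_map_hmap s (nc_sg ncH).
have hp2 s := hol_map_hmap s (nc_map ncH).
pose tau := (fun s => coord c2 (sg s)) \o icoord c1 s0.
have tauh : hol1 tau (coord c1 s0).
  by apply/(hol_at_icoord _ c1s); exact: (hsg s0).2.
have tauE s : dom c1 s -> tau (coord c1 s) = coord c2 (sg s) by move=> cs; rewrite /tau /= icoordK.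
have fmE (k : fidx L) s : frame_metric (fun y => (hL y)%:M) k s 0 0 = hL s * `|lframe k s| ^+ 2.
  by rewrite /frame_metric lframeE ctrmx_scalar -!scalar_mxM mxE eqxx mulr1n normCK; ring.
have [j0 j0s] := N_cover (p2 s0).
have nl : \forall s \near s0, la s != 0.
  have q0 : (lframe (L := N) j0 (p2 s0))^-1 * la s0 != 0 by rewrite mulf_neq0 // invr_eq0 N_neq0.
  by apply: filterS (hol_at_neq0 (la_frame_hol j0s) q0) => s; rewrite mulf_eq0 negb_or => /andP[].
have nd1 := near_dom c1s.
have nd2 : \forall s \near s0, dom c2 (sg s) by apply: (hsg s0).1; exact: near_dom.
have ni := fdom_near L_bundle is0.
have nj : \forall s \near s0, fdom j (sg s) by apply: (hsg s0).1; exact: (fdom_near L_bundle js0).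
have J1 : \forall s \near s0, germ_eq (coord c1) s (frame_metric (fun y => (hL y)%:M) i) H1.
  exact: germ_eqJ.
have J2 : \forall s \near s0, germ_eq (coord c2) (sg s) (frame_metric (fun y => (hL y)%:M) j) H2.
  exact: (hsg s0).1 _ (germ_eqJ H2E).
have nt : \forall s \near s0, hol1 tau (coord c1 s) := near_coord c1s (hol1_near tauh).
pose good s := [/\ la s != 0, dom c1 s, dom c2 (sg s) & [/\ fdom i s, fdom j (sg s),
   germ_eq (coord c1) s (frame_metric (fun y => (hL y)%:M) i) H1,
   germ_eq (coord c2) (sg s) (frame_metric (fun y => (hL y)%:M) j) H2 & hol1 tau (coord c1 s)]].
have ng : \forall s \near s0, good s.
  apply: filterS3 (filterI nl nd1) (filterI nd2 ni) (filterI (filterI nj nt) (filterI J1 J2)).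
  by move=> s [? ?] [? ?] [[? ?] [? ?]].
have pos1 s : good s -> 0 < H1 (coord c1 s) 0 0.
  move=> [ls _ _ [is_ _ /germ_at <- _ _]]; rewrite fmE mulr_gt0 ?hL_gt0 // exprn_gt0 //.
  by rewrite normr_gt0 lframe_neq0 //; exact: L_bundle.
have pos2 s : good s -> 0 < H2 (tau (coord c1 s)) 0 0.
  move=> [ls cs _ [_ js_ _ /germ_at K _]]; rewrite (tauE _ cs) -K fmE mulr_gt0 ?hL_gt0 ?(nc_sg_la ncH) ?oppr_eq0 //.
  by rewrite exprn_gt0 // normr_gt0 lframe_neq0 //; exact: L_bundle.
have pos2' : \forall z \near (tau (coord c1 s0) : R[i]^o), 0 < H2 z 0 0.
  rewrite (tauE _ c1s).
  have K : \forall t \near sg s0, [/\ la t != 0, fdom j t & frame_metric (fun y => (hL y)%:M) j t = H2 (coord c2 t)].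
    have [j1 j1s] := N_cover (p2 (sg s0)).
    have q0 : (lframe (L := N) j1 (p2 (sg s0)))^-1 * la (sg s0) != 0 by rewrite mulf_neq0 // invr_eq0 N_neq0.
    have nl2 := hol_at_neq0 (la_frame_hol j1s) q0.
    apply: filterS3 nl2 (fdom_near L_bundle js0) H2E => t; rewrite mulf_eq0 negb_or => /andP[_ ?] ? ?; by split.
  apply: nearS (near_icoord c2s K) => z [_ e1 [lt jt]]; rewrite e1 => e2.
  by rewrite -e2 fmE mulr_gt0 ?hL_gt0 // exprn_gt0 // normr_gt0 lframe_neq0 //; exact: L_bundle.
have curvE (H : R[i] -> 'M[R[i]]_1) z : chern_curv H z 0 0 =
    wirtbar (fun w => (H w 0 0)^-1 * wirt (fun w => H w 0 0) w) z.
  rewrite mxE; congr (wirtbar _ z); apply/funext => w.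
  by rewrite {1}[H w]mx11E invmx_scalar mul_scalar_mx !mxE.
have [f [fh fP]] : exists f, hol1 f (coord c1 s0) /\ \forall z \near (coord c1 s0 : R[i]^o),
    f z != 0 /\ H1 z 0 0 / H2 (tau z) 0 0 = f z * (f z)^*.
  apply: (@flat_ratio _ (fun z => H1 z 0 0) (fun z => H2 z 0 0) tau).
  - exact: H1s.
  - by rewrite (tauE _ c1s); exact: H2s.
  - exact: tauh.
  - by apply: nearS (near_icoord c1s ng) => z [_ e1 /pos1]; rewrite e1.
  - exact: pos2'.
  apply: nearS (near_icoord c1s ng) => z [_ + g]; move: (icoord c1 s0 z) g => s g <- {z}.
  have [ls cs c2sg [is_ js_ g1 g2 th]] := g.
  have sgl : la (sg s) != 0 by rewrite (nc_sg_la ncH) oppr_eq0.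
  rewrite -!curvE (tauE _ cs) (curv c1 i s H1 (nS _ ls) cs is_ g1) (curv c2 j (sg s) H2 (nS _ sgl) c2sg js_ g2).
  rewrite !mxE !eqxx !mulr1n (nc_sg_p2 ncH).
  (* Both curvatures involve the same chart of [Y] and the same value of [kappa], as [s] and [sg s]
     lie over one point. Since [p2] is invariant under [sg], the chain rule produces exactly the
     factor [|wirt tau|^2] that [flat_ratio] expects. *)
  set G := coord (chart_at (p2 s)).
  have Gh : hol_at (sg s) (fun t => G (p2 t)).
    have gp : dom (chart_at (p2 s)) (p2 (sg s)) by rewrite (nc_sg_p2 ncH) /chart_at; case: cid.
    exact: (hp2 (sg s)).2 gp.
  have D := dcoord_chain cs c2sg (hsg s) Gh.
  have -> : dcoord c1 (fun y' => G (p2 y')) s = dcoord c1 (fun v => G (p2 (sg v))) s.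
    by congr (dcoord _ _ _); apply/funext => v; rewrite (nc_sg_p2 ncH).
  rewrite D.
  have -> : dcoord c1 (fun v => coord c2 (sg v)) s = wirt tau (coord c1 s).
    apply: (dcoordE cs); last exact: hol1_holat th.
    by apply: filterS (near_dom cs) => v cv; rewrite (tauE _ cv).
  by rewrite normrM exprMn; ring.
exists (f \o coord c1); split.
  by apply: (hol_at_comp (g := f)); [exact: hol_at_coord|].
apply: filterS2 ng (near_coord c1s fP) => s [ls cs c2sg [is_ js_ g1 g2 th]] [f0 fE].
split; first exact: f0.
rewrite -fE (tauE _ cs) -(germ_at g1) -(germ_at g2) !fmE.
by [].
Qed.

(** A local section of [p2] brings the two eigenlines down to [Y]. The off-diagonal coordinates in
    the resulting eigenbasis give the form [swap2] and a diagonal metric with entries [|f|^2] and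
    its inverse; multiplying by [diag2 f f^-1] makes the metric standard. *)
Lemma eigen_splitting y0 : (\forall y \near y0, b2 y != 0) ->
  exists C : Y -> 'M[R[i]]_2,
    (forall i, fdom (b := V3) i y0 -> hol_mx y0 (fun y => C y *m frame (b := V3) i y)) /\
    \forall y \near y0, [/\ (J3 y)^T *m w3 y *m J3 y = (C y)^T *m swap2 R *m C y,
      (J3 y)^t* *m h3 y *m J3 y = (C y)^t* *m C y
      & exists nu, C y *m PhiV3 y = diag2 nu (- nu) *m C y].
Proof.
move=> nb; have [s0 ps0 l0] := ex_eigenpoint (nbhs_singleton nb); move: nb; rewrite -{}ps0 => {y0} nb.
have [t [ht t0 pt]] := p2_local_section l0.
have [i is0] := fdom_cover L_bundle s0; have [j js0] := fdom_cover L_bundle (sg s0).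
have [f0 [f0h f0P]] := eigenline_ratio l0 is0 js0.
pose f := f0 \o t; pose y0 := p2 s0.
have hsg s := hol_map_hmap s (nc_sg ncH).
have hst : hmap y0 (sg \o t) by apply: hmap_comp ht _; exact: hsg.
have fh : hol_at y0 f by apply: hmap_hol ht _; rewrite t0.
have tn (Q : S -> Prop) : (\forall s \near s0, Q s) -> \forall y \near y0, Q (t y).
  by rewrite -t0; exact: ht.1.
have sgn (Q : S -> Prop) : (\forall s \near sg s0, Q s) -> \forall s \near s0, Q (sg s).
  exact: (hsg s0).1.
have nl : \forall s \near s0, la s != 0.
  have [j0 j0s] := N_cover (p2 s0).
  have q0 : (lframe (L := N) j0 (p2 s0))^-1 * la s0 != 0 by rewrite mulf_neq0 // invr_eq0 N_neq0.
  by apply: filterS (hol_at_neq0 (la_frame_hol j0s) q0) => s; rewrite mulf_eq0 negb_or => /andP[].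
pose lp y := lframe i (t y); pose lm y := lframe j (sg (t y)).
(* The factors [lp] and [lm] are values of frames of [L]: they turn the columns, known in pointwise
   bases, into holomorphic eigenvectors. *)
pose P y : 'M[R[i]]_2 := row_mx (lp y *: JL (t y)) (lm y *: JL (sg (t y))).
pose good y := [/\ p2 (t y) = y, la (t y) != 0, lp y != 0, lm y != 0 &
  [/\ f y != 0, (hL (t y) * `|lp y| ^+ 2) / (hL (sg (t y)) * `|lm y| ^+ 2) = f y * (f y)^* & b2 y != 0]].
have ng : \forall y \near y0, good y.
  have ni := tn _ (fdom_near L_bundle is0).
  have nj := tn _ (sgn _ (fdom_near L_bundle js0)).
  apply: filterS3 (filterI pt (tn _ nl)) (filterI ni nj) (filterI (tn _ f0P) nb).
  move=> y [e1 e2] [e3 e4] [[e5 e6] e7]; split; [exact: e1|exact: e2| | |by split].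
    exact: lframe_neq0 L_bundle e3.
  exact: lframe_neq0 L_bundle e4.
have eigA y : good y -> Phi' y *m (lp y *: JL (t y)) = la (t y) *: (lp y *: JL (t y)).
  move=> [e1 _ _ _ _]; have := el_eigen elH (t y); rewrite e1 => E.
  by rewrite -scalemxAr E scalerA mulrC -scalerA.
have eigB y : good y -> Phi' y *m (lm y *: JL (sg (t y))) = - la (t y) *: (lm y *: JL (sg (t y))).
  move=> [e1 _ _ _ _]; have := el_eigen elH (sg (t y)).
  rewrite (nc_sg_p2 ncH) e1 (nc_sg_la ncH) => E.
  by rewrite -scalemxAr E scalerA mulrC -scalerA.
have uP y : good y -> P y \in unitmx.
  move=> g; have [e1 e2 e3 e4 _] := g.
  by apply: (eigen_unit e2 _ _ (eigA y g) (eigB y g)); rewrite scaler_eq0 negb_or ?e3 ?e4 JL_neq0.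
have eigP y : good y -> Phi' y *m P y = P y *m diag2 (la (t y)) (- la (t y)).
  by move=> g; rewrite /P row_diag2 mul_row2 (eigA y g) (eigB y g).
have hP y : good y -> (P y)^t* *m h' y *m P y =
    diag2 (hL (t y) * `|lp y| ^+ 2) (hL (sg (t y)) * `|lm y| ^+ 2).
  move=> [e1 e2 _ _ _]; have sl : la (sg (t y)) != 0 by rewrite (nc_sg_la ncH) oppr_eq0.
  have q1 := hL1 e2; have q2 := hL1 sl; have q3 := hL2 e2; have q4 := hL2 sl.
  rewrite (sg_sg e2) in q4; rewrite !(nc_sg_p2 ncH) e1 in q1 q2 q3 q4.
  apply: herm_row; rewrite ctrmxZ -scalemxAl -scalemxAl -scalemxAr scalerA ?q1 ?q2 ?q3 ?q4 ?scaler0 //.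
    by rewrite scale_scalar_mx; congr (_%:M); rewrite normCK; ring.
  by rewrite scale_scalar_mx; congr (_%:M); rewrite normCK; ring.
have JM0 y : JM3 y != 0.
  have [[_ _ rk] _] := ker3; apply/eqP => J0; have := rk y.
  by rewrite J0 mxrank0.
pose Cm y := offmx (P y) (psi y) *m J3 y.
exists (fun y => diag2 (f y) (f y)^-1 *m Cm y); split; last first.
  apply: filterS ng => y g; have [e1 e2 e3 e4 [e5 e6 e7]] := g.
  have [_ JMJ PJ] := perp3; have [_ PJM] := ker3.
  have d10 : hL (t y) * `|lp y| ^+ 2 != 0.
    by rewrite mulf_neq0 ?expf_neq0 ?normr_eq0 // gt_eqF // hL_gt0.
  have d20 : hL (sg (t y)) * `|lm y| ^+ 2 != 0.
    by rewrite mulf_neq0 ?expf_neq0 ?normr_eq0 // gt_eqF // hL_gt0 // (nc_sg_la ncH) oppr_eq0.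
  split.
  - rewrite (fibre_form (ad_psi_tr adH y) (ad_psi_form adH y) (w3u y) (ad_psi_phi adH y)
      (uP y g) e2 (eigP y g) (JM0 y) (PJM y) (JMJ y)) -/(Cm y).
    by rewrite swap2_absorb.
  - rewrite (fibre_herm (ad_psi_tr adH y) (ad_psi_form adH y) (w3u y) (ad_psi_phi adH y)
      (fun k l => h3E k l e7) (uP y g) e2 (eigP y g) d10 d20 (hP y g) (JM0 y) (PJM y) (JMJ y)) -/(Cm y).
    by rewrite (diag2_absorb _ e6).
  exists (2 * la (t y)).
  rewrite -mulmxA (fibre_phi (ad_psi_tr adH y) (ad_psi_form adH y) (w3u y) (ad_psi_phi adH y)
      (uP y g) e2 (eigP y g) (JM0 y) (PJM y) (JMJ y) (PJ y)) -/(Cm y).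
  by rewrite !mulmxA diag2_comm.
move=> k ky0.
have [l ly0] := fdom_cover E3_bundle y0; have [m my0] := fdom_cover (ad_bundle adH) y0.
have [[_ J3h _] _ _] := perp3.
have J3f := hom_hol_at J3h I ky0 ly0.
have uF3 : \forall y \near y0, frame (b := E3) l y \in unitmx.
  by apply: filterS (fdom_near E3_bundle ly0) => y; exact: frame_unit.
have uF' : \forall y \near y0, frame (b := E') m y \in unitmx.
  by apply: filterS (fdom_near (ad_bundle adH) my0) => y; exact: (frame_unit (ad_bundle adH)).
have [_ JLh _] := el_sub elH.
have colh (u : Y -> S) (s1 : S) (q : fidx L) : hmap y0 u -> u y0 = s1 -> fdom q s1 -> p2 s1 = y0 ->
    (\forall y \near y0, p2 (u y) = y) ->
    hol_mx y0 (fun y => invmx (frame (b := E') m y) *m (lframe q (u y) *: JL (u y))).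
  move=> hu us1 qs ps pu.
  have m1 : fdom (b := pull p2 E') m s1 by rewrite /= ps.
  have H := hom_hol_at JLh I qs m1.
  rewrite -us1 in H; have := hmap_hol_mx hu H; apply: hol_mx_ext.
  by apply: filterS pu => y /= ->; rewrite lframeE mul_mx_scalar -scalemxAr.
pose Pj y : 'M[R[i]]_2 := invmx (frame (b := E') m y) *m P y.
have Pjh : hol_mx y0 Pj.
  have h1 := colh t s0 i ht t0 is0 erefl pt.
  have h2 := colh (sg \o t) (sg s0) j hst _ js0 (nc_sg_p2 ncH s0) _.
  have {}h2 : hol_mx y0 (fun y => invmx (frame (b := E') m y) *m (lm y *: JL (sg (t y)))).
    apply: h2; first by rewrite /= t0.
    by apply: filterS pt => y e; rewrite /= (nc_sg_p2 ncH).
  have E : Pj = fun y => row_mx (invmx (frame (b := E') m y) *m (lp y *: JL (t y)))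
     (invmx (frame (b := E') m y) *m (lm y *: JL (sg (t y)))) :> 'M[R[i]]_2.
    by apply/funext => y; rewrite /Pj /P mul_row2.
  rewrite E => a b; move: b; apply: ord2P.
    by under eq_fun do rewrite row2E0; exact: h1.
  by under eq_fun do rewrite row2E1; exact: h2.
have uPj : Pj y0 \in unitmx.
  rewrite unitmx_mul unitmx_inv (nbhs_singleton uF').
  exact: uP (nbhs_singleton ng).
(* The pointwise basis of [E'] cancels: conjugating by [P] is the same as conjugating the matrix
   [Mh] in the frame [m] by the matrix [Pj] of [P] in that frame, and both of these are
   holomorphic. *)
pose Mh q y : 'M[R[i]]_2 := invmx (frame (b := E') m y) *m
  lin_app (psi y) (col q (frame (b := E3) l y)) *m frame (b := E') m y.
have Mhh q : hol_mx y0 (Mh q).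
  by move=> a b; have /hol_onP := ad_psi_hol adH (i := l) (j := m) q a b; apply.
have offh : hol_mx y0 (fun y => offmx (P y) (psi y) *m frame (b := E3) l y).
  move=> b q; have H := hol_mxM (hol_mxM (hol_mxV Pjh uPj) (Mhh q)) Pjh.
  apply: (@hol_at_ext _ _ _ (fun y => offd b (invmx (Pj y) *m Mh q y *m Pj y))).
    apply: filterS2 ng uF' => y g u'; rewrite offmx_mul; congr (offd b _).
    rewrite /conj_by /Pj /Mh invmxM ?unitmx_inv ?(uP y g) // invmxK.
    rewrite !mulmxA mulmxK //; rewrite -!mulmxA; congr (_ *m _).
    by rewrite mulKVmx // mulKVmx.
  by rewrite /offd; case: (b == 0); exact: H.
have Dh : hol_mx y0 (fun y => diag2 (f y) (f y)^-1).
  have f1 : f y0 != 0 by have [_ _ _ _ []] := nbhs_singleton ng.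
  have fVh := hol_atV fh f1.
  move=> a b; rewrite /diag2; under eq_fun do rewrite mxE.
  case: (a == b); last exact: hol_at_cst.
  by case: (a == 0).
have := hol_mxM Dh (hol_mxM offh J3f); apply: hol_mx_ext.
apply: filterS uF3 => y u3; rewrite /Cm -!mulmxA; congr (_ *m (_ *m _)).
by rewrite mulKVmx.
Qed.

End EigenSplitting.

(** * The pushforward metric *)

Section LocalGram.
Variables (R : realType) (X : surface R) (m : nat) (E : bundle X m)
  (Phi w : X -> 'M[R[i]]_m) (S : set X) (h : X -> 'M[R[i]]_m).

Lemma gram_gt0 (Q : 'M[R[i]]_m) (v : 'cV[R[i]]_m) : Q \in unitmx -> v != 0 ->
  0 < (v^t* *m (Q^t* *m Q) *m v) 0 0.
Proof.
move=> uQ v0; have -> : v^t* *m (Q^t* *m Q) *m v = (Q *m v)^t* *m (Q *m v).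
  by rewrite ctrmx_mul !mulmxA.
have : Q *m v != 0.
  by apply: contra_neq v0 => Qv; rewrite -[v](mulKmx uQ) Qv mulmx0.
move: (Q *m v) => u u0; rewrite mxE.
have [k uk] : exists k, u k 0 != 0.
  apply: contrapT => H; move/eqP: u0; apply; apply/colP => k; rewrite mxE.
  by apply: contrapT => /eqP uk; apply: H; exists k.
rewrite (bigD1 k) //= ltr_pwDl //.
  by rewrite !mxE mulJE ltcR exprn_gt0 // nm_gt0.
by rewrite sumr_ge0 // => l _; rewrite !mxE mulJE ler0c exprn_ge0 // nm_ge0.
Qed.

(** Smoothness and flatness concern germs, so the factorisation is asked near [x0]; compatibility
    and normality are pointwise and are asked at [x0]. In the basis given by [Q] the metric is
    standard, so the adjoint of [La] is its conjugate transpose. *)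
Lemma solution_of_local_gram : is_bundle E ->
  (forall x0, ~ S x0 -> exists Q : X -> 'M[R[i]]_m,
    [/\ forall i, fdom (b := E) i x0 -> hol_mx x0 (fun x => Q x *m frame (b := E) i x),
        \forall x \near x0, h x = (Q x)^t* *m Q x, Q x0 \in unitmx, compatible (w x0) (h x0)
      & exists2 La, Q x0 *m Phi x0 = La *m Q x0 & La *m La^t* = La^t* *m La]) ->
  decoupled_solution E Phi w S h.
Proof.
move=> HE loc; split.
- split=> [x Sx|x v Sx v0|c i x Sx cx ix].
  + have [Q [_ /nbhs_singleton -> _ _ _]] := loc x Sx.
    by rewrite ctrmx_mul ctrmxK.
  + have [Q [_ /nbhs_singleton -> uQ _ _]] := loc x Sx; exact: gram_gt0.
  have [Q [Qh Qn _ _ _]] := loc x Sx.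
  pose A z := Q (icoord c x z) *m frame (b := E) i (icoord c x z).
  exists (fun z => (A z)^t* *m A z).
    apply: filterS2 Qn (near_dom cx) => y Qy cy; rewrite /A icoordK //.
    by rewrite /frame_metric Qy ctrmx_mul !mulmxA.
  by move=> k l; apply: gram_smooth => a b; apply/(hol_at_icoord (fun y => (Q y *m frame (b := E) i y) a b) cx); exact: Qh.
- by move=> x Sx; have [Q [_ _ _ ? _]] := loc x Sx.
- move=> c i x H Sx cx ix HE'.
  have [Q [Qh Qn uQ _ _]] := loc x Sx.
  pose A z := Q (icoord c x z) *m frame (b := E) i (icoord c x z).
  apply: (@gram_flat _ _ A).
  + by move=> a b; apply/(hol_at_icoord (fun y => (Q y *m frame (b := E) i y) a b) cx); exact: Qh.
  + by rewrite /A icoordK // unitmx_mul uQ; exact: frame_unit ix.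
  apply: nearS (near_icoord cx (filterI HE' Qn)) => z [_ e [e1 e2]].
  by rewrite e in e1; rewrite -e1 /frame_metric e2 /A ctrmx_mul !mulmxA.
move=> x Sx; have [Q [_ /nbhs_singleton -> uQ _ [La QPhi nLa]]] := loc x Sx.
have uQt : (Q x)^t* \in unitmx by rewrite ctrmx_unit.
have PE : Phi x = invmx (Q x) *m La *m Q x by rewrite -mulmxA -QPhi mulKmx.
have mE : madj ((Q x)^t* *m Q x) (Phi x) = invmx (Q x) *m La^t* *m Q x.
  rewrite /madj invmxM // PE !ctrmx_mul ctrmx_inv -!mulmxA; congr (_ *m _).
  by rewrite !mulKmx.
have cj L1 L2 : (invmx (Q x) *m L1 *m Q x) *m (invmx (Q x) *m L2 *m Q x) =
    invmx (Q x) *m (L1 *m L2) *m Q x by rewrite -!mulmxA mulKVmx.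
by rewrite mE PE !cj nLa.
Qed.

End LocalGram.

(** * Joining the kernel and its orthogonal complement *)

Section Assemble.
Variables (R : realType) (m : nat).
Notation C := R[i].
Variables (v : 'cV[C]_(1 + m)) (J : 'M[C]_(1 + m, m)) (w : 'M[C]_(1 + m)) (rho : C).
Let B := row_mx v J.
Let a := (v^T *m w *m v) 0 0.
Hypotheses (uB : B \in unitmx) (ws : w^T = w) (vJ : v^T *m w *m J = 0) (rhoa : rho * rho * a = 1).

(** In the basis [B] this is block diagonal with blocks [rho * a] and [A]. As [rho] is an inverse
    square root of [a = w(v, v)], the first block has square [a] and squared modulus [|a|], so the
    same row represents both the form and the metric on the kernel. *)
Definition assemble (A : 'M[C]_m) : 'M[C]_(1 + m) :=
  col_mx (rho *: (v^T *m w)) (A *m dsubmx (invmx B)).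

Lemma assemble_basis A : assemble A *m B = block_mx (rho * a)%:M 0 0 A.
Proof.
rewrite /assemble /B mul_col_row -!scalemxAl vJ scaler0.
rewrite [v^T *m w *m v]mx11_scalar -/a scale_scalar_mx.
have : invmx B *m row_mx v J = 1%:M by rewrite mulVmx.
rewrite -{1}[invmx B]vsubmxK mul_col_row (scalar_mx_block 1 m) => /eq_block_mx [_ _ e1 e2].
by rewrite -!mulmxA e1 e2 mulmx0 mulmx1.
Qed.

Lemma assemble_herm A : (assemble A)^t* *m assemble A =
  (invmx B)^t* *m block_mx `|a|%:M 0 0 (A^t* *m A) *m invmx B.
Proof.
have -> : assemble A = block_mx (rho * a)%:M 0 0 A *m invmx B.
  by rewrite -assemble_basis mulmxK.
rewrite ctrmx_mul !mulmxA; congr (_ *m _); rewrite -!mulmxA; congr (_ *m _).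
rewrite tr_block_mx map_block_mx !trmx0 !map_mx0 mulmx_block !mulmx0 !mul0mx !addr0 add0r.
rewrite tr_scalar_mx map_scalar_mx -scalar_mxM; congr (block_mx _%:M _ _ _).
have a0 : a != 0 by apply/eqP => a0; move/eqP: rhoa; rewrite a0 mulr0 eq_sym oner_eq0.
have n1 : `|rho| * `|rho| * `|a| = 1 by rewrite -!normrM rhoa normr1.
rewrite [_ * _](_ : _ = `|rho * a| ^+ 2); last by rewrite normCK mulrC.
have -> : `|rho * a| ^+ 2 = `|rho| * `|rho| * `|a| * `|a| by rewrite normrM; ring.
by rewrite n1 mul1r.
Qed.

Lemma assemble_form A : A^T *m A = J^T *m w *m J -> (assemble A)^T *m assemble A = w.
Proof.
move=> AA.
have E : (assemble A *m B)^T *m (assemble A *m B) = B^T *m w *m B.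
  rewrite assemble_basis tr_block_mx !trmx0 mulmx_block !mulmx0 !mul0mx !addr0 add0r AA.
  rewrite tr_scalar_mx -scalar_mxM /B tr_row_mx mul_col_mx mul_col_row vJ.
  have -> : J^T *m w *m v = 0.
    by apply: trmx_inj; rewrite !trmx_mul trmxK ws mulmxA vJ trmx0.
  rewrite [v^T *m w *m v]mx11_scalar -/a; congr (block_mx _%:M _ _ _).
  by rewrite mulrACA mulrA rhoa mul1r.
have uBt : B^T \in unitmx by rewrite unitmx_tr.
have := congr1 (fun M => invmx B^T *m M *m invmx B) E.
by rewrite trmx_mul !mulmxA !mulVmx // !mul1mx !mulmxK.
Qed.

Lemma assemble_unit A : A \in unitmx -> assemble A \in unitmx.
Proof.
move=> uA; have : assemble A *m B \in unitmx.
  rewrite assemble_basis unitmxE det_ublock det_scalar1 unitrM -unitmxE uA andbT unitfE.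
  by apply: contraTneq (oner_neq0 C) => ra; rewrite -rhoa -mulrA ra mulr0 eqxx.
by rewrite unitmx_mul => /andP[].
Qed.

Lemma assemble_eigen A (Phi : 'M[C]_(1 + m)) (PhiV La : 'M[C]_m) :
  Phi *m v = 0 -> Phi *m J = J *m PhiV -> A *m PhiV = La *m A ->
  assemble A *m Phi = block_mx 0 0 0 La *m assemble A.
Proof.
move=> Pv PJ AP.
have PB : Phi *m B = B *m block_mx 0 0 0 PhiV.
  by rewrite /B mul_mx_row Pv PJ mul_row_block !mulmx0 addr0 add0r.
have E : assemble A *m Phi *m B = block_mx 0 0 0 La *m assemble A *m B.
  rewrite -mulmxA PB mulmxA assemble_basis -mulmxA assemble_basis !mulmx_block.
  by rewrite !mulmx0 !mul0mx !addr0 !add0r AP.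
by rewrite -[LHS](mulmxK uB) E mulmxK.
Qed.

End Assemble.

(** * Stacking the rows of the sheets *)

Section Stack.
Variables (R : realType) (n : nat).
Notation C := R[i].

(** [mxvec] provides the bijection of ['I_(2 * n)] with pairs of a row [b] and a sheet [k], so that
    Gram matrices of stacks are sums over sheets. *)
Definition stack (m : nat) (D : 'I_n -> 'M[C]_(2, m)) : 'M[C]_(2 * n, m) :=
  \matrix_(i, j) mxvec (\matrix_(b < 2, k < n) D k b j) 0 i.

Lemma stackE m (D : 'I_n -> 'M[C]_(2, m)) b k j : stack D (mxvec_index b k) j = D k b j.
Proof. by rewrite mxE mxvecE mxE. Qed.

Lemma sum_stack (G : 'I_(2 * n) -> C) : \sum_i G i = \sum_k \sum_b G (mxvec_index b k).
Proof.
rewrite exchange_big pair_big (reindex _ (curry_mxvec_bij 2 n)) /=.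
by apply: eq_bigr => -[b k] _.
Qed.

Lemma stack_ind (P : 'I_(2 * n) -> Prop) : (forall b k, P (mxvec_index b k)) -> forall i, P i.
Proof. by move=> H i; case/mxvec_indexP: i. Qed.

Lemma ctrmxE m p (A : 'M[C]_(m, p)) i j : (A^t*) i j = (A j i)^*.
Proof. by rewrite !mxE. Qed.

Lemma trmxE m p (A : 'M[C]_(m, p)) i j : A^T i j = A j i.
Proof. by rewrite mxE. Qed.

Lemma stack_herm m (D : 'I_n -> 'M[C]_(2, m)) :
  (stack D)^t* *m stack D = \sum_k (D k)^t* *m D k.
Proof.
apply/matrixP => i j; rewrite summxE mxE sum_stack; apply: eq_bigr => k _.
by rewrite mxE; apply: eq_bigr => b _; rewrite !ctrmxE !stackE.
Qed.

Lemma stack_tr m (D : 'I_n -> 'M[C]_(2, m)) :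
  (stack D)^T *m stack D = \sum_k (D k)^T *m D k.
Proof.
apply/matrixP => i j; rewrite summxE mxE sum_stack; apply: eq_bigr => k _.
by rewrite mxE; apply: eq_bigr => b _; rewrite !trmxE !stackE.
Qed.

Lemma stack_mul m p (D : 'I_n -> 'M[C]_(2, m)) (M : 'M[C]_(m, p)) :
  stack D *m M = stack (fun k => D k *m M).
Proof.
apply/matrixP => i j; move: i; apply: stack_ind => b k; rewrite stackE !mxE.
by apply: eq_bigr => l _; rewrite stackE.
Qed.

Lemma stack_eigen m (D : 'I_n -> 'M[C]_(2, m)) (M : 'M[C]_m) (nu : 'I_n -> C) :
  (forall k, D k *m M = diag2 (nu k) (- nu k) *m D k) ->
  exists u : 'rV_(2 * n), stack D *m M = diag_mx u *m stack D.
Proof.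
move=> H; exists (mxvec (\matrix_(b < 2, k < n) if b == 0 then nu k else - nu k)).
rewrite stack_mul; apply/matrixP => i j; move: i; apply: stack_ind => b k.
rewrite stackE H mul_diag_mx [RHS]mxE stackE mxvecE [in RHS]mxE.
by have [e0 e1] := diag2_mulE (nu k) (- nu k) (D k) j; move: b; apply: ord2P; rewrite /= ?e0 ?e1.
Qed.

(** The unitary passage from [(x, y)] to [(x + y) / sqrt 2] and ['i (x - y) / sqrt 2], whose squares
    add up to [2 x y], the quadratic form of [swap2]. *)
Definition rot2 : 'M[C]_2 := \matrix_(i, j)
  ((Num.sqrt 2)^-1%:C * (if i == 0 then 1 else if j == 0 then 'i else - 'i)).

Lemma rot2_form : rot2^T *m rot2 = swap2 R.
Proof.
have i2 : 'i * 'i = -1 :> C by rewrite -expr2 sqrCi.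
have s2 : (Num.sqrt 2)^-1%:C * (Num.sqrt 2)^-1%:C = 2^-1 :> C.
  rewrite -rmorphM -invfM -expr2 sqr_sqrtr // fmorphV; congr (_^-1).
  exact: (rmorph_nat (real_complex R) 2).
apply/matrixP => i j; rewrite !mxE sum2 !mxE; move: i j.
have E (x y : C) : (Num.sqrt 2)^-1%:C * x * ((Num.sqrt 2)^-1%:C * y) = 2^-1 * (x * y).
  by rewrite mulrACA s2.
by apply: ord2P; apply: ord2P; rewrite /= !E ?mulrN ?mulNr ?i2; field.
Qed.

Lemma rot2_herm : rot2^t* *m rot2 = 1%:M.
Proof.
have i2 : 'i * 'i = -1 :> C by rewrite -expr2 sqrCi.
have iJ : ('i : C)^* = - 'i by apply: eqC; rewrite !ReImE ?oppr0.
have s2 : (Num.sqrt 2)^-1%:C * (Num.sqrt 2)^-1%:C = 2^-1 :> C.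
  rewrite -rmorphM -invfM -expr2 sqr_sqrtr // fmorphV; congr (_^-1).
  exact: (rmorph_nat (real_complex R) 2).
apply/matrixP => i j; rewrite !mxE sum2 !mxE; move: i j.
have E (x y : C) : ((Num.sqrt 2)^-1%:C * x)^* * ((Num.sqrt 2)^-1%:C * y) = 2^-1 * (x^* * y).
  by rewrite cjM conj_real mulrACA s2.
by apply: ord2P; apply: ord2P; rewrite /= !E ?cjE ?iJ ?mulrN ?mulNr ?opprK ?i2 ?mul1r ?mulr1; field.
Qed.

End Stack.

Section Frames.
Variable R : realType.
Implicit Types (X Y : surface R).

Lemma lframe_lpow X (L : bundle X 1) k (i : fidx L) x :
  lframe (L := lpow L k) i x = lframe i x ^+ k.
Proof. by rewrite {1}/lframe /= mxE eqxx mulr1n. Qed.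

Lemma canonical_neq0 X (c : chart X) (x : X) : dom c x -> lframe (L := canonical X) c x != 0.
Proof.
move=> cx; rewrite /lframe /= mxE eqxx mulr1n; apply: dcoord_neq0 => //.
by rewrite /chart_at; case: cid.
Qed.

Lemma punctured_eq Y (y : Y) f g : hol_at y f -> hol_at y g ->
  (\forall v \near y^', f v = g v) -> f y = g y.
Proof.
move=> fh gh E; apply/eqP; rewrite -subr_eq0; apply/negPn/negP => n0.
have H := hol_at_neq0 (hol_atD fh (hol_atN gh)) n0.
have PF := dnbhs_proper y.
have H' : \forall v \near y^', f v - g v != 0 by apply: cvg_within.
have [v [e1]] := filter_ex (filterI E H').
by rewrite e1 subrr eqxx.
Qed.

Lemma hol_atX Y (y : Y) f k : hol_at y f -> hol_at y (fun v => f v ^+ k).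
Proof.
move=> fh; elim: k => [|k IH]; first exact: hol_at_cst.
by under eq_fun do rewrite exprS; exact: hol_atM.
Qed.

(** Both signs of [k] are excluded by continuity at [y]: a positive power forces [f y = 0], and a
    negative one, moved to the other side, forces [B y = 0]. *)
Lemma order_eq0 Y (y : Y) f k : hol_at y f -> f y != 0 -> lsec_ord (triv Y 1) f y k -> k = 0.
Proof.
move=> fh f0 [c [U [B [[cy oU Uy Bh By] fB]]]].
have bh : hol_at y (fun v => B v 0 0).
  have := @hom_hol_at _ _ _ _ (triv Y 1) (triv Y 1) U B tt tt y Bh Uy I I 0 0.
  by under eq_fun do rewrite /= mulmx1 invmx1 mul1mx.
have b0 : B y 0 0 != 0.
  by apply: contra_neq By => b0; rewrite [B y]mx11E b0 raddf0.
have uh : hol_at y (fun v => coord c v - coord c y).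
  by apply: hol_atD; [exact: hol_at_coord|exact: hol_at_cst].
have E : \forall v \near y^', f v = (coord c v - coord c y) ^ k * B v 0 0.
  apply: filterS fB => v /(congr1 (fun A : 'M[R[i]]_1 => A 0 0)).
  by rewrite !mxE eqxx mulr1n.
case: k fB E => [[|k]|k] // _ E.
  have gh := hol_atM (hol_atX k.+1 uh) bh.
  have := punctured_eq fh gh E; rewrite subrr expr0n mul0r => f00.
  by rewrite f00 eqxx in f0.
have gh := hol_atM (hol_atX k.+1 uh) fh.
have := punctured_eq gh bh _; rewrite subrr expr0n mul0r => H.
have /esym b00 : 0 = B y 0 0.
  apply: H; apply: (near_dnbhs_coord cy).
  have E' : nbhs y (fun v => v != y -> f v = (coord c v - coord c y) ^ Negz k * B v 0 0) := E.
  apply: filterS E' => v Ev cv.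
  have vy : v != y by apply: contra_neq cv => ->.
  have u0 : (coord c v - coord c y) ^+ k.+1 != 0 by rewrite expf_neq0 // subr_eq0.
  by rewrite (Ev vy) /= mulrA mulfV ?mul1r.
by rewrite b00 eqxx in b0.
Qed.

End Frames.

(** * Fibres of the quotient curve and its ramification section *)

Section SpectralCurve.
Variables (R : realType) (X : surface R) (n : nat).
Variables (Phi : X -> 'M[R[i]]_(1 + 2 * n)) (Y : surface R) (pi : Y -> X) (eta delta : Y -> R[i]).
Let K := canonical X.
Let quot := fun x => quot_poly (Phi x).
Hypothesis (Hpi : is_curve_of (lpow K 2) quot pi eta).
Hypothesis (Hdelta : ramification_section pi (pull pi (lpow K (2 * n.-1))) delta).

Lemma pi_hmap y : hmap y pi. Proof. exact: hol_map_hmap (curve_map Hpi). Qed.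

Lemma spec0E x : (spec_poly (Phi x))`_0 = (char_poly (Phi x))`_1.
Proof. by rewrite /spec_poly coef_poly. Qed.

Lemma quot_root y : root (quot (pi y)) (eta y).
Proof.
have /seteqP [H _] := curve_range Hpi; apply/eqP.
by apply: (H (pi y, eta y)); exists y.
Qed.

Lemma quot_neq0 x : quot x != 0.
Proof.
apply/eqP => q0; have : (quot x)`_n = 1.
  rewrite /quot /quot_poly coef_poly ltnSn /spec_poly coef_poly ltnSn.
  have := char_poly_monic (Phi x); rewrite monicE lead_coefE size_char_poly => /eqP.
  by [].
by rewrite q0 coef0 => /eqP; rewrite eq_sym oner_eq0.
Qed.

(** The points of a fibre are told apart by [eta], whose values are roots of a non-zero polynomial
    of degree at most [n]. *)
Lemma fibre_le x (s : seq Y) : uniq s -> (forall y, y \in s -> pi y = x) -> (size s <= n)%N.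
Proof.
move=> us sx; have q0 := quot_neq0 x.
have us' : uniq [seq eta y | y <- s].
  rewrite map_inj_in_uniq // => u v us_ vs E; apply: (curve_inj Hpi).
  by rewrite /= (sx _ us_) (sx _ vs) E.
have rs : all (root (quot x)) [seq eta y | y <- s].
  by apply/allP => _ /mapP [y ys ->]; rewrite -(sx _ ys) quot_root.
have := max_poly_roots q0 rs us'; rewrite size_map => H.
by have := leq_trans H (size_poly _ _); rewrite ltnS.
Qed.

Lemma eta_neq0 y : (spec_poly (Phi (pi y)))`_0 != 0 -> eta y != 0.
Proof.
move=> a0; apply/eqP => e0; have := quot_root y; rewrite e0 /root horner_coef0.
by rewrite /quot /quot_poly coef_poly /= muln0 (negbTE a0).
Qed.

Lemma b2_near y : (spec_poly (Phi (pi y)))`_0 != 0 -> \forall v \near y, - eta v != 0.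
Proof.
move=> /eta_neq0 e0; have [c cy] := dom_cover (pi y).
have H := lsec_hol_at (L := pull pi (lpow K 2)) (i := c) (curve_taut Hpi) I cy.
have n0 : (lframe (L := pull pi (lpow K 2)) c y)^-1 * eta y != 0.
  by rewrite mulf_neq0 // invr_eq0 [lframe _ _](lframe_lpow) expf_neq0 // canonical_neq0.
by apply: filterS (hol_at_neq0 H n0) => v; rewrite mulf_eq0 negb_or oppr_eq0 => /andP[].
Qed.

Lemma unramified y (e : chart Y) (c : chart X) : ~ branch_set pi (pi y) -> dom e y -> dom c (pi y) ->
  dcoord e (fun v => coord c (pi v)) y != 0.
Proof. by move=> nb ey cy; apply/eqP => d0; apply: nb; exists y, e, c. Qed.

Lemma delta_hol y c : dom c (pi y) ->
  hol_at y (fun v => (lframe (L := K) c (pi v) ^+ (2 * n.-1))^-1 * delta v).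
Proof.
move=> cy; have := lsec_hol_at (L := pull pi (lpow K (2 * n.-1))) (i := c) Hdelta.1 I cy.
by under eq_fun do rewrite [lframe _ _](lframe_lpow).
Qed.

(** Off the branch points the derivative of [pi] in charts does not vanish, so its order is 0, and
    [delta] has the same order by definition of the ramification section. *)
Lemma delta_neq0 y : ~ branch_set pi (pi y) -> delta y != 0.
Proof.
move=> nb; have [e ey] := dom_cover y; have [c cy] := dom_cover (pi y).
have [k dk ck] := Hdelta.2 y e c ey cy.
have ch : hol_at y (dcoord e (fun v => coord c (pi v))).
  by apply: hol_at_dcoord => //; exact: (pi_hmap y).2.
have k0 := order_eq0 ch (unramified nb ey cy) ck; subst k.
have [c' [U [B [[c'y oU Uy Bh By] dB]]]] := dk.
pose L := pull pi (lpow K (2 * n.-1)).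
have l0 : lframe (L := L) c y != 0 by rewrite [lframe _ _](lframe_lpow) expf_neq0 // canonical_neq0.
have bh : hol_at y (fun v => (lframe (L := L) c v)^-1 * B v 0 0).
  have Eb v : invmx (frame (b := L) c v) *m B v *m frame (b := triv Y 1) tt v =
      (lframe (L := L) c v)^-1 *: B v.
    by rewrite (lframeE (L := L)) invmx_scalar mul_scalar_mx; exact: mulmx1.
  have := @hom_hol_at _ _ _ _ (triv Y 1) L U B tt c y Bh Uy I cy 0 0.
  by under eq_fun do rewrite Eb mxE.
have dh := lsec_hol_at (L := L) (i := c) Hdelta.1 I cy.
have := punctured_eq dh bh _ => H.
have : (lframe (L := L) c y)^-1 * delta y = (lframe (L := L) c y)^-1 * B y 0 0.
  apply: H; apply: filterS dB => v /(congr1 (fun A : 'M[R[i]]_1 => A 0 0)).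
  by rewrite expr0z scale1r mxE eqxx mulr1n => ->.
move=> /(mulfI (invr_neq0 l0)) ->.
by apply: contra_neq By => b0; rewrite [B y]mx11E b0 raddf0.
Qed.

End SpectralCurve.

(** * The two rows contributed by one sheet *)

Section FibreBlock.
Variables (R : realType) (X : surface R) (n : nat).
Variables (Phi : X -> 'M[R[i]]_(1 + 2 * n)) (Y : surface R) (pi : Y -> X) (eta delta : Y -> R[i]).
Let K := canonical X.
Let quot := fun x => quot_poly (Phi x).
Hypothesis (Hpi : is_curve_of (lpow K 2) quot pi eta).
Hypothesis (Hdelta : ramification_section pi (pull pi (lpow K (2 * n.-1))) delta).
Variables (w : X -> 'M[R[i]]_(1 + 2 * n)) (E3 : bundle Y (1 + 2)) (Phi3 w3 h3 : Y -> 'M[R[i]]_(1 + 2))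
  (V : bundle X (2 * n)) (J : X -> 'M[R[i]]_(1 + 2 * n, 2 * n))
  (PhiV : X -> 'M[R[i]]_(2 * n))
  (M3 : bundle Y 1) (JM3 : Y -> 'M[R[i]]_(1 + 2, 1))
  (V3 : bundle Y 2) (J3 : Y -> 'M[R[i]]_(1 + 2, 2)) (PhiV3 : Y -> 'M[R[i]]_2)
  (T : Y -> 'M[R[i]]_(2, 2 * n)).
Hypotheses (H3 : so_higgs (pull pi K) E3 Phi3 w3)
  (cp3 : forall y, char_poly (Phi3 y) = 'X * ('X ^+ 2 + (- eta y)%:P))
  (ker3 : is_kernel E3 Phi3 M3 JM3) (perp3 : is_perp E3 Phi3 w3 JM3 V3 J3 PhiV3)
  (pc : push_corr pi delta w V J PhiV w3 V3 J3 PhiV3 T)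
  (ih3 : is_h3 (pull pi K) E3 Phi3 w3 (fun y => - eta y) h3).

Lemma E3_splitting y : (spec_poly (Phi (pi y)))`_0 != 0 ->
  exists C : Y -> 'M[R[i]]_2,
    (forall i, fdom (b := V3) i y -> hol_mx y (fun v => C v *m frame (b := V3) i v)) /\
    \forall v \near y, [/\ (J3 v)^T *m w3 v *m J3 v = (C v)^T *m swap2 R *m C v,
      (J3 v)^t* *m h3 v *m J3 v = (C v)^t* *m C v
      & exists nu, C v *m PhiV3 v = diag2 nu (- nu) *m C v].
Proof.
move=> a0.
have [E' [Phi' [psi [OD [sD [kappa [hdet [S [p2 [la [sg [L [JL [hL [h' [[adH _ _ ncH elH] [hL1 hL2 h3E]]]]]]]]]]]]]]]]] := ih3.
have piC : continuous pi by have [] := curve_map Hpi.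
apply: (eigen_splitting (N := pull pi K) _ _ _ (so_bundle H3) (so_form_nondeg H3) cp3 ker3 perp3 adH ncH elH hL1 hL2 h3E).
- by move=> c; have /continuousP := piC; apply; exact: dom_open.
- by move=> v; exact: dom_cover.
- by move=> c v cv; exact: canonical_neq0.
exact: (b2_near Hpi (y:=y) a0).
Qed.

Lemma invmxZ m (a : R[i]) (A : 'M[R[i]]_m) : a != 0 -> A \in unitmx -> invmx (a *: A) = a^-1 *: invmx A.
Proof.
by move=> a0 uA; apply: invmx_uniq; rewrite -scalemxAr -scalemxAl scalerA mulmxV // mulVf // scale1r.
Qed.

Lemma trmxZ m p (a : R[i]) (A : 'M[R[i]]_(m, p)) : (a *: A)^T = a *: A^T.
Proof. exact: linearZ. Qed.

Lemma frame_cancel m p (C F : 'M[R[i]]_m) (U : 'M[R[i]]_(m, p)) (G : 'M[R[i]]_p) (a q : R[i]) :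
  a != 0 -> F \in unitmx ->
  q^-1 *: (C *m F *m (invmx (a *: F) *m U *m G)) = (a * q)^-1 *: (C *m U) *m G.
Proof.
move=> a0 uF; rewrite invmxZ // -!scalemxAl -!scalemxAr scalerA [in RHS]mulrC invfM; congr (_ *: _).
by rewrite -!mulmxA mulKVmx.
Qed.

(** One scalar [e] with [e * e = 1 / delta] serves both structures: the form is multiplied by [e^2],
    the metric by [|e|^2 = 1 / |delta|]. *)
Lemma fibre_block y : (spec_poly (Phi (pi y)))`_0 != 0 -> ~ branch_set pi (pi y) ->
  exists D : Y -> 'M[R[i]]_(2, 2 * n),
    (forall i, fdom (b := V) i (pi y) -> hol_mx y (fun v => D v *m frame (b := V) i (pi v))) /\
    \forall v \near y,
     [/\ (T v)^T *m ((delta v)^-1 *: ((J3 v)^T *m w3 v *m J3 v)) *m T v = (D v)^T *m swap2 R *m D v,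
         (T v)^t* *m (`|delta v|^-1 *: ((J3 v)^t* *m h3 v *m J3 v)) *m T v = (D v)^t* *m D v
      & exists nu, D v *m PhiV (pi v) = diag2 nu (- nu) *m D v].
Proof.
move=> a0 nb; have [C [Ch Cn]] := E3_splitting a0.
have [c cy] := dom_cover (pi y).
pose phi v := lframe (L := K) c (pi v).
have phi0 : phi y != 0 by exact: canonical_neq0.
have piC : continuous pi by have [] := curve_map Hpi.
have phin : \forall v \near y, phi v != 0.
  have H : nbhs y (fun v => dom c (pi v)) by apply: piC; exact: near_dom.
  by apply: filterS H => v; exact: canonical_neq0.
have dh : hol_at y (fun v => (phi v ^+ (2 * n.-1))^-1 * delta v) := delta_hol Hdelta cy.
have d0 : (phi y ^+ (2 * n.-1))^-1 * delta y != 0.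
  by rewrite mulf_neq0 ?invr_eq0 ?expf_neq0 //; exact: (delta_neq0 Hpi Hdelta).
have [q [qh qE]] := hol_at_sqrt dh d0.
(* Read in the frame of [K^(2n-2)] the section [delta] is the function [q^2], so [e] is a square
   root of [1 / delta]. Its factor [phi ^+ n.-1] is exactly the frame of the twist by [K^(n-1)] in
   the target of [T], so the two cancel. *)
pose e v := (phi v ^+ n.-1 * q v)^-1.
have eE : \forall v \near y, e v * e v = (delta v)^-1.
  apply: filterS2 qE phin => v qv p0.
  rewrite /e -invfM mulrACA qv -exprD addnn -mul2n mulrA mulfV ?mul1r //.
  by rewrite expf_neq0.
have q0 : q y != 0.
  by apply: contra_neq d0 => q0; rewrite -(nbhs_singleton qE) q0 mul0r.
exists (fun v => e v *: (C v *m T v)); split.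
  move=> i iy; have [[V3b _ _] _ _] := perp3.
  have [i3 i3y] := fdom_cover V3b y.
  have Th := @hom_hol_at _ _ _ _ (pull pi V) (tens V3 (pull pi (lpow K n.-1))) setT T i (i3, c) y
    (pc_iso pc).1 I iy (conj i3y cy).
  have H := hol_mxZ (hol_atV qh q0) (hol_mxM (Ch _ i3y) Th).
  apply: hol_mx_ext H; apply: filterS2 phin (fdom_near V3b i3y) => v p0 i3v.
  have fE : frame (b := tens V3 (pull pi (lpow K n.-1))) (i3, c) v = phi v ^+ n.-1 *: frame (b := V3) i3 v.
    by rewrite -lframe_lpow.
  by rewrite fE frame_cancel ?expf_neq0 //; exact: frame_unit i3v.
apply: filterS2 Cn eE => v [f1 f2 [nu f3]] ev; split.
- rewrite f1 -ev trmxZ trmx_mul -!scalemxAl -!scalemxAr -!scalemxAl scalerA.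
  by rewrite !mulmxA.
- rewrite f2 ctrmxZ ctrmx_mul -normfV -ev normrM -!scalemxAl -!scalemxAr -!scalemxAl scalerA.
  by rewrite -expr2 normCK mulrC !mulmxA.
exists nu.
by rewrite -!scalemxAl -mulmxA (pc_phi pc) mulmxA f3 -scalemxAr !mulmxA.
Qed.

End FibreBlock.

Section KernelPoint.
Variables (R : realType) (X : surface R) (N : bundle X 1) (n : nat)
  (E : bundle X (1 + 2 * n)) (Phi w : X -> 'M[R[i]]_(1 + 2 * n))
  (M : bundle X 1) (JM : X -> 'M[R[i]]_(1 + 2 * n, 1))
  (V : bundle X (2 * n)) (J : X -> 'M[R[i]]_(1 + 2 * n, 2 * n))
  (PhiV : X -> 'M[R[i]]_(2 * n)).
Hypotheses (HE : so_higgs N E Phi w) (ker : is_kernel E Phi M JM) (perp : is_perp E Phi w JM V J PhiV).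

Lemma kernel_norm_neq0 x : (spec_poly (Phi x))`_0 != 0 -> ((JM x)^T *m w x *m JM x) 0 0 != 0.
Proof.
rewrite spec0E => a0; have [[_ _ rJM] kJM] := ker.
apply: kernel_nonisotropic (kJM x) (so_phi_skew HE x) (so_form_nondeg HE x) a0.
by rewrite -mxrank_eq0 rJM.
Qed.

Lemma kernel_perp_unit x : (spec_poly (Phi x))`_0 != 0 -> row_mx (JM x) (J x) \in unitmx.
Proof.
move=> a0; have [[_ _ rJ] vJ _] := perp.
exact: row_mx_unit (kernel_norm_neq0 a0) (vJ x) (rJ x).
Qed.

Lemma perp_form_neq0 x : (spec_poly (Phi x))`_0 != 0 -> (J x)^T *m w x *m J x \in unitmx.
Proof.
move=> a0; have [_ vJ _] := perp.
exact: perp_form_unit (so_form_sym HE x) (so_form_nondeg HE x) (vJ x) (kernel_perp_unit a0).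
Qed.

End KernelPoint.

(** * Sheets near an unbranched point *)

Section Fibre.
Variables (R : realType) (X : surface R) (n : nat).
Variables (Phi : X -> 'M[R[i]]_(1 + 2 * n)) (Y : surface R) (pi : Y -> X) (eta : Y -> R[i]).
Let K := canonical X.
Let quot := fun x => quot_poly (Phi x).
Hypothesis (Hpi : is_curve_of (lpow K 2) quot pi eta).

(** Lists of distinct points of the fibre have bounded length, and one of maximal length exhausts
    the fibre. *)
Lemma fibre_seq x : exists s : seq Y, [/\ uniq s, (size s <= n)%N & pi @^-1` [set x] = [set` s]].
Proof.
pose P m := `[< exists s : seq Y, [/\ uniq s, size s = m & forall y, y \in s -> pi y = x] >].
have P0 : exists m, P m by exists 0%N; apply/asboolP; exists [::].
have Pn m : P m -> (m <= n)%N.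
  by move=> /asboolP [s [us <- sx]]; exact: (fibre_le Hpi us sx).
case: (ex_maxnP P0 Pn) => m /asboolP [s [us ss sx]] mmax.
exists s; split=> //; first exact: (fibre_le Hpi us sx).
apply/seteqP; split=> y /=; last exact: sx.
move=> yx; apply/negPn/negP => ys.
have := mmax m.+1; rewrite ltnn => H; suff : false by [].
apply: H; apply/asboolP; exists (y :: s); split=> /=; [by rewrite ys|by rewrite ss|].
by move=> z; rewrite in_cons => /orP[/eqP ->|/sx].
Qed.

Lemma fibre_sum (V : nmodType) (F : Y -> V) x (s : 'I_n -> Y) : injective s -> (forall k, pi (s k) = x) ->
  \sum_(y \in pi @^-1` [set x]) F y = \sum_k F (s k).
Proof.
move=> sI sx; pose t := [seq s k | k <- enum 'I_n].
have ut : uniq t by rewrite map_inj_uniq // enum_uniq.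
have -> : pi @^-1` [set x] = [set` t].
  apply/seteqP; split=> y /=; last by move=> /mapP [k _ ->].
  move=> yx; apply/negPn/negP => yt.
  have := @fibre_le _ _ _ _ _ _ _ Hpi x (y :: t); rewrite /= yt ut size_map size_enum_ord ltnn => H.
  suff : false by []; apply: H => // z; rewrite in_cons => /orP[/eqP ->|/mapP [k _ ->]] //.
by rewrite -fsbig_seq // big_map big_enum.
Qed.

(** Each point of the fibre adds a matrix of rank at most 2, so rank [2 * n] needs [n] points, and
    [fibre_le] allows no more. *)
Lemma full_fibre m (T : Y -> 'M[R[i]]_(2, m)) (t : Y -> 'M[R[i]]_2) x : (2 * n <= \rank (push_form pi T t x))%N ->
  exists2 s : 'I_n -> Y, injective s & forall k, pi (s k) = x.
Proof.
have [s [us sn sx]] := fibre_seq x.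
rewrite /push_form sx -fsbig_seq // => H.
have := leq_trans H (@rank_sum_le _ _ s _ _ (fun y => (T y)^T *m t y *m T y) 2 _).
rewrite leq_mul2l /= => ns.
have {ns}ns : size s = n.
  apply/eqP; rewrite eqn_leq sn; apply: ns => y.
  by apply: leq_trans (mxrankM_maxr _ _) _; exact: rank_leq_row.
have [y0 _] := @point_nonempty _ Y.
exists (fun k : 'I_n => nth y0 s k) => [k l /eqP|k].
  by rewrite nth_uniq ?ns // => /eqP /val_inj.
have sk : [set` s] (nth y0 s k) by apply: mem_nth; rewrite ns.
by rewrite -sx in sk.
Qed.

Lemma local_sections x (s : 'I_n -> Y) : injective s -> (forall k, pi (s k) = x) -> ~ branch_set pi x ->
  exists t : 'I_n -> X -> Y, (forall k, hmap x (t k) /\ t k x = s k) /\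
    \forall u \near x, injective (t^~ u) /\ forall k, pi (t k u) = u.
Proof.
move=> sI sx nb.
have /choice [t tP] : forall k, exists t : X -> Y, [/\ hmap x t, t x = s k & \forall u \near x, pi (t u) = u].
  move=> k; rewrite -(sx k); apply: hmap_local_inverse; first exact: pi_hmap Hpi _.
  have [e ey] := dom_cover (s k); have [c cy] := dom_cover (pi (s k)).
  apply: (dcoord_local_inj ey cy (pi_hmap Hpi _)); apply: unramified => //.
  by rewrite sx.
exists t; split; first by move=> k; have [] := tP k.
(* Distinct points of the fibre over [x] have disjoint neighbourhoods, so the sections through them
   stay distinct near [x]; by the bound on fibres they then enumerate every nearby fibre. *)
have sep k l : \forall u \near x, t k u = t l u -> k = l.
  have [->|kl] := eqVneq k l; first exact: nearW.
  have := @point_hausdorff _ Y; rewrite open_hausdorff => /(_ (s k) (s l)).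
  have -> : s k != s l by apply: contra_neq kl => /sI.
  move=> /(_ isT) [[A B] /= [/set_mem Ak /set_mem Bl] [oA oB /eqP AB0]].
  have [[hk _] tk _] := tP k; have [[hl _] tl _] := tP l.
  have H1 : \forall u \near x, A (t k u) by apply: hk; rewrite tk; exact: open_nbhs_nbhs.
  have H2 : \forall u \near x, B (t l u) by apply: hl; rewrite tl; exact: open_nbhs_nbhs.
  apply: filterS2 H1 H2 => u a b e.
  by have : (A `&` B) (t k u) by [split=> //; rewrite e]; rewrite AB0.
have H1 : \forall u \near x, forall k l, t k u = t l u -> k = l.
  apply: (filter_forall (f := fun k u => forall l, t k u = t l u -> k = l)) => k.
  exact: (filter_forall (f := fun l u => t k u = t l u -> k = l)) (sep k).
have H2 : \forall u \near x, forall k, pi (t k u) = u.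
  by apply: (filter_forall (f := fun k u => pi (t k u) = u)) => k; have [] := tP k.
by apply: filterS2 H1 H2 => u a b; split.
Qed.

End Fibre.

Section BlockHol.
Variables (R : realType) (X : surface R).

Lemma hol_row_mx x m n p (A : X -> 'M[R[i]]_(m, n)) (B : X -> 'M[R[i]]_(m, p)) :
  hol_mx x A -> hol_mx x B -> hol_mx x (fun y => row_mx (A y) (B y)).
Proof.
move=> Ah Bh i j; case: (split_ordP j) => k ->.
  by under eq_fun do rewrite row_mxEl; exact: Ah.
by under eq_fun do rewrite row_mxEr; exact: Bh.
Qed.

Lemma hol_col_mx x m n p (A : X -> 'M[R[i]]_(m, n)) (B : X -> 'M[R[i]]_(p, n)) :
  hol_mx x A -> hol_mx x B -> hol_mx x (fun y => col_mx (A y) (B y)).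
Proof.
move=> Ah Bh i j; case: (split_ordP i) => k ->.
  by under eq_fun do rewrite col_mxEu; exact: Ah.
by under eq_fun do rewrite col_mxEd; exact: Bh.
Qed.

Lemma hol_dsubmx x m n p (A : X -> 'M[R[i]]_(m + n, p)) :
  hol_mx x A -> hol_mx x (fun y => dsubmx (A y)).
Proof. by move=> Ah i j; under eq_fun do rewrite mxE; exact: Ah. Qed.

End BlockHol.

(** * The decomposition read in frames *)

Section FrameBlock.
Variables (K : fieldType) (m : nat) (F : 'M[K]_(1 + m)) (v : 'cV[K]_(1 + m)) (J : 'M[K]_(1 + m, m))
  (G1 : 'M[K]_1) (G : 'M[K]_m).

Lemma frame_blockE : row_mx (invmx F *m v *m G1) (invmx F *m J *m G) =
  invmx F *m row_mx v J *m block_mx G1 0 0 G.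
Proof. by rewrite -[RHS]mulmxA mul_row_block !mulmx0 addr0 add0r mul_mx_row !mulmxA. Qed.

Hypotheses (uF : F \in unitmx) (u1 : G1 \in unitmx) (uG : G \in unitmx).

Lemma frame_form (w : 'M[K]_(1 + m)) p (A : 'M[K]_(1 + m, p)) : (invmx F *m A)^T *m (F^T *m w *m F) = A^T *m w *m F.
Proof. by rewrite trmx_mul trmx_inv !mulmxA mulmxKV ?unitmx_tr. Qed.

Lemma frame_block_unit : (row_mx (invmx F *m v *m G1) (invmx F *m J *m G) \in unitmx) = (row_mx v J \in unitmx).
Proof.
have ub : block_mx G1 0 0 G \in unitmx by rewrite unitmxE det_ublock unitrM -!unitmxE u1 uG.
by rewrite frame_blockE !unitmx_mul unitmx_inv uF ub andbT.
Qed.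

Lemma frame_block_inv p (A : 'M[K]_(p, m)) : row_mx v J \in unitmx ->
  A *m G *m dsubmx (invmx (row_mx (invmx F *m v *m G1) (invmx F *m J *m G))) = A *m dsubmx (invmx (row_mx v J)) *m F.
Proof.
move=> uB; set B := row_mx v J in uB *; set Bh := row_mx _ _.
rewrite -!mulmxA; congr (_ *m _).
have uBh : Bh \in unitmx by rewrite frame_block_unit.
have -> : invmx Bh = block_mx (invmx G1) 0 0 (invmx G) *m (invmx B *m F).
  apply: (can_inj (mulKmx uBh)); rewrite mulmxV // /Bh frame_blockE -/B -!mulmxA.
  rewrite [X in _ = _ *m (_ *m X)]mulmxA mulmx_block !mulmxV // !mulmx0 !mul0mx !addr0 !add0r.
  by rewrite -scalar_mx_block mul1mx mulKVmx // mulVmx.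
rewrite -{1}[invmx B *m F]vsubmxK mul_block_col !mul0mx addr0 add0r col_mxKd mulKVmx //.
by rewrite -{1}[invmx B]vsubmxK mul_col_mx col_mxKd.
Qed.

End FrameBlock.

Section AssembleHol.
Variables (R : realType) (X : surface R) (m : nat) (E : bundle X (1 + m)) (M : bundle X 1) (V : bundle X m)
  (JM : X -> 'M[R[i]]_(1 + m, 1)) (J : X -> 'M[R[i]]_(1 + m, m)) (w : X -> 'M[R[i]]_(1 + m)).
Hypotheses (HE : is_bundle E) (HM : is_bundle M) (HV : is_bundle V).
Hypotheses (hM : hom_hol M E setT JM) (hJ : hom_hol V E setT J) (hw : hom_hol E (dual E) setT w).
Variables (x0 : X) (iE : fidx E) (iM : fidx M) (iV : fidx V).
Hypotheses (xE : fdom iE x0) (xM : fdom iM x0) (xV : fdom iV x0).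
Let F := frame iE. Let G1 := frame iM. Let G := frame iV.

Lemma bundle_unit_near r (B : bundle X r) i : is_bundle B -> fdom (b := B) i x0 ->
  \forall x \near x0, frame i x \in unitmx.
Proof. by move=> HB ix; apply: filterS (fdom_near HB ix) => x; exact: frame_unit. Qed.

Lemma form_frame_hol : hol_mx x0 (fun x => (F x)^T *m w x *m F x).
Proof.
have := hom_hol_at hw I xE xE; apply: hol_mx_ext; apply: nearW => x.
by rewrite /= -trmx_inv invmxK.
Qed.

Lemma kernel_norm_hol : hol_at x0 (fun x => lframe iM x * lframe iM x * ((JM x)^T *m w x *m JM x) 0 0).
Proof.
have H1 := hom_hol_at hM I xM xE.
have := hol_mxM (hol_mxM (hol_mxT H1) form_frame_hol) H1 => /(_ 0 0); apply: hol_at_ext.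
apply: filterS (bundle_unit_near HE xE) => x uF.
rewrite -/(F x) in uF *; rewrite lframeE mul_mx_scalar trmxZ -!scalemxAl -!scalemxAr !scalerA.
by rewrite (frame_form uF) -!mulmxA mulKVmx // mxE.
Qed.

(** The first row contains the pointwise vector [JM], which is holomorphic only after multiplication
    by [lframe iM]; hence the compensating quotient [rho / lframe iM]. In the second block the
    frames of [M] and [V] cancel against those hidden in the inverse of [row_mx (JM x) (J x)]. *)
Lemma assemble_hol (rho : X -> R[i]) (A : X -> 'M[R[i]]_m) : row_mx (JM x0) (J x0) \in unitmx ->
  hol_at x0 (fun x => rho x / lframe iM x) -> hol_mx x0 (fun x => A x *m G x) ->
  hol_mx x0 (fun x => assemble (JM x) (J x) (w x) (rho x) (A x) *m F x).
Proof.
move=> uB rh Ah.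
have H1 := hom_hol_at hM I xM xE; have H2 := hom_hol_at hJ I xV xE.
have nE := bundle_unit_near HE xE; have nM := bundle_unit_near HM xM; have nV := bundle_unit_near HV xV.
have Hb := hol_row_mx H1 H2.
have ub0 : row_mx (invmx (F x0) *m JM x0 *m G1 x0) (invmx (F x0) *m J x0 *m G x0) \in unitmx.
  by rewrite (frame_block_unit _ _ (frame_unit HE xE) (frame_unit HM xM) (frame_unit HV xV)).
have H3 := hol_mxM Ah (hol_dsubmx (hol_mxV Hb ub0)).
have H4 := hol_mxZ rh (hol_mxM (hol_mxT H1) form_frame_hol).
apply: hol_mx_ext (hol_col_mx H4 H3).
apply: filterS3 nE (filterI nM nV) (hol_mx_unit Hb ub0) => x uF [u1 uG] ub.
rewrite -/(F x) -/(G1 x) -/(G x) in uF u1 uG ub *.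
rewrite (frame_block_unit _ _ uF u1 uG) in ub.
rewrite (frame_block_inv uF u1 uG _ ub) /assemble mul_col_mx.
have G1E : G1 x = (lframe iM x)%:M := lframeE iM x.
have l0 : lframe iM x != 0 by move: u1; rewrite G1E unitmxE det_scalar expr1 unitfE.
by rewrite G1E mul_mx_scalar trmxZ -!scalemxAl (frame_form uF) scalerA divfK.
Qed.

End AssembleHol.

(** * The holomorphic Gram factor of the pushforward metric *)

Section LocalGramOfPush.
Variables (R : realType) (X : surface R) (n : nat)
  (E : bundle X (1 + 2 * n)) (Phi w : X -> 'M[R[i]]_(1 + 2 * n))
  (Y : surface R) (pi : Y -> X) (eta delta : Y -> R[i])
  (E3 : bundle Y (1 + 2)) (Phi3 w3 h3 : Y -> 'M[R[i]]_(1 + 2))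
  (M : bundle X 1) (JM : X -> 'M[R[i]]_(1 + 2 * n, 1))
  (V : bundle X (2 * n)) (J : X -> 'M[R[i]]_(1 + 2 * n, 2 * n))
  (PhiV : X -> 'M[R[i]]_(2 * n))
  (M3 : bundle Y 1) (JM3 : Y -> 'M[R[i]]_(1 + 2, 1))
  (V3 : bundle Y 2) (J3 : Y -> 'M[R[i]]_(1 + 2, 2)) (PhiV3 : Y -> 'M[R[i]]_2)
  (T : Y -> 'M[R[i]]_(2, 2 * n)).
Let K := canonical X.
Hypotheses (HE : so_higgs K E Phi w)
  (Hpi : is_curve_of (lpow K 2) (fun x => quot_poly (Phi x)) pi eta)
  (Hdelta : ramification_section pi (pull pi (lpow K (2 * n.-1))) delta)
  (H3 : so_higgs (pull pi K) E3 Phi3 w3)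
  (cp3 : forall y, char_poly (Phi3 y) = 'X * ('X ^+ 2 + (- eta y)%:P))
  (ker : is_kernel E Phi M JM) (perp : is_perp E Phi w JM V J PhiV)
  (ker3 : is_kernel E3 Phi3 M3 JM3) (perp3 : is_perp E3 Phi3 w3 JM3 V3 J3 PhiV3)
  (pc : push_corr pi delta w V J PhiV w3 V3 J3 PhiV3 T)
  (ih3 : is_h3 (pull pi K) E3 Phi3 w3 (fun y => - eta y) h3).

Section Point.
Variable x0 : X.
Hypotheses (a0 : (spec_poly (Phi x0))`_0 != 0) (nb : ~ branch_set pi x0).

Lemma sheet_blocks : exists D : 'I_n -> X -> 'M[R[i]]_(2, 2 * n),
  [/\ forall k i, fdom (b := V) i x0 -> hol_mx x0 (fun x => D k x *m frame (b := V) i x)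
    & \forall x \near x0,
      [/\ push_metric pi T (fun y => `|delta y|^-1 *: ((J3 y)^t* *m h3 y *m J3 y)) x =
            \sum_k (D k x)^t* *m D k x,
          push_form pi T (fun y => (delta y)^-1 *: ((J3 y)^T *m w3 y *m J3 y)) x =
            \sum_k (D k x)^T *m swap2 R *m D k x
        & forall k, exists nu, D k x *m PhiV x = diag2 nu (- nu) *m D k x]].
Proof.
have uJ := perp_form_neq0 HE ker perp a0.
have [s sI sx] : exists2 s : 'I_n -> Y, injective s & forall k, pi (s k) = x0.
  apply: (full_fibre Hpi (T := T) (t := fun y => (delta y)^-1 *: ((J3 y)^T *m w3 y *m J3 y))).
  by rewrite -(pc_form pc nb) mxrank_unit.
have [t [ht tP]] := local_sections Hpi sI sx nb.
have /choice [D DP] := fun k => fibre_block Hpi Hdelta H3 cp3 ker3 perp3 pc ih3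
  (eq_ind_r (fun x => (spec_poly (Phi x))`_0 != 0) a0 (sx k))
  (eq_ind_r (fun x => ~ branch_set pi x) nb (sx k)).
exists (fun k x => D k (t k x)); split => //.
- move=> k i ix; have [hk tk] := ht k; have [Dh _] := DP k.
  rewrite sx in Dh; rewrite -tk in Dh.
  have := hmap_hol_mx hk (Dh i ix); apply: hol_mx_ext.
  by apply: filterS tP => x [_ e]; rewrite /= e.
have nD : \forall x \near x0, forall k,
     [/\ (T (t k x))^T *m ((delta (t k x))^-1 *: ((J3 (t k x))^T *m w3 (t k x) *m J3 (t k x))) *m T (t k x)
           = (D k (t k x))^T *m swap2 R *m D k (t k x),
         (T (t k x))^t* *m (`|delta (t k x)|^-1 *: ((J3 (t k x))^t* *m h3 (t k x) *m J3 (t k x))) *m T (t k x)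
           = (D k (t k x))^t* *m D k (t k x)
      & exists nu, D k (t k x) *m PhiV (pi (t k x)) = diag2 nu (- nu) *m D k (t k x)].
  apply: filter_forall => k; have [hk tk] := ht k; have [_] := DP k.
  by rewrite -tk; exact: hk.1.
apply: filterS2 nD tP => x DE [tI tx].
split; last by move=> k; have [_ _ [nu Dnu]] := DE k; exists nu; rewrite tx in Dnu.
  by rewrite /push_metric (fibre_sum Hpi _ tI tx); apply: eq_bigr => k _; have [] := DE k.
by rewrite /push_form (fibre_sum Hpi _ tI tx); apply: eq_bigr => k _; have [] := DE k.
Qed.

Lemma rot2_stack (D : 'I_n -> 'M[R[i]]_(2, 2 * n)) :
  (stack (fun k => rot2 R *m D k))^T *m stack (fun k => rot2 R *m D k) =
    \sum_k (D k)^T *m swap2 R *m D k /\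
  (stack (fun k => rot2 R *m D k))^t* *m stack (fun k => rot2 R *m D k) = (stack D)^t* *m stack D.
Proof.
split; first by rewrite stack_tr; apply: eq_bigr => k _; rewrite trmx_mul -rot2_form !mulmxA.
rewrite !stack_herm; apply: eq_bigr => k _.
by rewrite ctrmx_mul -mulmxA (mulmxA ((rot2 R)^t*)) rot2_herm mul1mx.
Qed.

Lemma unitmx_ctr m (A : 'M[R[i]]_m) : (A^t* *m A \in unitmx) = (A \in unitmx).
Proof. by rewrite unitmx_mul ctrmx_unit andbb. Qed.

Lemma diag_normal m (u : 'rV[R[i]]_m) :
  let La := block_mx (0 : 'M[R[i]]_(1, 1)) 0 0 (diag_mx u) in
  La *m La^t* = La^t* *m La.
Proof.
move=> La; rewrite /La tr_block_mx map_block_mx !trmx0 !map_mx0 tr_diag_mx map_diag_mx.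
by rewrite !mulmx_block !mulmx0 !mul0mx !addr0 !add0r diag_mxC.
Qed.

Lemma local_gram : exists Q : X -> 'M[R[i]]_(1 + 2 * n),
    [/\ forall i, fdom (b := E) i x0 -> hol_mx x0 (fun x => Q x *m frame (b := E) i x),
        \forall x \near x0, h_dc pi delta w JM J J3 T h3 x = (Q x)^t* *m Q x,
        Q x0 \in unitmx, compatible (w x0) (h_dc pi delta w JM J J3 T h3 x0)
      & exists2 La, Q x0 *m Phi x0 = La *m Q x0 & La *m La^t* = La^t* *m La].
Proof.
have [D [Dh Dn]] := sheet_blocks.
have [[[HM hM _] kM] [[HV hJ rJ] vJ PJ]] := (ker, perp).
have HB := so_bundle HE; have hw := so_form_hol HE; have ws := so_form_sym HE.
have [iM xM] := fdom_cover HM x0; have [iV xV] := fdom_cover HV x0; have [iE xE] := fdom_cover HB x0.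
pose a x := ((JM x)^T *m w x *m JM x) 0 0.
have ah : hol_at x0 (fun x => lframe iM x * lframe iM x * a x) := kernel_norm_hol HB hM hw xE xM.
have l0 := lframe_neq0 HM xM.
have a00 : lframe iM x0 * lframe iM x0 * a x0 != 0.
  by rewrite mulf_neq0 ?mulf_neq0 //; exact: (kernel_norm_neq0 HE ker a0).
have [s [sh sE]] := hol_at_sqrt ah a00.
have s0 : s x0 != 0 by apply: contra_neq a00 => s0; rewrite -(nbhs_singleton sE) s0 mul0r.
(* [s] is a holomorphic square root of [w] on the section [lframe iM *: JM] of the kernel. This
   choice makes [rho ^+ 2 * a = 1], while [rho / lframe iM] is [1 / s]. *)
pose rho x := lframe iM x / s x.
have rhoE : \forall x \near x0, rho x * rho x * a x = 1.
  apply: filterS2 sE (hol_at_neq0 sh s0) => x e sx0.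
  have -> : rho x * rho x * a x = lframe iM x * lframe iM x * a x / (s x * s x).
    by rewrite /rho; field.
  by rewrite e divff // -e mulf_neq0.
have rE := nbhs_singleton rhoE.
have unitB x : rho x * rho x * a x = 1 -> row_mx (JM x) (J x) \in unitmx.
  move=> e; apply: row_mx_unit (vJ x) (rJ x).
  by apply/eqP => v0; move/eqP: e; rewrite /a v0 mulr0 eq_sym oner_eq0.
pose A x := stack (fun k => D k x).
pose Q x := assemble (JM x) (J x) (w x) (rho x) (A x).
have hE : \forall x \near x0, h_dc pi delta w JM J J3 T h3 x = (Q x)^t* *m Q x.
  apply: filterS2 Dn rhoE => x [e _ _] e1.
  by rewrite /Q (assemble_herm (unitB _ e1) (vJ x) e1) stack_herm /h_dc e.
have uB := unitB _ rE.
have [_ De eig] := nbhs_singleton Dn.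
have [rT rH] := rot2_stack (fun k => D k x0).
(* [A'] differs from [A x0] by a unitary matrix, so it has the same Gram matrix for the metric, but
   it writes the form as a sum of squares. The form being invertible, so is [A'], and equality of
   the Gram matrices passes this on to [A x0]. *)
set A' := stack _ in rT rH.
have JA' : A'^T *m A' = (J x0)^T *m w x0 *m J x0 by rewrite (pc_form pc nb) De.
have uA' : A' \in unitmx.
  by have := perp_form_neq0 HE ker perp a0; rewrite -JA' unitmx_mul => /andP[].
have uA : A x0 \in unitmx by rewrite -unitmx_ctr -rH unitmx_ctr.
exists Q; split => //.
- move=> i xi; apply: (assemble_hol HB HM HV hM hJ hw xi xM xV uB).
    apply: hol_at_ext (hol_atV sh s0); apply: filterS (bundle_unit_near HM xM) => x u.
    have lx : lframe iM x != 0 by move: u; rewrite lframeE unitmxE det_scalar expr1 unitfE.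
    by rewrite /rho mulrAC divff // mul1r.
  move=> r j; move: r; apply: stack_ind => b k.
  have := Dh k _ xV b j; apply: hol_at_ext; apply: nearW => x.
  by rewrite stack_mul stackE.
- exact: (assemble_unit (rho := rho x0) uB (vJ x0) rE uA).
(* [Q'] factors both structures, [Q'^T *m Q' = w] and [Q'^t* *m Q' = h]; the columns of its inverse
   are therefore orthonormal for both. *)
- pose Q' := assemble (JM x0) (J x0) (w x0) (rho x0) A'.
  have uQ' : Q' \in unitmx by exact: (assemble_unit (rho := rho x0) uB (vJ x0) rE uA').
  have wQ : Q'^T *m Q' = w x0 by exact: (assemble_form (rho := rho x0) uB (ws x0) (vJ x0) rE JA').
  have hQ : Q'^t* *m Q' = h_dc pi delta w JM J J3 T h3 x0.
    have hA B := assemble_herm (rho := rho x0) uB (vJ x0) rE B.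
    rewrite (nbhs_singleton hE); apply: etrans (hA A') _; rewrite rH.
    exact: esym (hA (A x0)).
  exists (invmx Q'); rewrite -hQ -wQ; split.
    by rewrite mulmxA -trmx_mul -mulmxA mulmxV // trmx1 mul1mx.
  by rewrite mulmxA -ctrmx_mul -mulmxA mulmxV // ctrmx_scalar rmorph1 mul1mx.
have /choice [nu Dnu] := eig.
have [u uE] := stack_eigen Dnu.
exists (block_mx 0 0 0 (diag_mx u)); last exact: diag_normal.
exact: (assemble_eigen (rho x0) uB (vJ x0) (kM x0) (PJ x0) uE).
Qed.

End Point.
End LocalGramOfPush.

Theorem theorem5p12 (R : realType) (X : surface R) (g n : nat)
  (E : bundle X (1 + 2 * n)) (Phi w : X -> 'M[R[i]]_(1 + 2 * n))
  (Y : surface R) (pi : Y -> X) (eta delta : Y -> R[i])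
  (E3 : bundle Y (1 + 2)) (Phi3 w3 h3 : Y -> 'M[R[i]]_(1 + 2))
  (M : bundle X 1) (JM : X -> 'M[R[i]]_(1 + 2 * n, 1))
  (V : bundle X (2 * n)) (J : X -> 'M[R[i]]_(1 + 2 * n, 2 * n))
  (PhiV : X -> 'M[R[i]]_(2 * n))
  (M3 : bundle Y 1) (JM3 : Y -> 'M[R[i]]_(1 + 2, 1))
  (V3 : bundle Y 2) (J3 : Y -> 'M[R[i]]_(1 + 2, 2)) (PhiV3 : Y -> 'M[R[i]]_2)
  (T : Y -> 'M[R[i]]_(2, 2 * n)) :
  let K := canonical X in
  let spec := fun x => spec_poly (Phi x) in
  let quot := fun x => quot_poly (Phi x) in
  let b2 := fun y => - eta y in
  let a2n := fun x => (spec x)`_0 in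
  genus X g -> (2 <= g)%N -> (1 <= n)%N ->
  so_higgs K E Phi w ->
  irreducible_div K spec -> reduced_div K (2 * n) spec ->
  smooth_div (lpow K 2) n quot ->
  is_curve_of (lpow K 2) quot pi eta ->
  ramification_section pi (pull pi (lpow K (2 * n.-1))) delta ->
  so_higgs (pull pi K) E3 Phi3 w3 ->
  (forall y, char_poly (Phi3 y) = 'X * ('X ^+ 2 + (b2 y)%:P)) ->
  is_kernel E Phi M JM -> is_perp E Phi w JM V J PhiV ->
  is_kernel E3 Phi3 M3 JM3 -> is_perp E3 Phi3 w3 JM3 V3 J3 PhiV3 ->
  push_corr pi delta w V J PhiV w3 V3 J3 PhiV3 T ->
  is_h3 (pull pi K) E3 Phi3 w3 b2 h3 ->
  decoupled_solution E Phi w ([set x | a2n x = 0] `|` branch_set pi)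
    (h_dc pi delta w JM J J3 T h3).
Proof.
move=> K spec quot b2 a2n _ _ _ HE _ _ _ Hpi Hdelta H3 cp3 ker perp ker3 perp3 pc ih3.
apply: solution_of_local_gram (so_bundle HE) _ => x0 Sx.
apply: (local_gram HE Hpi Hdelta H3 cp3 ker perp ker3 perp3 pc ih3).
  by apply/eqP => e; apply: Sx; left.
by move=> b; apply: Sx; right.
Qed.
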